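(* Let $(M^n,g)$ be a closed Riemannian manifold, let $2\le d\le n-1$, and set $$\kappa_d:=d(n-d)\,\inf_{p\in M,\ \Pi\in G_d(T_pM)}\overline{\mathrm{Ric}}^{\perp}_{\Pi}.$$ If $\kappa_d>0$, then there are no nonzero harmonic simple $d$-vector fields on $M$; that is, every smooth pointwise simple $d$-vector field $V$ on $M$ with $\Delta_HV=0$ vanishes identically.
   Context: Closed means compact without boundary. $G_d(T_pM)$ is the Grassmannian of $d$-dimensional linear subspaces of $T_pM$. $\nabla$ is the Levi-Civita connection, $R(X,Y)Z=\nabla_X\nabla_YZ-\nabla_Y\nabla_XZ-\nabla_{[X,Y]}Z$, and for orthonormal $u,v\in T_pM$, $K(u,v)=g(R(u,v)v,u)$ is the sectional curvature of $\mathrm{span}\{u,v\}$. For a $d$-dimensional subspace $\Pi\subset T_pM$ with orthonormal basis $\{e_1,\dots,e_d\}$ and an orthonormal basis $\{n_1,\dots,n_{n-d}\}$ of $\Pi^\perp$, the mean normal Ricci curvature is $$\overline{\mathrm{Ric}}^{\perp}_{\Pi}=\frac{1}{d(n-d)}\sum_{i=1}^{d}\sum_{\alpha=1}^{n-d}K(e_i,n_\alpha),$$ which does not depend on the choice of bases. A $d$-vector field is a section of $\Lambda^dTM$; it is (pointwise) simple if at each point $p$ its value is of the form $v_1\wedge\cdots\wedge v_d$ with $v_i\in T_pM$ (the value $0$ is allowed). $\Delta_H$ denotes the Hodge (Lichnerowicz) Laplacian on $d$-vector fields, i.e. the Hodge Laplacian on $d$-forms ($d\delta+\delta d$, where in this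 expression $d$ is the exterior derivative and $\delta$ its formal adjoint) transported to $\Lambda^dTM$ by the musical isomorphism. A $d$-vector field $V$ is harmonic if $\Delta_HV=0$. *)

(* Defs.v *)
From HB Require Import structures.
From mathcomp Require Import all_boot all_order all_fingroup all_algebra.
From mathcomp Require Import all_classical all_reals all_analysis.
Set Implicit Arguments.
Unset Strict Implicit.
Unset Printing Implicit Defensive.
Import Order.TTheory GRing.Theory Num.Theory numFieldNormedType.Exports.
Local Open Scope classical_set_scope.
Local Open Scope ring_scope.

(* A manifold is given by an atlas, and
   tensor fields by their components in every chart, related by the tensor
   transformation law. Differential operators are computed in charts. *)

Definition partial (R : realType) (n : nat) (i : 'I_n) (f : 'rV[R]_n -> R)
  (x : 'rV[R]_n) : R := 'D_('e_i) f x.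

Fixpoint Cn_on (R : realType) (n k : nat) (U : set 'rV[R]_n)
    (f : 'rV[R]_n -> R) : Prop :=
  (forall x, U x -> {for x, continuous f}) /\
  (if k is k'.+1 then
     forall i : 'I_n, (forall x, U x -> derivable f x 'e_i) /\
                      Cn_on k' U (partial i f)
   else True).

(* Meant for open U. *)
Definition smooth_on (R : realType) (n : nat) (U : set 'rV[R]_n)
  (f : 'rV[R]_n -> R) : Prop := forall k, Cn_on k U f.

(* Charts take values in open subsets of R^n, so there is no boundary. *)
Record smoothAtlas (R : realType) (n : nat) (M : topologicalType) := SmoothAtlas {
  chart : Type;
  dom : chart -> set M;
  img : chart -> set 'rV[R]_n;
  phi : chart -> M -> 'rV[R]_n;
  psi : chart -> 'rV[R]_n -> M;
  atlas_cover : forall p, exists a, dom a p;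
  dom_open : forall a, open (dom a);
  img_open : forall a, open (img a);
  phi_img : forall a p, dom a p -> img a (phi a p);
  psi_dom : forall a x, img a x -> dom a (psi a x);
  phiK : forall a p, dom a p -> psi a (phi a p) = p;
  psiK : forall a x, img a x -> phi a (psi a x) = x;
  phi_cont : forall a p, dom a p -> {for p, continuous (phi a)};
  psi_cont : forall a x, img a x -> {for x, continuous (psi a)};
  transition_smooth : forall a b (j : 'I_n),
    smooth_on (img a `&` psi a @^-1` dom b) (fun x => phi b (psi a x) 0 j)
}.

(* Differential at p of the change of coordinates from chart a to chart b, in
   row-vector convention: a tangent vector with components v in chart a has
   components v *m jac a b p in chart b. *)
Definition jac (R : realType) (n : nat) (M : topologicalType)
    (A : smoothAtlas R n M) (a b : chart A) (p : M) : 'M[R]_n :=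
  \matrix_(i, j) partial i (fun y => phi b (psi a y) 0 j) (phi a p).

Record riemMetric (R : realType) (n : nat) (M : topologicalType)
    (A : smoothAtlas R n M) := RiemMetric {
  gmx :> chart A -> 'rV[R]_n -> 'M[R]_n;
  gmx_sym : forall a x, img a x -> (gmx a x)^T = gmx a x;
  gmx_posdef : forall a x (v : 'rV[R]_n), img a x -> v != 0 ->
    0 < (v *m gmx a x *m v^T) 0 0;
  gmx_smooth : forall a i j, smooth_on (img a) (fun x => gmx a x i j);
  gmx_change : forall a b p, dom a p -> dom b p ->
    gmx a (phi a p) = jac a b p *m gmx b (phi b p) *m (jac a b p)^T
}.

(* In what follows G is the matrix field of a metric in one chart. *)

Definition ginner (R : realType) (n : nat) (g : 'M[R]_n) (u v : 'rV[R]_n) : R :=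
  (u *m g *m v^T) 0 0.

(* Christoffel symbol Gamma^k_(i j) of the Levi-Civita connection. *)
Definition christoffel (R : realType) (n : nat) (G : 'rV[R]_n -> 'M[R]_n)
    (k i j : 'I_n) (x : 'rV[R]_n) : R :=
  2^-1 * \sum_(l < n) invmx (G x) k l *
    (partial i (fun y => G y j l) x + partial j (fun y => G y i l) x
     - partial l (fun y => G y i j) x).

Definition nabla (R : realType) (n : nat) (G : 'rV[R]_n -> 'M[R]_n)
    (X Y : 'rV[R]_n -> 'rV[R]_n) (x : 'rV[R]_n) : 'rV[R]_n :=
  \row_k (\sum_(i < n) X x 0 i * partial i (fun y => Y y 0 k) x +
          \sum_(i < n) \sum_(j < n) christoffel G k i j x * X x 0 i * Y x 0 j).

Definition lie_bracket (R : realType) (n : nat) (X Y : 'rV[R]_n -> 'rV[R]_n)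
    (x : 'rV[R]_n) : 'rV[R]_n :=
  \row_k \sum_(i < n) (X x 0 i * partial i (fun y => Y y 0 k) x -
                       Y x 0 i * partial i (fun y => X y 0 k) x).

Definition riemann (R : realType) (n : nat) (G : 'rV[R]_n -> 'M[R]_n)
    (X Y Z : 'rV[R]_n -> 'rV[R]_n) (x : 'rV[R]_n) : 'rV[R]_n :=
  nabla G X (nabla G Y Z) x - nabla G Y (nabla G X Z) x
  - nabla G (lie_bracket X Y) Z x.

(* K(u,v) for orthonormal u, v; by tensoriality of the curvature, u and v may be
   extended to vector fields with constant components. *)
Definition sectional (R : realType) (n : nat) (G : 'rV[R]_n -> 'M[R]_n)
    (x u v : 'rV[R]_n) : R :=
  ginner (G x) (riemann G (cst u) (cst v) (cst v) x) u.

Definition orthonormal_basis (R : realType) (n m : nat) (g : 'M[R]_n)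
    (S : set 'rV[R]_n) (e : 'I_m -> 'rV[R]_n) : Prop :=
  [/\ forall i, S (e i),
      forall i j, ginner g (e i) (e j) = (i == j)%:R &
      forall v, S v -> exists c : 'I_m -> R, v = \sum_(i < m) c i *: e i].

Definition gperp (R : realType) (n : nat) (g : 'M[R]_n) (P : {vspace 'rV[R]_n})
  : set 'rV[R]_n := [set v | forall w, w \in P -> ginner g v w = 0].

(* [get] picks the common value over all choices of bases. *)
Definition mean_normal_ricci (R : realType) (n d : nat)
    (G : 'rV[R]_n -> 'M[R]_n) (x : 'rV[R]_n) (P : {vspace 'rV[R]_n}) : R :=
  get [set r : R | exists (e : 'I_d -> 'rV[R]_n) (nu : 'I_(n - d) -> 'rV[R]_n),
    [/\ orthonormal_basis (G x) [set v | v \in P] e,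
        orthonormal_basis (G x) (gperp (G x) P) nu &
        r = ((d * (n - d))%:R)^-1 *
            \sum_(i < d) \sum_(j < n - d) sectional G x (e i) (nu j)]].

Definition kappa (R : realType) (n d : nat) (M : topologicalType)
    (A : smoothAtlas R n M) (g : riemMetric A) : \bar R :=
  ((d * (n - d))%:R%:E *
   ereal_inf [set r | exists (p : M) (a : chart A) (P : {vspace 'rV[R]_n}),
     [/\ dom a p, \dim P = d &
         r = (mean_normal_ricci d (g a) (phi a p) P)%:E]])%E.

(* Components T_(i_1 .. i_k), resp. T^(i_1 .. i_k), of a k-tensor. *)
Definition tensor (R : realType) (n k : nat) : Type :=
  {ffun 'I_k -> 'I_n} -> R.

Definition alternating_tensor (R : realType) (n k : nat) (T : tensor R n k) : Prop :=
  forall (s : 'S_k) (I : {ffun 'I_k -> 'I_n}),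
    T [ffun l => I (s l)] = (-1) ^+ s * T I.

Definition tfield (R : realType) (n k : nat) : Type :=
  'rV[R]_n -> tensor R n k.

Definition smooth_tfield (R : realType) (n k : nat) (U : set 'rV[R]_n)
    (w : tfield R n k) : Prop := forall I, smooth_on U (fun x => w x I).

(* Lambda^k of the tangent space is identified with the alternating
   contravariant k-tensors, the components of v_1 /\ ... /\ v_k being the
   k x k minors of the matrix with rows v_1, ..., v_k. *)
Definition wedge (R : realType) (n k : nat) (v : 'I_k -> 'rV[R]_n)
  : tensor R n k := fun I => \det (\matrix_(i < k, j < k) v i 0 (I j)).

Definition ext_deriv (R : realType) (n k : nat) (w : tfield R n k)
  : tfield R n k.+1 := fun x I =>
  \sum_(j < k.+1) (-1) ^+ j *
    partial (I j) (fun y => w y [ffun l => I (lift j l)]) x.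

(* Pointwise inner product of forms; the factor 1/k! makes the wedge products of
   an orthonormal coframe orthonormal. *)
Definition form_inner (R : realType) (n k : nat) (g : 'M[R]_n)
    (T S : tensor R n k) : R :=
  (k`!%:R)^-1 * \sum_(I : {ffun 'I_k -> 'I_n}) \sum_(J : {ffun 'I_k -> 'I_n})
    (\prod_(l < k) invmx g (I l) (J l)) * T I * S J.

(* Lebesgue integral over R^n as an iterated integral; only used for continuous
   compactly supported integrands. *)
Fixpoint integral_rV (R : realType) (n : nat) : ('rV[R]_n -> R) -> R :=
  if n is m.+1 return ('rV[R]_n -> R) -> R then
    fun f => Rintegral (@lebesgue_measure R) [set: R]
      (fun t => integral_rV (fun y : 'rV[R]_m => f (row_mx (const_mx t : 'rV_1) y)))
  else fun f => f 0.

(* L^2 product for the Riemannian volume sqrt (det g) dx. *)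
Definition L2_inner (R : realType) (n k : nat) (G : 'rV[R]_n -> 'M[R]_n)
    (w t : tfield R n k) : R :=
  integral_rV (fun x => form_inner (G x) (w x) (t x) * Num.sqrt (\det (G x))).

Definition test_form (R : realType) (n k : nat) (U : set 'rV[R]_n)
    (w : tfield R n k) : Prop :=
  [/\ forall x, alternating_tensor (w x), smooth_tfield [set: 'rV[R]_n] w &
      exists K : set 'rV[R]_n, [/\ compact K, K `<=` U &
        forall x, ~ K x -> forall I, w x I = 0]].

(* delta w, for the formal adjoint delta of the exterior derivative with respect
   to the metric G on U: the form on U, unique on U, such that
   (d eta, w) = (eta, delta w) for every test form eta. Its values outside U are
   irrelevant. *)
Definition codiff (R : realType) (n k : nat) (G : 'rV[R]_n -> 'M[R]_n)
    (U : set 'rV[R]_n) (w : tfield R n k.+1) : tfield R n k :=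
  xget (fun _ _ => 0) [set t : tfield R n k |
    [/\ forall x, U x -> alternating_tensor (t x), smooth_tfield U t &
        forall eta : tfield R n k, test_form U eta ->
          L2_inner G (ext_deriv eta) w = L2_inner G eta t]].

Definition hodge_laplacian_form (R : realType) (n k : nat)
    (G : 'rV[R]_n -> 'M[R]_n) (U : set 'rV[R]_n)
  : tfield R n k -> tfield R n k :=
  if k is k'.+1 return tfield R n k -> tfield R n k then
    fun w x I => ext_deriv (codiff G U w) x I + codiff G U (ext_deriv w) x I
  else fun w => codiff G U (ext_deriv w).

Definition flat (R : realType) (n k : nat) (G : 'rV[R]_n -> 'M[R]_n)
    (V : tfield R n k) : tfield R n k := fun x I =>
  \sum_(J : {ffun 'I_k -> 'I_n}) (\prod_(l < k) G x (I l) (J l)) * V x J.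

Definition sharp (R : realType) (n k : nat) (G : 'rV[R]_n -> 'M[R]_n)
    (w : tfield R n k) : tfield R n k := fun x I =>
  \sum_(J : {ffun 'I_k -> 'I_n}) (\prod_(l < k) invmx (G x) (I l) (J l)) * w x J.

Definition hodge_laplacian (R : realType) (n k : nat) (G : 'rV[R]_n -> 'M[R]_n)
    (U : set 'rV[R]_n) (V : tfield R n k) : tfield R n k :=
  sharp G (hodge_laplacian_form G U (flat G V)).

(* Smooth section of Lambda^d TM. *)
Record multivectorField (R : realType) (n d : nat) (M : topologicalType)
    (A : smoothAtlas R n M) := MultivectorField {
  mvcomp :> chart A -> tfield R n d;
  mv_alt : forall a x, img a x -> alternating_tensor (mvcomp a x);
  mv_smooth : forall a, smooth_tfield (img a) (mvcomp a);
  mv_change : forall a b p, dom a p -> dom b p ->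
    forall I : {ffun 'I_d -> 'I_n},
    mvcomp b (phi b p) I = \sum_(J : {ffun 'I_d -> 'I_n})
      (\prod_(l < d) jac a b p (J l) (I l)) * mvcomp a (phi a p) J
}.

Definition simple_mv (R : realType) (n d : nat) (M : topologicalType)
    (A : smoothAtlas R n M) (V : multivectorField d A) : Prop :=
  forall (p : M) (a : chart A), dom a p ->
    exists v : 'I_d -> 'rV[R]_n, V a (phi a p) = wedge v.

Definition harmonic_mv (R : realType) (n d : nat) (M : topologicalType)
    (A : smoothAtlas R n M) (g : riemMetric A) (V : multivectorField d A) : Prop :=
  forall (p : M) (a : chart A), dom a p ->
    forall I, hodge_laplacian (g a) (img a) (V a) (phi a p) I = 0.

(* Main.v *)
Require Import Defs.
From HB Require Import structures.
From mathcomp Require Import all_boot all_order all_algebra.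
From mathcomp Require Import all_classical all_reals all_analysis.
From mathcomp Require Import fingroup perm ring lra.

(** The proof is the Bochner method. On [d]-vector fields the Hodge Laplacian is
    minus the sum of the trace of the second covariant derivative and of a
    curvature term ([hodge_laplacianE], from the Weitzenboeck formula
    [weitzenboeck]). If [V = c e_1 /\ ... /\ e_d] with [e] orthonormal, the
    pairing of the curvature term with [V] is [- d! c^2] times the sum of the
    sectional curvatures [K (e_i, nu_j)] over an orthonormal basis [nu] of the
    orthogonal complement ([curvature_wdg]); for simple [V] only mixed curvatures
    of a subspace and its complement occur, and the sign of their sum is what
    [kappa_d > 0] controls.

    On the compact manifold the squared norm of [V] attains its maximum. There
    the Bochner identity ([bochner]), the first and second derivative tests
    ([partial_max], [hessian_max]) and harmonicity show that this pairing is
    nonnegative ([rough_laplacian_max]). Positivity of the normal Ricci sum then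
    forces [c = 0] ([harmonic_max]): the maximum of the squared norm is zero, and
    [V] vanishes ([simple_harmonic_vanish]). Working at a maximum replaces the
    integration over the manifold of the usual Bochner argument by a computation
    in one chart.

    The tensor calculus is carried out over an arbitrary commutative ring with
    commuting derivations. Exterior multiplication [eps] and contraction [iota]
    satisfy the canonical anticommutation relation [iota_eps], and together with
    the way covariant derivatives commute with them and with each other this
    yields the Weitzenboeck formula by pure algebra. The ring of smooth functions
    on the image of a chart, with partial derivatives as derivations, is then
    substituted: partial derivatives commute by Schwarz' theorem [partialC].

    The codifferential is defined as a formal adjoint, through integrals against
    test forms. It equals minus the metric divergence ([codiffE]): the two
    pairings differ by the integral of a divergence ([adjoint_divergence]), which
    vanishes for compactly supported fields ([integral_partial]), and the adjoint
    is unique because test forms can be localized by bump functions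
    ([exists_bump]). *)

Set Implicit Arguments.
Unset Strict Implicit.
Unset Printing Implicit Defensive.
Import Order.TTheory GRing.Theory Num.Theory numFieldNormedType.Exports.
Local Open Scope classical_set_scope.
Local Open Scope ring_scope.

(** * Tensor algebra over a commutative ring *)

Section MultiIndex.
Variable n : nat.
Local Notation idx k := {ffun 'I_k -> 'I_n}.

Definition icons k (b : 'I_n) (I : idx k) : idx k.+1 :=
  [ffun l => if unlift ord0 l is Some l' then I l' else b].
Definition iomit k (j : 'I_k.+1) (I : idx k.+1) : idx k :=
  [ffun l => I (lift j l)].
Definition iupd k (I : idx k) (l : 'I_k) (m : 'I_n) : idx k :=
  [ffun i => if i == l then m else I i].
Definition iperm k (s : 'S_k) (I : idx k) : idx k := [ffun l => I (s l)].

Lemma icons0 k b (I : idx k) : icons b I ord0 = b.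
Proof. by rewrite ffunE unlift_none. Qed.

Lemma iconsS k b (I : idx k) l : icons b I (lift ord0 l) = I l.
Proof. by rewrite ffunE liftK. Qed.

Lemma iomit0_cons k b (I : idx k) : iomit ord0 (icons b I) = I.
Proof. by apply/ffunP => l; rewrite ffunE iconsS. Qed.

Lemma icons_omit0 k (I : idx k.+1) : icons (I ord0) (iomit ord0 I) = I.
Proof.
apply/ffunP => l; rewrite ffunE; case: unliftP => [l' ->|->] //.
by rewrite ffunE.
Qed.

Lemma iomitS_cons k b (I : idx k.+1) j :
  iomit (lift ord0 j) (icons b I) = icons b (iomit j I).
Proof.
apply/ffunP => l; rewrite !ffunE; case: (unliftP ord0 l) => [l' ->|->].
  rewrite ffunE.
  have -> : lift (lift ord0 j) (lift ord0 l') = lift ord0 (lift j l').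
    by apply: val_inj; rewrite /= /bump /= !add1n ltnS addnS.
  by rewrite liftK.
have -> : lift (lift ord0 j) ord0 = ord0 by apply: val_inj.
by rewrite unlift_none.
Qed.

Lemma iupd_cons0 k b (I : idx k) m : iupd (icons b I) ord0 m = icons m I.
Proof.
apply/ffunP => l; rewrite !ffunE; case: unliftP => [l' ->|->].
  by rewrite eq_sym (negbTE (neq_lift _ _)).
by rewrite eqxx.
Qed.

Lemma iupd_consS k b (I : idx k) l m :
  iupd (icons b I) (lift ord0 l) m = icons b (iupd I l m).
Proof.
apply/ffunP => i; rewrite !ffunE; case: (unliftP ord0 i) => [i' ->|->].
  by rewrite (inj_eq lift_inj) ffunE.
by rewrite (negbTE (neq_lift _ _)).
Qed.

Lemma iupd_same k (I : idx k) l m m' : iupd (iupd I l m) l m' = iupd I l m'.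
Proof. by apply/ffunP => i; rewrite !ffunE; case: eqP. Qed.

Lemma iupd_comm k (I : idx k) l l' m m' : l != l' ->
  iupd (iupd I l m) l' m' = iupd (iupd I l' m') l m.
Proof.
move=> ll'; apply/ffunP => i; rewrite !ffunE.
by case: (altP (i =P l)) => [->|//]; rewrite (negbTE ll').
Qed.

Lemma iupd_id k (I : idx k) l : iupd I l (I l) = I.
Proof. by apply/ffunP => i; rewrite !ffunE; case: eqP => [->|]. Qed.

Lemma iomit_upd k (I : idx k.+1) j m : iomit j (iupd I j m) = iomit j I.
Proof.
by apply/ffunP => i; rewrite !ffunE eq_sym (negbTE (neq_lift _ _)).
Qed.

Lemma iomit_upd_lift k (I : idx k.+1) j l m :
  iomit j (iupd I (lift j l) m) = iupd (iomit j I) l m.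
Proof. by apply/ffunP => i; rewrite !ffunE (inj_eq lift_inj). Qed.

Lemma iperm_upd k (s : 'S_k) (I : idx k) l m :
  iupd (iperm s I) l m = iperm s (iupd I (s l) m).
Proof. by apply/ffunP => i; rewrite !ffunE (inj_eq perm_inj). Qed.

Lemma iperm_cons k (s : 'S_k) (I : idx k) b :
  icons b (iperm s I) = iperm (lift_perm ord0 ord0 s) (icons b I).
Proof.
apply/ffunP => i; rewrite !ffunE; case: (unliftP ord0 i) => [i' ->|->].
  by rewrite lift_perm_lift liftK ffunE.
by rewrite lift_perm_id unlift_none.
Qed.

(** Moving the entry in slot [j] to the front is a cycle of length [j + 1]. *)
Lemma icons_omit k (I : idx k.+1) j m :
  iperm (lift_perm j ord0 1) (icons m (iomit j I)) = iupd I j m.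
Proof.
apply/ffunP => i; rewrite !ffunE; case: (unliftP j i) => [i' ->|->].
  rewrite lift_perm_lift liftK perm1 ffunE.
  by rewrite eq_sym (negbTE (neq_lift _ _)).
by rewrite lift_perm_id unlift_none eqxx.
Qed.

Lemma iperm_cons2 k (I : idx k) l a m :
  iperm (tperm ord0 (lift ord0 l)) (icons a (iupd I l m)) =
  icons m (iupd I l a).
Proof.
apply/ffunP => i; rewrite !ffunE; case: (unliftP ord0 i) => [i' ->|->].
  case: (altP (i' =P l)) => [->|il].
    by rewrite tpermR unlift_none ffunE eqxx.
  rewrite tpermD ?liftK ?ffunE ?(negbTE il) ?neq_lift //.
  by rewrite (inj_eq lift_inj) eq_sym.
by rewrite tpermL liftK ffunE eqxx.
Qed.

Lemma sum_icons (V : nmodType) k (F : idx k.+1 -> V) :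
  \sum_I F I = \sum_a \sum_(I : idx k) F (icons a I).
Proof.
rewrite pair_big (reindex (fun p : 'I_n * idx k => icons p.1 p.2)) //=.
exists (fun I : idx k.+1 => (I ord0, iomit ord0 I)) => [[a I] _|I _] /=.
  by rewrite icons0 iomit0_cons.
by rewrite icons_omit0.
Qed.

Lemma sum_iperm (V : nmodType) k (s : 'S_k) (F : idx k -> V) :
  \sum_I F (iperm s I) = \sum_I F I.
Proof.
rewrite [RHS](reindex (iperm s)) //.
exists (iperm s^-1) => I _; apply/ffunP => l; rewrite !ffunE.
  by rewrite permKV.
by rewrite permK.
Qed.

(** This compares removing a slot before and after a permutation. *)
Lemma perm_lift k (s : 'S_k.+1) (j : 'I_k.+1) :
  exists s' : 'S_k, s = lift_perm j (s j) s'.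
Proof.
pose f l := odflt l (unlift (s j) (s (lift j l))).
have fE l : lift (s j) (f l) = s (lift j l).
  rewrite /f; case: unliftP => [l' -> //|/perm_inj /eqP].
  by rewrite eq_sym (negbTE (neq_lift _ _)).
have finj : injective f.
  by move=> l l' /(congr1 (lift (s j))); rewrite !fE => /perm_inj /lift_inj.
exists (perm finj); apply/permP => i; case: (unliftP j i) => [l ->|->].
  by rewrite lift_perm_lift permE fE.
by rewrite lift_perm_id.
Qed.

Lemma iomit_perm k (s : 'S_k.+1) (j : 'I_k.+1) : exists s' : 'S_k,
  [/\ (s' : bool) = odd j (+) odd (s j) (+) s &
      forall I : idx k.+1, iomit j (iperm s I) = iperm s' (iomit (s j) I)].
Proof.
have [s' es] := perm_lift s j; exists s'; split.
  by rewrite {2}es odd_lift_perm addbA addbb.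
by move=> I; apply/ffunP => l; rewrite !ffunE {1}es lift_perm_lift.
Qed.

End MultiIndex.

Section Tensors.
Variables (A : comNzRingType) (n : nat).
Local Notation idx k := {ffun 'I_k -> 'I_n}.
Local Notation tens k := (idx k -> A).
Local Notation covec := ('I_n -> A).
Implicit Types (v u : covec) (M N : 'M[A]_n).

Definition tscale k (a : A) (T : tens k) : tens k := fun I => a * T I.
(** Exterior multiplication by a vector, and contraction of the first slot
    with a basis covector: the creation and annihilation operators of the
    exterior algebra. *)
Definition eps k v (T : tens k) : tens k.+1 :=
  fun I => \sum_(j < k.+1) (-1) ^+ j * v (I j) * T (iomit j I).
Definition iota k b (T : tens k.+1) : tens k := fun I => T (icons b I).
(** The action of a matrix on tensors, as a derivation [act] and as an
    algebra morphism [tmap]. *)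
Definition act k M (T : tens k) : tens k :=
  fun I => \sum_(l < k) \sum_m M (I l) m * T (iupd I l m).
Definition tmap k M (T : tens k) : tens k :=
  fun I => \sum_(J : idx k) (\prod_(l < k) M (I l) (J l)) * T J.
Definition tdot k (T S : tens k) : A := \sum_I T I * S I.
Definition alternating k (T : tens k) : Prop :=
  forall (s : 'S_k) (I : idx k), T (iperm s I) = (-1) ^+ s * T I.
Definition kron (a : 'I_n) : covec := fun i => (i == a)%:R.
Definition mcol M m : covec := fun i => M i m.

Lemma tsumE k (J : finType) (F : J -> tens k) I :
  (\sum_j F j) I = \sum_j F j I.
Proof. by rewrite fct_sumE. Qed.

Lemma tDE k (T S : tens k) I : (T + S) I = T I + S I. Proof. by []. Qed.
Lemma tNE k (T : tens k) I : (- T) I = - T I. Proof. by []. Qed.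
Lemma tBE k (T S : tens k) I : (T - S) I = T I - S I. Proof. by []. Qed.

Lemma eps_sumr k (J : finType) v (F : J -> tens k) :
  eps v (\sum_j F j) = \sum_j eps v (F j).
Proof.
apply/funext => I; rewrite tsumE /eps exchange_big /=.
by apply: eq_bigr => l _; rewrite tsumE mulr_sumr.
Qed.

Lemma epsDr k v (T S : tens k) : eps v (T + S) = eps v T + eps v S.
Proof.
by apply/funext => I; rewrite tDE /eps -big_split /=; apply: eq_bigr => l _;
  rewrite mulrDr.
Qed.

Lemma epsBr k v (T S : tens k) : eps v (T - S) = eps v T - eps v S.
Proof.
by apply/funext => I; rewrite tBE /eps -sumrB /=; apply: eq_bigr => l _;
  rewrite -mulrBr.
Qed.

Lemma epsZr k v a (T : tens k) : eps v (tscale a T) = tscale a (eps v T).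
Proof.
apply/funext => I; rewrite /eps /tscale mulr_sumr; apply: eq_bigr => l _.
by ring.
Qed.

Lemma eps_suml k (J : finType) (a : J -> A) (v : J -> covec) (T : tens k) :
  eps (fun i => \sum_j a j * v j i) T = \sum_j tscale (a j) (eps (v j) T).
Proof.
apply/funext => I; rewrite tsumE /eps /tscale.
under [RHS]eq_bigr do rewrite mulr_sumr.
rewrite exchange_big /=; apply: eq_bigr => l _.
by rewrite mulr_sumr mulr_suml; apply: eq_bigr => j _; ring.
Qed.

Lemma epsNl k v (T : tens k) : eps (- v) T = - eps v T.
Proof.
apply/funext => I; rewrite tNE /eps -sumrN; apply: eq_bigr => l _.
by rewrite /= mulrN mulNr.
Qed.

(** The canonical anticommutation relation. *)
Lemma iota_eps k b v (T : tens k.+1) :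
  iota b (eps v T) = tscale (v b) T - eps v (iota b T).
Proof.
apply/funext => I; rewrite tBE /iota /eps /tscale big_ord_recl /=.
rewrite icons0 iomit0_cons expr0 mul1r; congr (_ + _).
rewrite -sumrN; apply: eq_bigr => j _.
by rewrite iconsS iomitS_cons /bump /= exprS mulN1r !mulNr.
Qed.

Lemma iota_eps0 b v (T : tens 0) : iota b (eps v T) = tscale (v b) T.
Proof.
apply/funext => I; rewrite /iota /eps /tscale big_ord_recl big_ord0 /=.
by rewrite icons0 iomit0_cons expr0 mul1r addr0.
Qed.

Lemma iota_inj k (T S : tens k.+1) : (forall b, iota b T = iota b S) -> T = S.
Proof.
move=> TS; apply/funext => I; rewrite -(icons_omit0 I).
exact: (congr1 (@^~ (iomit ord0 I)) (TS (I ord0))).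
Qed.

Lemma iotaD k b (T S : tens k.+1) : iota b (T + S) = iota b T + iota b S.
Proof. by []. Qed.
Lemma iotaN k b (T : tens k.+1) : iota b (- T) = - iota b T.
Proof. by []. Qed.
Lemma iota_sum k (J : finType) b (F : J -> tens k.+1) :
  iota b (\sum_j F j) = \sum_j iota b (F j).
Proof. by apply/funext => I; rewrite /iota !tsumE. Qed.
Lemma iotaZ k b a (T : tens k.+1) : iota b (tscale a T) = tscale a (iota b T).
Proof. by []. Qed.

Lemma tscaleN k a (T : tens k) : tscale a (- T) = - tscale a T.
Proof. by apply/funext => I; rewrite /tscale /= mulrN. Qed.
Lemma tscaleB k a (T S : tens k) : tscale a (T - S) = tscale a T - tscale a S.
Proof. by apply/funext => I; rewrite /tscale /= mulrBr. Qed.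
Lemma tscaleA k a b (T : tens k) : tscale a (tscale b T) = tscale (a * b) T.
Proof. by apply/funext => I; rewrite /tscale mulrA. Qed.

(** Exterior multiplications anticommute: contracting once reduces the rank,
    so this follows from [iota_eps] by induction. *)
Lemma eps_anticomm k u v (T : tens k) : eps u (eps v T) = - eps v (eps u T).
Proof.
elim: k T => [|k IH] T.
  apply: iota_inj => b; rewrite iotaN !iota_eps !iota_eps0 !epsZr.
  by rewrite opprB addrC.
apply: iota_inj => b; rewrite iotaN !iota_eps !epsBr !epsZr (IH (iota b T)).
by rewrite opprK opprD addrA opprB addrAC.
Qed.

Lemma act_sumr k (J : finType) M (F : J -> tens k) :
  act M (\sum_j F j) = \sum_j act M (F j).
Proof.
apply/funext => I; rewrite tsumE /act [RHS]exchange_big /=.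
apply: eq_bigr => l _; rewrite [RHS]exchange_big /=; apply: eq_bigr => m _.
by rewrite tsumE mulr_sumr.
Qed.

Lemma actB k M N (T : tens k) : act (M - N) T = act M T - act N T.
Proof.
apply/funext => I; rewrite tBE /act -sumrB; apply: eq_bigr => l _.
by rewrite -sumrB; apply: eq_bigr => m _; rewrite !mxE mulrBl.
Qed.

Lemma actD k M N (T : tens k) : act (M + N) T = act M T + act N T.
Proof.
apply/funext => I; rewrite tDE /act -big_split; apply: eq_bigr => l _.
by rewrite -big_split; apply: eq_bigr => m _; rewrite !mxE mulrDl.
Qed.

Lemma actDr k M (T S : tens k) : act M (T + S) = act M T + act M S.
Proof.
apply/funext => I; rewrite tDE /act -big_split; apply: eq_bigr => l _.
by rewrite -big_split; apply: eq_bigr => m _; rewrite mulrDr.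
Qed.

Lemma actZ k M a (T : tens k) : act M (tscale a T) = tscale a (act M T).
Proof.
apply/funext => I; rewrite /act /tscale mulr_sumr; apply: eq_bigr => l _.
by rewrite mulr_sumr; apply: eq_bigr => m _; ring.
Qed.

Lemma act_eps k M v (T : tens k) :
  act M (eps v T) = eps (fun i => \sum_m M i m * v m) T + eps v (act M T).
Proof.
apply/funext => I; rewrite tDE /act /eps -big_split /=.
under eq_bigr do under eq_bigr do rewrite mulr_sumr.
under eq_bigr do rewrite exchange_big.
rewrite exchange_big /=; apply: eq_bigr => j _.
rewrite (bigD1_ord j) //=; congr (_ + _).
  rewrite mulr_sumr mulr_suml; apply: eq_bigr => m _.
  by rewrite ffunE eqxx iomit_upd; ring.
rewrite mulr_sumr; apply: eq_bigr => l _.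
rewrite mulr_sumr; apply: eq_bigr => m _.
rewrite iomit_upd_lift ffunE (negbTE (neq_lift _ _)).
by rewrite /iomit ffunE; ring.
Qed.

Lemma iota_act k M b (T : tens k.+1) :
  iota b (act M T) = \sum_m tscale (M b m) (iota m T) + act M (iota b T).
Proof.
apply/funext => I; rewrite tDE tsumE /iota /act /tscale big_ord_recl /=.
congr (_ + _).
  by apply: eq_bigr => m _; rewrite icons0 iupd_cons0.
apply: eq_bigr => l _; apply: eq_bigr => m _.
by rewrite iconsS iupd_consS.
Qed.

(** [act] is a Lie algebra representation: the terms in which the two matrices
    hit different slots are symmetric in them. *)
Lemma act_comm k M N (T : tens k) :
  act M (act N T) - act N (act M T) = act (M *m N - N *m M) T.
Proof.
pose cross (P Q : 'M[A]_n) (I : idx k) := \sum_(l < k) \sum_(l' < k | l' != l) \sum_m \sum_m'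
  P (I l) m * Q (I l') m' * T (iupd (iupd I l m) l' m').
have split P Q I : act P (act Q T) I = act (P *m Q) T I + cross P Q I.
  rewrite /act /cross -big_split /=; apply: eq_bigr => l _.
  under eq_bigr do rewrite (bigD1 l) //= mulrDr.
  rewrite big_split /=; congr (_ + _).
    under eq_bigr do rewrite mulr_sumr.
    rewrite exchange_big /=; apply: eq_bigr => m _; rewrite mxE mulr_suml.
    by apply: eq_bigr => m' _; rewrite ffunE eqxx iupd_same; ring.
  under eq_bigr do rewrite mulr_sumr.
  rewrite exchange_big /=; apply: eq_bigr => l' ll'; apply: eq_bigr => m _.
  rewrite mulr_sumr; apply: eq_bigr => m' _.
  by rewrite ffunE (negbTE ll'); ring.
have crossC I : cross M N I = cross N M I.
  rewrite /cross (exchange_big_dep xpredT) //=; apply: eq_bigr => l' _.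
  rewrite (eq_bigl (fun l => l != l')) => [|l]; last by rewrite eq_sym.
  apply: eq_bigr => l ll'; rewrite exchange_big /=; apply: eq_bigr => m _.
  by apply: eq_bigr => m' _; rewrite (iupd_comm _ _ _ ll'); ring.
apply/funext => I; rewrite tBE !split crossC actB tBE; ring.
Qed.

Lemma alt_sum k (J : finType) (F : J -> tens k) :
  (forall j, alternating (F j)) -> alternating (\sum_j F j).
Proof.
move=> aF s I; rewrite !tsumE mulr_sumr; apply: eq_bigr => j _.
exact: aF.
Qed.

Lemma altN k (T : tens k) : alternating T -> alternating (- T).
Proof. by move=> aT s I; rewrite tNE aT mulrN. Qed.

Lemma altD k (T S : tens k) :
  alternating T -> alternating S -> alternating (T + S).
Proof. by move=> aT aS s I; rewrite tDE aT aS mulrDr. Qed.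

Lemma alt_act k M (T : tens k) : alternating T -> alternating (act M T).
Proof.
move=> aT s I; rewrite /act mulr_sumr [RHS](reindex_perm s) /=.
apply: eq_bigr => l _; rewrite mulr_sumr; apply: eq_bigr => m _.
by rewrite iperm_upd aT ffunE mulrCA.
Qed.

Lemma alt_iota k b (T : tens k.+1) : alternating T -> alternating (iota b T).
Proof.
move=> aT s I; rewrite /iota iperm_cons aT odd_lift_perm addbb addFb.
by [].
Qed.

(** Removing slot [j] after permuting by [s] is removing slot [s j] and then
    permuting the others, at the cost of the sign computed in [iomit_perm]. *)
Lemma alt_eps k v (T : tens k) : alternating T -> alternating (eps v T).
Proof.
move=> aT s I; rewrite /eps mulr_sumr [RHS](reindex_perm s) /=.
apply: eq_bigr => j _; have [s' [os' es']] := iomit_perm n s j.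
rewrite es' aT os' signr_addb (signr_addb _ (odd j)) !signr_odd ffunE.
have := sqrr_sign A j.
by move: (nat_of_bool s) ((-1) ^+ j : A) ((-1) ^+ s j : A) => c y z yy; ring: yy.
Qed.

Lemma alt_tmap k M (T : tens k) : alternating T -> alternating (tmap M T).
Proof.
move=> aT s I; rewrite /tmap -(sum_iperm s) mulr_sumr; apply: eq_bigr => J _.
rewrite aT mulrCA; congr (_ * (_ * _)).
rewrite [RHS](reindex_perm s) /=.
by apply: eq_bigr => l _; rewrite !ffunE.
Qed.

Lemma alt_cons k (T : tens k.+1) I j m : alternating T ->
  T (icons m (iomit j I)) = (-1) ^+ j * T (iupd I j m).
Proof.
move=> aT; rewrite -icons_omit aT odd_lift_perm odd_perm1 addbF addbF.
by rewrite signr_odd mulrA -expr2 sqrr_sign mul1r.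
Qed.

(** Every slot of an alternating tensor can be moved to the front, with the sign
    by which [eps] moves it back. *)
Lemma act_alt k M (T : tens k.+1) : alternating T ->
  act M T = \sum_m eps (mcol M m) (iota m T).
Proof.
move=> aT; apply/funext => I; rewrite tsumE /act /eps exchange_big /=.
apply: eq_bigr => m _; apply: eq_bigr => j _; rewrite /iota alt_cons //.
rewrite /mcol; transitivity (((-1) ^+ j) ^+ 2 * M (I j) m * T (iupd I j m)).
  by rewrite sqrr_sign mul1r.
ring.
Qed.

Lemma tmap_comp k M N (T : tens k) : tmap M (tmap N T) = tmap (M *m N) T.
Proof.
apply/funext => I; rewrite /tmap.
under eq_bigr do rewrite mulr_sumr.
rewrite exchange_big /=; apply: eq_bigr => K _.
under eq_bigr do rewrite mulrA.
rewrite -mulr_suml; congr (_ * _).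
under [RHS]eq_bigr do rewrite mxE.
by rewrite bigA_distr_bigA /=; apply: eq_bigr => J _; rewrite -big_split.
Qed.

Lemma tmap1 k (T : tens k) : tmap 1%:M T = T.
Proof.
apply/funext => I; rewrite /tmap (bigD1 I) //= [X in X * _]big1 => [|l _].
  rewrite mul1r big1 ?addr0 // => J JI.
  suff [l ll] : exists l, I l != J l.
    by rewrite (bigD1 l) //= mxE (negbTE ll) !mul0r.
  apply/existsP; rewrite -negb_forall; apply: contra JI => /forallP e.
  by apply/eqP/ffunP => l; rewrite (eqP (e l)).
by rewrite mxE eqxx.
Qed.

Lemma tmap_sum k (J : finType) M (F : J -> tens k) :
  tmap M (\sum_j F j) = \sum_j tmap M (F j).
Proof.
apply/funext => I; rewrite tsumE /tmap exchange_big /=.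
by apply: eq_bigr => l _; rewrite tsumE mulr_sumr.
Qed.

Lemma tmapN k M (T : tens k) : tmap M (- T) = - tmap M T.
Proof.
apply/funext => I; rewrite tNE /tmap -sumrN.
by apply: eq_bigr => J _; rewrite /= mulrN.
Qed.

Lemma tmapD k M (T S : tens k) : tmap M (T + S) = tmap M T + tmap M S.
Proof.
apply/funext => I; rewrite tDE /tmap -big_split.
by apply: eq_bigr => J _; rewrite /= mulrDr.
Qed.

Lemma tmapZ k M a (T : tens k) : tmap M (tscale a T) = tscale a (tmap M T).
Proof.
apply/funext => I; rewrite /tmap /tscale mulr_sumr.
by apply: eq_bigr => J _; ring.
Qed.

(** In the term where [v] occupies slot [j], the index of that slot is summed
    separately from the others. *)
Lemma tmap_eps k M v (T : tens k) :
  tmap M (eps v T) = eps (fun i => \sum_m M i m * v m) (tmap M T).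
Proof.
apply/funext => I; rewrite /tmap /eps.
under eq_bigr do rewrite mulr_sumr.
rewrite exchange_big /=; apply: eq_bigr => j _.
transitivity (\sum_a \sum_(K : idx k) (M (I j) a * v a) * ((-1) ^+ j *
   ((\prod_(l < k) M (iomit j I l) (K l)) * T K))).
  rewrite pair_big /=.
  rewrite (reindex (fun p : 'I_n * idx k =>
    iperm (lift_perm j ord0 1) (icons p.1 p.2))) /=; last first.
    exists (fun J : idx k.+1 => (J j, iomit j J)) => [[a K] _|J _] /=; last first.
      by rewrite icons_omit iupd_id.
    congr (_, _); first by rewrite ffunE lift_perm_id icons0.
    by apply/ffunP => l; rewrite !ffunE lift_perm_lift perm1 liftK.
  apply: eq_bigr => -[a K] _ /=.
  have -> : iomit j (iperm (lift_perm j ord0 1) (icons a K)) = K.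
    by apply/ffunP => l; rewrite !ffunE lift_perm_lift perm1 liftK.
  rewrite (bigD1_ord j) //= ffunE lift_perm_id icons0.
  rewrite (eq_bigr (fun l => M (iomit j I l) (K l))); last first.
    by move=> l _; rewrite !ffunE lift_perm_lift perm1 liftK.
  by ring.
rewrite -[RHS]mulrA [RHS]mulrCA mulr_suml; apply: eq_bigr => a _.
by rewrite -!mulr_sumr.
Qed.

Lemma tdot_tmap k M (T S : tens k) : tdot T (tmap M S) = tdot (tmap M^T T) S.
Proof.
rewrite /tdot /tmap; under eq_bigr do rewrite mulr_sumr.
rewrite exchange_big /=; apply: eq_bigr => J _; rewrite mulr_suml.
apply: eq_bigr => I _; under [X in _ = X * _ * _]eq_bigr do rewrite mxE.
by ring.
Qed.

Lemma tdot_act k M (T S : tens k) : tdot T (act M S) = tdot (act M^T T) S.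
Proof.
rewrite /tdot /act; under eq_bigr do rewrite mulr_sumr.
under [RHS]eq_bigr do rewrite mulr_suml.
rewrite exchange_big [RHS]exchange_big /=; apply: eq_bigr => l _.
under eq_bigr do rewrite mulr_sumr; under [RHS]eq_bigr do rewrite mulr_suml.
rewrite !pair_big /=.
rewrite (reindex (fun p : idx k * 'I_n => (iupd p.1 l p.2, p.1 l))) /=; last first.
  exists (fun p : idx k * 'I_n => (iupd p.1 l p.2, p.1 l)) => -[I m] _ /=;
    by rewrite iupd_same iupd_id ffunE eqxx.
apply: eq_bigr => -[I m] _ /=.
by rewrite ffunE eqxx iupd_same iupd_id mxE; ring.
Qed.

Lemma tdotC k (T S : tens k) : tdot T S = tdot S T.
Proof. by apply: eq_bigr => I _; rewrite mulrC. Qed.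

Lemma tdotDl k (T T' S : tens k) : tdot (T + T') S = tdot T S + tdot T' S.
Proof. by rewrite /tdot -big_split; apply: eq_bigr => I _; rewrite /= mulrDl. Qed.

Lemma tdotDr k (T S S' : tens k) : tdot T (S + S') = tdot T S + tdot T S'.
Proof. by rewrite /tdot -big_split; apply: eq_bigr => I _; rewrite /= mulrDr. Qed.

Lemma tdotNl k (T S : tens k) : tdot (- T) S = - tdot T S.
Proof. by rewrite /tdot -sumrN; apply: eq_bigr => I _; rewrite /= mulNr. Qed.

Lemma tdotZl k a (T S : tens k) : tdot (tscale a T) S = a * tdot T S.
Proof. by rewrite /tdot mulr_sumr; apply: eq_bigr => I _; rewrite /tscale mulrA. Qed.

Lemma tdot_suml k (J : finType) (F : J -> tens k) S :
  tdot (\sum_j F j) S = \sum_j tdot (F j) S.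
Proof.
rewrite /tdot exchange_big /=; apply: eq_bigr => I _.
by rewrite tsumE mulr_suml.
Qed.

(** Creation and annihilation are adjoint; by alternation each of the [k + 1] slots
    that [v] can occupy contributes the same amount. *)
Lemma tdot_eps k v (T : tens k) (S : tens k.+1) : alternating S ->
  tdot (eps v T) S = k.+1%:R * \sum_a v a * tdot T (iota a S).
Proof.
move=> aS; rewrite /tdot /eps; under eq_bigr do rewrite mulr_suml.
rewrite exchange_big /= -[k.+1 in RHS]card_ord -sum1_card natr_sum mulr_suml.
apply: eq_bigr => j _; rewrite mul1r.
rewrite -(sum_iperm (lift_perm j ord0 1)) sum_icons.
apply: eq_bigr => a _; rewrite mulr_sumr; apply: eq_bigr => I _.
rewrite aS ffunE lift_perm_id icons0 odd_lift_perm odd_perm1 !addbF signr_odd.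
have -> : iomit j (iperm (lift_perm j ord0 1) (icons a I)) = I.
  by apply/ffunP => l; rewrite !ffunE lift_perm_lift perm1 liftK.
rewrite /iota; transitivity (((-1) ^+ j) ^+ 2 * (v a * (T I * S (icons a I)))).
  by ring.
by rewrite sqrr_sign mul1r.
Qed.

End Tensors.

(** * Covariant calculus for commuting derivations *)

Section Covariant.
Variables (A : comNzRingType) (n : nat) (D : 'I_n -> A -> A).
Hypothesis DD : forall a, {morph D a : x y / x + y}.
Hypothesis DM : forall a x y, D a (x * y) = D a x * y + x * D a y.
Hypothesis DC : forall a b x, D a (D b x) = D b (D a x).
Local Notation idx k := {ffun 'I_k -> 'I_n}.
Local Notation tens k := (idx k -> A).

Lemma D0 a : D a 0 = 0.
Proof. by apply: (addIr (D a 0)); rewrite add0r -DD addr0. Qed.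

Lemma DN a x : D a (- x) = - D a x.
Proof. by apply: (addIr (D a x)); rewrite addNr -DD addNr D0. Qed.

Lemma D1 a : D a 1 = 0.
Proof. by apply: (addIr (D a 1)); rewrite add0r -[1 in RHS]mulr1 DM mulr1 mul1r. Qed.

Lemma Dnat a m : D a m%:R = 0.
Proof. by elim: m => [|m IH]; rewrite ?D0 // -natr1 DD IH D1 addr0. Qed.

Lemma Dsign a m : D a ((-1) ^+ m) = 0.
Proof.
elim: m => [|m IH]; rewrite ?expr0 ?D1 // exprS DM IH mulr0 addr0 DN D1.
by rewrite oppr0 mul0r.
Qed.

Lemma Dsum a (J : finType) (P : pred J) (F : J -> A) :
  D a (\sum_(j | P j) F j) = \sum_(j | P j) D a (F j).
Proof. exact: (big_morph (D a) (DD a) (D0 a)). Qed.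

Lemma Dprod a (J : finType) (F : J -> A) :
  D a (\prod_j F j) = \sum_j D a (F j) * \prod_(l | l != j) F l.
Proof.
suff H (r : seq J) : uniq r -> D a (\prod_(j <- r) F j) =
    \sum_(j <- r) D a (F j) * \prod_(l <- r | l != j) F l.
  by apply: H; exact: index_enum_uniq.
elim: r => [|i r IH] /=; first by rewrite !big_nil D1.
case/andP=> ir ur; rewrite !big_cons DM IH // eqxx /=; congr (_ * _ + _).
  rewrite big_seq [RHS]big_seq_cond; apply: eq_bigl => l.
  by case: eqP => [->|]; rewrite ?andbT // (negbTE ir).
rewrite mulr_sumr big_seq [RHS]big_seq; apply: eq_bigr => j jr.
rewrite big_cons ifT; last by apply: contra ir => /eqP ->.
by rewrite mulrCA.
Qed.

Definition Dt k a (T : tens k) : tens k := fun I => D a (T I).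
Definition Dmx a (M : 'M[A]_n) : 'M[A]_n := \matrix_(i, j) D a (M i j).

Lemma Dmx_mul a (M N : 'M[A]_n) :
  Dmx a (M *m N) = Dmx a M *m N + M *m Dmx a N.
Proof.
apply/matrixP => i j; rewrite !mxE Dsum -big_split /=; apply: eq_bigr => m _.
by rewrite DM !mxE.
Qed.

Lemma Dmx_tr a (M : 'M[A]_n) : Dmx a M^T = (Dmx a M)^T.
Proof. by apply/matrixP => i j; rewrite !mxE. Qed.

Lemma DmxD a (M N : 'M[A]_n) : Dmx a (M + N) = Dmx a M + Dmx a N.
Proof. by apply/matrixP => i j; rewrite !mxE DD. Qed.

(** Jacobi's formula. *)
Lemma D_det a (M : 'M[A]_n) : D a (\det M) = \tr (\adj M *m Dmx a M).
Proof.
transitivity (\sum_i \sum_j Dmx a M i j * cofactor M i j); last first.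
  rewrite /mxtrace exchange_big /=; apply: eq_bigr => j _; rewrite mxE.
  by apply: eq_bigr => i _; rewrite [\adj M j i]mxE mulrC.
pose B i := \matrix_(i', j) (if i' == i then Dmx a M i j else M i' j).
have BE i : \sum_j Dmx a M i j * cofactor M i j = \det (B i).
  rewrite (expand_det_row _ i); apply: eq_bigr => j _.
  rewrite [B i i j]mxE eqxx /cofactor; congr (_ * (_ * \det _)).
  apply/matrixP => x y; rewrite !mxE eq_sym (negbTE (neq_lift _ _)).
  by [].
under eq_bigr do rewrite BE.
rewrite /determinant Dsum exchange_big /=; apply: eq_bigr => s _.
rewrite DM Dsign mul0r add0r Dprod mulr_sumr; apply: eq_bigr => i _.
congr (_ * _); rewrite [RHS](bigD1 i) //= !mxE eqxx; congr (_ * _).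
by apply: eq_bigr => l li; rewrite mxE (negbTE li).
Qed.

(** The derivative of the tensor power [tmap M] in the direction [X]. *)
Definition tmap_deriv k (M X : 'M[A]_n) (T : tens k) : tens k := fun I =>
  \sum_(J : idx k) (\sum_(l < k) X (I l) (J l) *
     \prod_(l' < k | l' != l) M (I l') (J l')) * T J.

Lemma Dt_tmap k a M (T : tens k) :
  Dt a (tmap M T) = tmap_deriv M (Dmx a M) T + tmap M (Dt a T).
Proof.
apply/funext => I; rewrite tDE /Dt /tmap Dsum -big_split /=.
apply: eq_bigr => J _; rewrite DM Dprod; congr (_ * _ + _).
by apply: eq_bigr => l _; rewrite mxE.
Qed.

Lemma tmap_derivD k M (X Y : 'M[A]_n) (T : tens k) :
  tmap_deriv M (X + Y) T = tmap_deriv M X T + tmap_deriv M Y T.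
Proof.
apply/funext => I; rewrite tDE /tmap_deriv -big_split /=.
apply: eq_bigr => J _; rewrite -mulrDl; congr (_ * _).
by rewrite -big_split; apply: eq_bigr => l _; rewrite mxE mulrDl.
Qed.

Lemma tmap_deriv_mull k M P (T : tens k) :
  tmap_deriv M (P *m M) T = act P (tmap M T).
Proof.
apply/funext => I; rewrite /tmap_deriv /act /tmap.
under eq_bigr do rewrite mulr_suml.
rewrite exchange_big /=; apply: eq_bigr => l _.
under [RHS]eq_bigr do rewrite mulr_sumr.
rewrite [RHS]exchange_big /=; apply: eq_bigr => J _.
rewrite mxE !mulr_suml; apply: eq_bigr => m _.
rewrite [in RHS](bigD1 l) //= ffunE eqxx !mulrA; congr (_ * _ * _).
by apply: eq_bigr => l' ll'; rewrite ffunE (negbTE ll').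
Qed.

Lemma tmap_deriv_mulr k M P (T : tens k) :
  tmap_deriv M (M *m P) T = tmap M (act P T).
Proof.
apply/funext => I; rewrite /tmap_deriv /act /tmap.
under eq_bigr do rewrite mulr_suml.
under [RHS]eq_bigr do rewrite mulr_sumr.
rewrite exchange_big [RHS]exchange_big /=; apply: eq_bigr => l _.
under eq_bigr do rewrite mxE !mulr_suml.
under [RHS]eq_bigr do rewrite mulr_sumr.
rewrite !pair_big /=.
rewrite (reindex (fun p : idx k * 'I_n => (iupd p.1 l p.2, p.1 l))) /=; last first.
  by exists (fun p : idx k * 'I_n => (iupd p.1 l p.2, p.1 l)) => -[I' m] _ /=;
    rewrite iupd_same iupd_id ffunE eqxx.
apply: eq_bigr => -[J m] _ /=; rewrite ffunE eqxx.
rewrite [in RHS](bigD1 l) //=.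
rewrite (eq_bigr (fun i => M (I i) (J i))); first by ring.
by move=> l' ll'; rewrite ffunE (negbTE ll').
Qed.

Variables (g ginv : 'M[A]_n) (half : A).
Hypothesis gsym : g^T = g.
Hypothesis ginvg : ginv *m g = 1%:M.
Hypothesis half2 : half + half = 1.

(** Christoffel symbols, as the matrices of the connection in the coordinate
    directions. *)
Definition gam a : 'M[A]_n := \matrix_(k, m) (half * \sum_(l < n) ginv k l *
  (D a (g m l) + D m (g a l) - D l (g a m))).

Lemma gginv : g *m ginv = 1%:M.
Proof. exact: mulmx1C. Qed.

Lemma gE i j : g i j = g j i.
Proof. by rewrite -[in RHS]gsym mxE. Qed.

Lemma gamC k a m : gam a k m = gam m k a.
Proof.
rewrite !mxE; congr (_ * _); apply: eq_bigr => l _; congr (_ * _).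
by rewrite [g a m]gE [D m _ + _]addrC.
Qed.

Lemma g_gam a i j :
  (g *m gam a) i j = half * (D a (g j i) + D j (g a i) - D i (g a j)).
Proof.
pose X l := D a (g j l) + D j (g a l) - D l (g a j).
rewrite mxE; transitivity (half * \sum_l (g *m ginv) i l * X l).
  under eq_bigr do rewrite mxE mulrCA mulr_sumr.
  rewrite -mulr_sumr exchange_big /=; congr (_ * _); apply: eq_bigr => l _.
  by rewrite mxE mulr_suml; apply: eq_bigr => k _; rewrite mulrA.
congr (_ * _); rewrite gginv (bigD1 i) //= mxE eqxx mul1r big1 ?addr0 // => l li.
by rewrite mxE eq_sym (negbTE li) mul0r.
Qed.

(** The Levi-Civita connection is compatible with the metric. *)
Lemma Dg a : Dmx a g = (gam a)^T *m g + g *m gam a.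
Proof.
have -> : (gam a)^T *m g = (g *m gam a)^T by rewrite trmx_mul gsym.
apply/matrixP => i j; rewrite mxE [RHS]mxE [X in _ = X + _]mxE !g_gam.
rewrite -mulrDr [g j i]gE -[LHS]mul1r -half2; ring.
Qed.

Lemma Dginv a : Dmx a ginv = - (gam a *m ginv + ginv *m (gam a)^T).
Proof.
have : Dmx a (ginv *m g) = 0.
  by apply/matrixP => i j; rewrite ginvg !mxE Dnat.
rewrite Dmx_mul Dg => /(congr1 (mulmx^~ ginv)); rewrite mul0mx mulmxDl.
rewrite -mulmxA gginv mulmx1 => /eqP; rewrite addr_eq0 => /eqP ->.
rewrite mulmxDr mulmxDl !mulmxA ginvg mul1mx -[_ *m g *m ginv]mulmxA gginv.
by rewrite mulmx1 addrC.
Qed.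

Definition nab k a (T : tens k) : tens k := Dt a T + act (gam a) T.

Lemma Dt_sum k (J : finType) a (F : J -> tens k) :
  Dt a (\sum_j F j) = \sum_j Dt a (F j).
Proof. by apply/funext => I; rewrite /Dt !tsumE Dsum. Qed.

Lemma DtN k a (T : tens k) : Dt a (- T) = - Dt a T.
Proof. by apply/funext => I; rewrite /Dt !tNE DN. Qed.

Lemma DtD k a (T S : tens k) : Dt a (T + S) = Dt a T + Dt a S.
Proof. by apply/funext => I; rewrite /Dt !tDE DD. Qed.

Lemma nab_sum k (J : finType) a (F : J -> tens k) :
  nab a (\sum_j F j) = \sum_j nab a (F j).
Proof. by rewrite /nab Dt_sum act_sumr big_split. Qed.

Lemma alt_nab k a (T : tens k) : alternating T -> alternating (nab a T).
Proof.
move=> aT; apply: altD; last exact: alt_act.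
by move=> s I; rewrite /Dt aT DM Dsign mul0r add0r.
Qed.

Lemma nab_iota k a b (T : tens k.+1) : nab a (iota b T) =
  iota b (nab a T) - \sum_m tscale (gam a b m) (iota m T).
Proof. by rewrite /nab iotaD iota_act addrCA addrAC subrr add0r addrC. Qed.

Lemma Dt_eps k b v (T : tens k) :
  Dt b (eps v T) = eps (fun i => D b (v i)) T + eps v (Dt b T).
Proof.
apply/funext => I; rewrite tDE /Dt /eps Dsum -big_split /=.
apply: eq_bigr => j _; rewrite !DM Dsign; ring.
Qed.

Lemma Dt_act k b M (T : tens k) :
  Dt b (act M T) = act (Dmx b M) T + act M (Dt b T).
Proof.
apply/funext => I; rewrite tDE /Dt /act Dsum -big_split /=.
apply: eq_bigr => l _; rewrite Dsum -big_split /=; apply: eq_bigr => m _.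
by rewrite DM mxE.
Qed.

Lemma nab_eps k b v (T : tens k) : nab b (eps v T) =
  eps (fun i => D b (v i) + \sum_m gam b i m * v m) T + eps v (nab b T).
Proof.
rewrite /nab Dt_eps act_eps epsDr addrACA; congr (_ + _).
apply/funext => I; rewrite tDE /eps -big_split /=; apply: eq_bigr => j _.
by rewrite mulrDr mulrDl.
Qed.

(** Raising an index is parallel, so only the connection acting on the label
    [a] of the coordinate covector remains. *)
Lemma nab_eps_ginv k b a (T : tens k) : nab b (eps (mcol ginv a) T) =
  eps (mcol ginv a) (nab b T) - \sum_m tscale (gam b a m) (eps (mcol ginv m) T).
Proof.
rewrite nab_eps addrC -(eps_suml (fun m => gam b a m)) -epsNl; congr (_ + eps _ _).
apply/funext => i; rewrite /mcol.
have /matrixP/(_ i a) := Dginv b; rewrite [LHS]mxE => ->.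
rewrite 3!mxE [X in - (_ + X)]mxE opprD addrAC addNr add0r.
by congr (- _); apply: eq_bigr => m _; rewrite [(_)^T _ _]mxE mulrC.
Qed.

(** The curvature of the connection with matrices [gam]. *)
Definition Riem a b : 'M[A]_n :=
  Dmx a (gam b) - Dmx b (gam a) + (gam a *m gam b - gam b *m gam a).

Lemma RiemC a b : Riem b a = - Riem a b.
Proof. by rewrite /Riem opprD !opprB. Qed.

(** The Ricci identity: as [act] is a Lie algebra representation, the second
    derivatives and the cross terms drop out and only the curvature remains. *)
Lemma nab_comm k a b (T : tens k) :
  nab a (nab b T) - nab b (nab a T) = act (Riem a b) T.
Proof.
have H u v : nab u (nab v T) = Dt u (Dt v T) + act (Dmx u (gam v)) T +
    (act (gam v) (Dt u T) + act (gam u) (Dt v T)) + act (gam u) (act (gam v) T).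
  by rewrite /nab DtD Dt_act actDr !addrA.
have DtC : Dt a (Dt b T) = Dt b (Dt a T).
  by apply/funext => I; rewrite /Dt DC.
rewrite !H /Riem actD -act_comm actB DtC.
set x := Dt b _; set p := act (Dmx _ _) _; set q := act (Dmx _ _) _.
rewrite [act (gam a) (Dt b T) + _]addrC; set y := act _ _ + act _ _.
set z := act _ (act _ _); set w := act _ (act _ _).
apply/funext => I; rewrite !(tDE, tNE); ring.
Qed.

(** The contravariant form of the exterior derivative, and minus the
    contravariant form of the codifferential. *)
Definition extd k (V : tens k) : tens k.+1 :=
  \sum_a eps (mcol ginv a) (nab a V).
Definition dvg k (V : tens k.+1) : tens k := \sum_b iota b (nab b V).

Lemma extdN k (V : tens k) : extd (- V) = - extd V.
Proof.
rewrite /extd -sumrN; apply: eq_bigr => a _.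
have -> : nab a (- V) = - nab a V.
  apply/funext => I; rewrite /nab DtN tNE !tDE !tNE opprD; congr (_ + _).
  rewrite /act -sumrN; apply: eq_bigr => l _; rewrite -sumrN.
  by apply: eq_bigr => m _; rewrite tNE mulrN.
apply/funext => I; rewrite tNE /eps -sumrN; apply: eq_bigr => j _.
by rewrite tNE mulrN.
Qed.

Definition rough_laplacian k (V : tens k) : tens k :=
  \sum_a \sum_b tscale (ginv a b) (nab a (nab b V)) -
  \sum_a \sum_b \sum_m tscale (ginv b m * gam b a m) (nab a V).

(** The Weitzenboeck formula. The operators [eps] of the raised coordinate
    covectors and [iota] of the coordinate covectors satisfy
    [iota b o eps a + eps a o iota b = ginv a b]; commuting them past the
    covariant derivatives produces Christoffel terms which cancel by symmetry,
    and the two orders of differentiation differ by the curvature. *)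
Lemma weitzenboeck k (V : tens k.+1) :
  extd (dvg V) + dvg (extd V) = rough_laplacian V +
  \sum_a \sum_b eps (mcol ginv a) (iota b (act (Riem a b) V)).
Proof.
pose e a := @eps A n k (mcol ginv a).
have L1 : extd (dvg V) = \sum_a \sum_b e a (iota b (nab a (nab b V))) -
    \sum_a \sum_b \sum_m tscale (gam a b m) (e a (iota m (nab b V))).
  rewrite -sumrB; apply: eq_bigr => a _; rewrite /dvg nab_sum eps_sumr -sumrB.
  apply: eq_bigr => b _; rewrite nab_iota epsBr eps_sumr; congr (_ - _).
  by apply: eq_bigr => m _; rewrite epsZr.
have L2 : dvg (extd V) = \sum_a \sum_b tscale (ginv b a) (nab b (nab a V)) -
    \sum_a \sum_b e a (iota b (nab b (nab a V))) - \sum_a \sum_b \sum_m tscale (gam b a m)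
      (tscale (ginv b m) (nab a V) - e m (iota b (nab a V))).
  rewrite /dvg /extd; under eq_bigr do rewrite nab_sum iota_sum.
  rewrite exchange_big /= -!sumrB; apply: eq_bigr => a _; rewrite -!sumrB.
  apply: eq_bigr => b _; rewrite nab_eps_ginv iotaD iotaN iota_eps iota_sum.
  congr (_ - _); apply: eq_bigr => m _; rewrite iotaZ iota_eps.
  by [].
have L3 : \sum_a \sum_b \sum_m tscale (gam b a m) (e m (iota b (nab a V))) =
    \sum_a \sum_b \sum_m tscale (gam a b m) (e a (iota m (nab b V))).
  rewrite [RHS]exchange_big /=; apply: eq_bigr => a _.
  rewrite exchange_big /=; apply: eq_bigr => m _.
  by apply: eq_bigr => b _; rewrite gamC.
have L4 : \sum_a \sum_b eps (mcol ginv a) (iota b (act (Riem a b) V)) =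
    \sum_a \sum_b e a (iota b (nab a (nab b V))) -
    \sum_a \sum_b e a (iota b (nab b (nab a V))).
  rewrite -sumrB; apply: eq_bigr => a _; rewrite -sumrB; apply: eq_bigr => b _.
  by rewrite -nab_comm iotaD iotaN epsBr.
rewrite L1 L2 L4 /rough_laplacian.
rewrite [X in _ + (_ - X)](_ : _ =
    \sum_a \sum_b \sum_m tscale (ginv b m * gam b a m) (nab a V) -
    \sum_a \sum_b \sum_m tscale (gam a b m) (e a (iota m (nab b V)))); last first.
  rewrite -L3 -sumrB; apply: eq_bigr => a _; rewrite -sumrB.
  apply: eq_bigr => b _; rewrite -sumrB; apply: eq_bigr => m _.
  by rewrite tscaleB tscaleA mulrC.
rewrite [X in _ = X - _ + _]exchange_big /=.
set p := \sum_a \sum_b e a _; set q := \sum_a \sum_b \sum_m tscale _ (e _ _).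
set r := \sum_a \sum_b tscale _ _; set t := \sum_a \sum_b e a _.
set w := \sum_a _.
by apply/funext => I; rewrite !(tDE, tNE); ring.
Qed.

(** Lowering indices is parallel. *)
Lemma Dt_flat k a (V : tens k) : Dt a (tmap g V) =
  tmap g (nab a V) + act (gam a)^T (tmap g V).
Proof.
rewrite Dt_tmap Dg tmap_derivD tmap_deriv_mull tmap_deriv_mulr /nab tmapD.
by rewrite -addrA addrC; congr (_ + _); rewrite addrC.
Qed.

Lemma D_inner k a (T S : tens k) : D a (tdot T (tmap g S)) =
  tdot (nab a T) (tmap g S) + tdot T (tmap g (nab a S)).
Proof.
transitivity (tdot (Dt a T) (tmap g S) + tdot T (Dt a (tmap g S))).
  by rewrite /tdot Dsum -big_split; apply: eq_bigr => I _; rewrite DM.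
rewrite Dt_flat tdotDr tdot_act trmxK [nab a T]/nab tdotDl -addrA.
by congr (_ + _); rewrite addrC.
Qed.

Lemma tdot_gC k (T S : tens k) : tdot T (tmap g S) = tdot S (tmap g T).
Proof. by rewrite tdot_tmap gsym tdotC. Qed.

Lemma D_norm k a (V : tens k) : D a (tdot V (tmap g V)) =
  tdot (nab a V) (tmap g V) + tdot (nab a V) (tmap g V).
Proof. by rewrite D_inner [X in _ + X]tdot_gC. Qed.

(** The Bochner identity for the Laplacian of a squared norm. *)
Lemma bochner k (V : tens k) : let N := tdot V (tmap g V) in
  let E := tdot (rough_laplacian V) (tmap g V) +
    \sum_a \sum_b ginv a b * tdot (nab a V) (tmap g (nab b V)) in
  \sum_a \sum_b ginv a b * D a (D b N) =
  E + E + \sum_a \sum_b \sum_m ginv b m * gam b a m * D a N.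
Proof.
move=> N E.
pose P a b := tdot (nab a (nab b V)) (tmap g V).
pose Q a b := tdot (nab a V) (tmap g (nab b V)).
pose S := \sum_a \sum_b \sum_m ginv b m * gam b a m * tdot (nab a V) (tmap g V).
have E1 : E = \sum_a \sum_b ginv a b * (P a b + Q a b) - S.
  rewrite /E /rough_laplacian tdotDl tdotNl addrAC; congr (_ - _).
    rewrite tdot_suml -big_split; apply: eq_bigr => a _ /=.
    rewrite tdot_suml -big_split; apply: eq_bigr => b _ /=.
    by rewrite tdotZl mulrDr.
  rewrite tdot_suml; apply: eq_bigr => a _; rewrite tdot_suml.
  apply: eq_bigr => b _; rewrite tdot_suml; apply: eq_bigr => m _.
  by rewrite tdotZl.
have E2 : \sum_a \sum_b \sum_m ginv b m * gam b a m * D a N = S + S.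
  rewrite -big_split; apply: eq_bigr => a _; rewrite -big_split.
  apply: eq_bigr => b _; rewrite -big_split; apply: eq_bigr => m _.
  by rewrite /N D_norm mulrDr.
rewrite E2 E1 addrACA !subrK -big_split; apply: eq_bigr => a _ /=.
rewrite -big_split; apply: eq_bigr => b _ /=; rewrite -mulrDr; congr (_ * _).
by rewrite /N D_norm DD D_inner /P /Q [tdot (nab a V) _]tdot_gC.
Qed.

(** The derivatives of [g] commute; expressing them by the connection matrices
    through [Dg], the symmetric terms cancel and this remains. *)
Lemma Riem_anti a b : (Riem a b)^T *m g + g *m Riem a b = 0.
Proof.
have H u v : Dmx u (Dmx v g) =
    (Dmx u (gam v))^T *m g + g *m Dmx u (gam v) +
    ((gam v)^T *m g *m gam u + (gam u)^T *m g *m gam v) +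
    ((gam v)^T *m (gam u)^T *m g + g *m gam u *m gam v).
  rewrite Dg DmxD !Dmx_mul Dmx_tr Dg mulmxDl mulmxDr !mulmxA.
  set x1 := (_ *m g)%R; set x2 := (_ *m g); set x3 := _ *m gam u.
  set x4 := _ *m gam v; set x5 := _ *m gam v; set x6 := _ *m Dmx u _.
  by apply/matrixP => i j; rewrite !mxE; ring.
have : Dmx a (Dmx b g) = Dmx b (Dmx a g).
  by apply/matrixP => i j; rewrite !mxE DC.
rewrite !H => /eqP; rewrite -subr_eq0 => /eqP E; rewrite -[RHS]E /Riem.
rewrite [(_ + (_ - _))^T]raddfD /= ![(_ - _)^T]raddfB /= !trmx_mul ?(mulmxDl, mulmxDr, mulNmx, mulmxN).
rewrite !mulmxA; apply/matrixP => i j; rewrite !mxE; ring.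
Qed.

Lemma ginv_tr a : \tr (ginv *m Dmx a g) = \tr (gam a) + \tr (gam a).
Proof.
rewrite Dg mulmxDr linearD /= [ginv *m (g *m _)]mulmxA ginvg mul1mx.
by rewrite mxtrace_mulC -mulmxA gginv mulmx1 mxtrace_tr.
Qed.

(** The logarithmic derivative of the Riemannian volume density. *)
Lemma D_sqrt_det a s sinv : s * s = \det g -> s * sinv = 1 ->
  D a s = s * \tr (gam a).
Proof.
move=> ss sV; have : D a (s * s) = \det g * \tr (ginv *m Dmx a g).
  rewrite ss D_det -[\adj g]mul1mx -ginvg -(mulmxA ginv) mul_mx_adj.
  by rewrite mul_mx_scalar -scalemxAl linearZ.
rewrite DM ginv_tr -ss => E.
rewrite -[LHS]mul1r -sV -[RHS]mul1r -sV.
transitivity (sinv * half * (D a s * s + s * D a s)).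
  by rewrite -[LHS]mulr1 -half2; ring.
by rewrite E -[RHS]mulr1 -half2; ring.
Qed.

(** The torsion terms of the divergence cancel by antisymmetry. *)
Lemma dvgE k (V : tens k.+1) : alternating V ->
  dvg V = \sum_a (iota a (Dt a V) + tscale (\tr (gam a)) (iota a V)).
Proof.
move=> aV; rewrite /dvg /nab; under eq_bigr do rewrite iotaD iota_act addrA.
rewrite big_split /= [X in _ + X](_ : _ = 0) ?addr0.
  rewrite !big_split /=; congr (_ + _); rewrite exchange_big /=.
  apply: eq_bigr => m _; apply/funext => I; rewrite tsumE /tscale -mulr_suml.
  by congr (_ * _); apply: eq_bigr => a _; rewrite gamC.
apply/funext => I; rewrite tsumE /act /iota exchange_big /=.
rewrite big1 // => l _; set S := \sum_a _.
have H : S = - S.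
  rewrite {1}/S exchange_big /= /S -sumrN; apply: eq_bigr => m _; rewrite -sumrN.
  apply: eq_bigr => a _; rewrite gamC -iperm_cons2 aV odd_tperm.
  by rewrite neq_lift /= expr1 mulN1r mulrN.
by rewrite -[S]mul1r -half2 mulrDl {1}H mulrN addNr.
Qed.

(** Pointwise form of the adjointness of exterior derivative and divergence: the
    derivative of the volume density gives the traces of the connection matrices
    in the divergence. *)
Lemma adjoint_divergence k s sinv (e : tens k) (W : tens k.+1) :
  s * s = \det g -> s * sinv = 1 -> alternating W ->
  \sum_a D a (s * tdot e (iota a W)) =
  s * (\sum_a tdot (Dt a e) (iota a W) + tdot e (dvg W)).
Proof.
move=> ss sV aW; rewrite dvgE // tdotC tdot_suml -big_split mulr_sumr /=.
apply: eq_bigr => a _; rewrite DM (D_sqrt_det _ ss sV) tdotDl tdotZl.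
have -> : D a (tdot e (iota a W)) =
    tdot (Dt a e) (iota a W) + tdot (iota a (Dt a W)) e.
  rewrite [X in _ = _ + X]tdotC /tdot Dsum -big_split /=.
  by apply: eq_bigr => I _; rewrite DM.
rewrite [tdot (iota a W) e]tdotC; ring.
Qed.

Definition ext k (w : tens k) : tens k.+1 := fun I =>
  \sum_(j < k.+1) (-1) ^+ j * D (I j) (w (iomit j I)).

Lemma extE k (w : tens k) : ext w = \sum_a eps (kron A a) (Dt a w).
Proof.
apply/funext => I; rewrite tsumE /ext /eps exchange_big /=.
apply: eq_bigr => j _; rewrite (bigD1 (I j)) //= /kron eqxx mulr1.
rewrite big1 ?addr0 // => a aI; rewrite eq_sym (negbTE aI) mulr0 mul0r.
by [].
Qed.

(** The Levi-Civita connection is torsion-free, so the exterior derivative is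
    the alternation of the covariant derivative. *)
Lemma ext_flat k (V : tens k) : alternating V ->
  ext (tmap g V) = tmap g (extd V).
Proof.
move=> aV; rewrite extE /extd tmap_sum.
under eq_bigr do rewrite Dt_flat epsDr.
rewrite big_split /= [X in _ + X](_ : _ = 0) ?addr0.
  apply: eq_bigr => a _; rewrite tmap_eps; congr (eps _ _).
  apply/funext => i; have /matrixP/(_ i a) := gginv.
  by rewrite [LHS]mxE [X in _ = X]mxE /kron => <-.
have aw := alt_tmap g aV; move: (tmap g V) aw => w {V aV}.
case: k w => [|k] w aw.
  rewrite big1 // => a _; apply/funext => I; rewrite /eps big1 // => j _.
  by rewrite /act big_ord0 mulr0.
have E a m : mcol (gam a)^T m = fun i => \sum_b gam a m b * kron A b i.
  apply/funext => i; rewrite /mcol mxE (bigD1 i) //= /kron eqxx mulr1.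
  by rewrite big1 ?addr0 // => b bi; rewrite eq_sym (negbTE bi) mulr0.
under eq_bigr do rewrite act_alt // eps_sumr.
rewrite exchange_big big1 //= => m _.
under eq_bigr do rewrite E eps_suml eps_sumr.
set S := \sum_a _.
have H : S = - S.
  rewrite /S -sumrN exchange_big; apply: eq_bigr => b _; rewrite -sumrN.
  by apply: eq_bigr => a _; rewrite !epsZr eps_anticomm tscaleN gamC.
apply/funext => I; have HI : S I = - S I by rewrite -[in RHS]tNE -H.
by rewrite -[S I]mul1r -half2 mulrDl {1}HI mulrN addNr.
Qed.

End Covariant.

(** * The curvature term on decomposable multivectors *)

Section Decomposable.
Variables (A : comNzRingType) (n : nat).
Local Notation idx k := {ffun 'I_k -> 'I_n}.
Local Notation tens k := (idx k -> A).
Local Notation covec := ('I_n -> A).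

Definition wdg k (v : 'I_k -> 'rV[A]_n) : tens k :=
  fun I => \det (\matrix_(i < k, j < k) v i 0 (I j)).

(** Evaluation of a contravariant tensor on a family of covectors. *)
Definition tev k (th : 'I_k -> covec) (T : tens k) : A :=
  \sum_(I : idx k) (\prod_l th l (I l)) * T I.
Definition fupd k (th : 'I_k -> covec) j (u : covec) : 'I_k -> covec :=
  fun l => if l == j then u else th l.

Lemma alt_wdg k (v : 'I_k -> 'rV[A]_n) : alternating (wdg v).
Proof.
move=> s I; rewrite /wdg -[LHS]det_tr -[in RHS]det_tr.
rewrite -det_perm -det_mulmx; congr (\det _).
by rewrite -row_permE; apply/matrixP => i j; rewrite !mxE ffunE.
Qed.

Lemma tmap_wdg k (M : 'M[A]_n) (v : 'I_k -> 'rV[A]_n) :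
  tmap M (wdg v) = wdg (fun i => v i *m M^T).
Proof.
apply/funext => I; rewrite /tmap /wdg.
under eq_bigr do rewrite -det_tr /determinant mulr_sumr.
rewrite -[RHS]det_tr /determinant.
rewrite exchange_big /=; apply: eq_bigr => s _.
under eq_bigr do rewrite mulrCA -big_split /=.
rewrite -mulr_sumr; congr (_ * _).
under [RHS]eq_bigr do rewrite !mxE.
rewrite bigA_distr_bigA /=; apply: eq_bigr => J _.
by apply: eq_bigr => l _; rewrite !mxE mulrC.
Qed.

(** By alternation, the [k!] permutations in the determinant all contribute the
    same. *)
Lemma tdot_wdg k (T : tens k) (v : 'I_k -> 'rV[A]_n) : alternating T ->
  tdot T (wdg v) = k`!%:R * tev (fun l => v l 0) T.
Proof.
move=> aT; rewrite /tdot /wdg.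
under eq_bigr do rewrite -det_tr /determinant mulr_sumr.
rewrite exchange_big /= -card_Sn -sum1_card natr_sum mulr_suml.
rewrite big_mkcond [RHS]big_mkcond; apply: eq_bigr => s _.
rewrite mul1r -(sum_iperm s); apply: eq_bigr => I _.
rewrite aT mulrCA mulrA mulrA -signr_addb addbb mul1r mulrC.
congr (_ * _); rewrite [RHS](reindex_perm s) /=; apply: eq_bigr => l _.
by rewrite !mxE ffunE.
Qed.

Lemma tev_suml k (J : finType) th (F : J -> tens k) :
  tev th (\sum_j F j) = \sum_j tev th (F j).
Proof.
rewrite /tev exchange_big /=; apply: eq_bigr => I _.
by rewrite tsumE mulr_sumr.
Qed.

(** Contracting a slot and inserting [v] instead replaces one covector at a time
    by a coordinate covector. *)
Lemma tev_eps_iota k th v b (T : tens k.+1) : alternating T ->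
  tev th (eps v (iota b T)) =
  \sum_j (\sum_i th j i * v i) * tev (fupd th j (kron A b)) T.
Proof.
move=> aT; rewrite /tev /eps; under eq_bigr do rewrite mulr_sumr.
rewrite exchange_big /=; apply: eq_bigr => j _.
transitivity (\sum_a \sum_(K : idx k) (th j a * v a) * ((-1) ^+ j *
   ((\prod_(l < k) th (lift j l) (K l)) * T (icons b K)))).
  rewrite -(sum_iperm (lift_perm j ord0 1)) sum_icons.
  apply: eq_bigr => a _; apply: eq_bigr => K _.
  have -> : iomit j (iperm (lift_perm j ord0 1) (icons a K)) = K.
    by apply/ffunP => l; rewrite !ffunE lift_perm_lift perm1 liftK.
  rewrite (bigD1_ord j) //= ffunE lift_perm_id icons0.
  rewrite (eq_bigr (fun l => th (lift j l) (K l))); last first.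
    by move=> l _; rewrite !ffunE lift_perm_lift perm1 liftK.
  by rewrite /iota; ring.
rewrite mulr_suml; apply: eq_bigr => a _.
rewrite -mulr_sumr; congr (_ * _).
rewrite -[RHS](sum_iperm (lift_perm j ord0 1)) sum_icons.
rewrite [RHS](bigD1 b) //= [X in _ = _ + X]big1 ?addr0; last first.
  move=> c cb; rewrite big1 // => K _; rewrite (bigD1 j) //=.
  rewrite /fupd eqxx ffunE lift_perm_id icons0 /kron (negbTE cb).
  by rewrite !mul0r.
apply: eq_bigr => K _; rewrite (bigD1_ord j) //= /fupd eqxx ffunE.
rewrite lift_perm_id icons0 /kron eqxx mul1r.
rewrite [in RHS](eq_bigr (fun l => th (lift j l) (K l))); last first.
  move=> l _; rewrite eq_sym (negbTE (neq_lift _ _)).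
  by rewrite !ffunE lift_perm_lift perm1 liftK.
by rewrite aT odd_lift_perm odd_perm1 !addbF signr_odd mulrCA.
Qed.

Lemma tev_act k th (M : 'M[A]_n) (T : tens k) : tev th (act M T) =
  \sum_l tev (fupd th l (fun m => \sum_i th l i * M i m)) T.
Proof.
rewrite /tev /act; under eq_bigr do rewrite mulr_sumr.
rewrite exchange_big /=; apply: eq_bigr => l _.
under eq_bigr do rewrite mulr_sumr.
rewrite pair_big /=.
rewrite (reindex (fun p : idx k * 'I_n => (iupd p.1 l p.2, p.1 l))) /=; last first.
  by exists (fun p : idx k * 'I_n => (iupd p.1 l p.2, p.1 l)) => -[I' m] _ /=;
    rewrite iupd_same iupd_id ffunE eqxx.
transitivity (\sum_(I : idx k) \sum_m (\prod_(i | i != l) th i (I i)) *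
    (th l m * M m (I l)) * T I).
  rewrite pair_big /=; apply: eq_bigr => -[I m] _ /=.
  rewrite ffunE eqxx iupd_same iupd_id (bigD1 l) //= ffunE eqxx.
  rewrite (eq_bigr (fun i => th i (I i))); first by ring.
  by move=> i il; rewrite ffunE (negbTE il).
apply: eq_bigr => I _; rewrite [in RHS](bigD1 l) //= {1}/fupd eqxx.
rewrite -mulr_suml -mulr_sumr; congr (_ * _); rewrite mulrC; congr (_ * _).
by apply: eq_bigr => i il; rewrite /fupd (negbTE il).
Qed.

Lemma tev_wdg k (th : 'I_k -> covec) (v : 'I_k -> 'rV[A]_n) :
  tev th (wdg v) = \det (\matrix_(i, j) \sum_m th i m * v j 0 m).
Proof.
rewrite /tev /wdg; under eq_bigr do rewrite -det_tr /determinant mulr_sumr.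
rewrite exchange_big /determinant /=; apply: eq_bigr => s _.
under eq_bigr do rewrite mulrCA -big_split /=.
rewrite -mulr_sumr; congr (_ * _).
under [RHS]eq_bigr do rewrite mxE.
rewrite bigA_distr_bigA /=; apply: eq_bigr => I _.
by apply: eq_bigr => l _; rewrite !mxE.
Qed.

(** Only the permutations preserving the set of exceptional rows contribute. *)
Lemma det_row1 k (N : 'M[A]_k) j :
  (forall i c, i != j -> N i c = (i == c)%:R) -> \det N = N j j.
Proof.
move=> Nij; rewrite /determinant (bigD1 1%g) //= [X in _ + X]big1 => [|s s1].
  rewrite odd_perm1 expr0 mul1r addr0 (bigD1 j) //= perm1 big1 ?mulr1 // => i ij.
  by rewrite Nij // perm1 eqxx.
have [i /andP[ij si]] : exists i, (i != j) && (s i != i).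
  apply/existsP; apply: contraNT s1 => /existsPn H; apply/eqP/permP.
  have H' i : i != j -> s i = i.
    by move=> ij; have := H i; rewrite ij /= negbK => /eqP.
  move=> i; rewrite perm1; have [->|/H' //] := eqVneq i j.
  have [//|sj] := eqVneq (s j) j; have := H' _ sj => /perm_inj sj'.
  by rewrite sj' eqxx in sj.
by rewrite (bigD1 i) //= Nij // eq_sym (negbTE si) mul0r mulr0.
Qed.

Lemma det_row2 k (N : 'M[A]_k) j l : j != l ->
  (forall i c, i != j -> i != l -> N i c = (i == c)%:R) ->
  \det N = N j j * N l l - N j l * N l j.
Proof.
move=> jl Nij; rewrite /determinant (bigD1 1%g) //= (bigD1 (tperm j l)) /=; last first.
  by apply: contra jl => /eqP/permP/(_ j); rewrite tpermL perm1 => ->.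
have T (s : 'S_k) : (forall i, i != j -> i != l -> s i = i) ->
   \prod_i N i (s i) = N j (s j) * N l (s l).
  move=> sE; rewrite (bigD1 j) //= (bigD1 l) 1?eq_sym //=.
  rewrite mulrA big1 ?mulr1 // => i /andP[ij il]; rewrite Nij // sE //.
  by rewrite eqxx.
rewrite (T 1%g) //; last by move=> i _ _; rewrite perm1.
rewrite (T (tperm j l)) //; last by move=> i ij il; rewrite tpermD // eq_sym.
rewrite odd_perm1 odd_tperm jl !perm1 tpermL tpermR expr0 expr1 mul1r mulN1r.
rewrite [X in _ + (_ + X)]big1 ?addr0 // => s /andP[s1 s2].
have [i /and3P[ij il si]] : exists i, [&& i != j, i != l & s i != i].
  apply/existsP; apply: contraNT s2 => /existsPn H.
  have H' i : i != j -> i != l -> s i = i.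
    by move=> ij il; have := H i; rewrite ij il /= negbK => /eqP.
  have H2 i : (i == j) || (i == l) -> (s i == j) || (s i == l).
    apply: contraTT; rewrite !negb_or => /andP[h1 h2].
    by rewrite -(perm_inj (H' _ h1 h2)) h1 h2.
  have [sj|sj] := eqVneq (s j) j.
    case/negP: s1; apply/eqP/permP => i; rewrite perm1.
    have [->//|ij] := eqVneq i j; have [->|il] := eqVneq i l; last exact: H'.
    have /orP[/eqP e|/eqP //] : (s l == j) || (s l == l).
      by apply: H2; rewrite eqxx orbT.
    by move: jl; rewrite -(inj_eq (@perm_inj _ s)) sj e eqxx.
  have /orP[/eqP e|/eqP sjl] : (s j == j) || (s j == l).
  - by apply: H2; rewrite eqxx.
  - by rewrite e eqxx in sj.
  apply/eqP/permP => i.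
  have [->|ij] := eqVneq i j; first by rewrite tpermL.
  have [->|il] := eqVneq i l; last by rewrite tpermD 1?eq_sym // H'.
  have /orP[/eqP ->|/eqP e] : (s l == j) || (s l == l).
  - by apply: H2; rewrite eqxx orbT.
  - by rewrite tpermR.
  by move: jl; rewrite -(inj_eq (@perm_inj _ s)) sjl e eqxx.
by rewrite (bigD1 i) //= Nij // eq_sym (negbTE si) mul0r mulr0.
Qed.

Variables (g ginv : 'M[A]_n) (half : A) (Rm : 'I_n -> 'I_n -> 'M[A]_n).
Hypothesis gsym : g^T = g.
Hypothesis ginvg : ginv *m g = 1%:M.
Hypothesis half2 : half + half = 1.
Hypothesis RmC : forall a b, Rm b a = - Rm a b.
Hypothesis Rm_anti : forall a b, (Rm a b)^T *m g + g *m Rm a b = 0.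

(** The curvature as a 4-linear form, [g (R (x, y) z, w)]. *)
Definition riem4 (x y z w : 'rV[A]_n) : A :=
  \sum_a \sum_b x 0 a * y 0 b * (w *m g *m Rm a b *m z^T) 0 0.

Lemma self_opp (x : A) : x = - x -> x = 0.
Proof. by move=> H; rewrite -[x]mul1r -half2 mulrDl {1}H mulrN addNr. Qed.

Lemma riem4_same x z w : riem4 x x z w = 0.
Proof.
apply: self_opp; rewrite /riem4 {1}exchange_big -sumrN; apply: eq_bigr => a _.
rewrite -sumrN; apply: eq_bigr => b _.
by rewrite RmC mulmxN mulNmx mxE mulrN [x 0 b * _]mulrC.
Qed.

Lemma riem4_anti x y z w : riem4 x y z w = - riem4 x y w z.
Proof.
rewrite /riem4 -sumrN; apply: eq_bigr => a _.
rewrite -sumrN; apply: eq_bigr => b _; rewrite -mulrN; congr (_ * _).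
have -> : w *m g *m Rm a b *m z^T = - (w *m ((Rm a b)^T *m g) *m z^T).
  have /eqP := Rm_anti a b; rewrite addrC addr_eq0 => /eqP E.
  by rewrite -(mulmxA w) E mulmxN mulNmx.
rewrite [LHS]mxE; congr (- _).
have -> : (w *m ((Rm a b)^T *m g) *m z^T) =
   (z *m g *m Rm a b *m w^T)^T by rewrite !trmx_mul !trmxK gsym !mulmxA.
by rewrite mxE.
Qed.

(** For an orthonormal frame [e] completed by [nu] to an orthonormal basis, the
    curvature term pairs [wdg e] with itself to the normal Ricci sum: the trace
    produces the sectional curvatures with all basis vectors, and the terms in
    which curvature and contraction hit different factors remove those of the
    planes inside the span of [e]. *)
Lemma curvature_wdg k m (e : 'I_k.+1 -> 'rV[A]_n) (nu : 'I_m -> 'rV[A]_n) :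
  (forall i j, (e i *m g *m (e j)^T) 0 0 = (i == j)%:R) ->
  \sum_j (e j)^T *m e j + \sum_al (nu al)^T *m nu al = ginv ->
  tdot (\sum_a \sum_b eps (mcol ginv a) (iota b (act (Rm a b) (wdg e))))
    (tmap g (wdg e)) =
  - (k.+1`!%:R * \sum_j \sum_al riem4 (e j) (nu al) (nu al) (e j)).
Proof.
move=> eE enu.
have aX a b : alternating (act (Rm a b) (wdg e)).
  exact/alt_act/alt_wdg.
rewrite tmap_wdg gsym tdot_wdg; last first.
  apply: alt_sum => a; apply: alt_sum => b; apply: alt_eps; exact: alt_iota.
rewrite -mulrN; congr (_ * _).
set th := fun l => _.
have thE i j : \sum_m th i m * e j 0 m = (i == j)%:R.
  by rewrite -eE mxE; apply: eq_bigr => q _; rewrite [(e j)^T _ _]mxE.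
have thMx i (x : 'rV[A]_n) (M : 'M[A]_n) : \sum_m (\sum_q th i q * M q m) * x 0 m =
    (e i *m g *m M *m x^T) 0 0.
  rewrite mxE; apply: eq_bigr => q _; rewrite [x^T _ _]mxE.
  by rewrite mxE.
have thginv j a : \sum_i th j i * mcol ginv a i = e j 0 a.
  transitivity ((e j *m g *m ginv) 0 a); first by rewrite mxE.
  by rewrite -mulmxA (mulmx1C ginvg) mulmx1.
pose X j l a b := tev (fupd (fupd th j (kron A b)) l (fun m =>
   \sum_i fupd th j (kron A b) l i * Rm a b i m)) (wdg e).
have kE (f : 'I_n -> A) b : \sum_q kron A b q * f q = f b.
  rewrite (bigD1 b) //= /kron eqxx mul1r big1 ?addr0 // => q qb.
  by rewrite (negbTE qb) mul0r.
have Xjj j a b : X j j a b = (Rm a b *m (e j)^T) b 0.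
  rewrite /X tev_wdg (det_row1 (j := j)); last first.
    by move=> i c ij; rewrite mxE /fupd (negbTE ij) thE.
  rewrite mxE /fupd !eqxx mxE; apply: eq_bigr => q _.
  by rewrite kE [(e j)^T _ _]mxE.
have Xjl j l a b : j != l -> X j l a b =
    e j 0 b * (e l *m g *m Rm a b *m (e l)^T) 0 0 -
    e l 0 b * (e l *m g *m Rm a b *m (e j)^T) 0 0.
  move=> jl; rewrite /X tev_wdg (det_row2 jl); last first.
    by move=> i c ij il; rewrite mxE /fupd (negbTE il) (negbTE ij) thE.
  rewrite -!thMx !mxE /fupd eqxx (negbTE jl) eq_sym (negbTE jl) eqxx !kE.
  by [].
have nuE j : \sum_a \sum_b e j 0 a * X j j a b =
    \sum_l riem4 (e j) (e l) (e j) (e l) +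
    \sum_al riem4 (e j) (nu al) (e j) (nu al).
  rewrite /riem4 [X in _ = X + _]exchange_big [X in _ = _ + X]exchange_big.
  rewrite -big_split /=; apply: eq_bigr => a _.
  rewrite [X in _ = X + _]exchange_big [X in _ = _ + X]exchange_big.
  rewrite -big_split /=; apply: eq_bigr => b _; rewrite Xjj.
  rewrite -[Rm a b *m (e j)^T]mul1mx -ginvg -enu !mulmxA mulmxDl mulmxDl mulmxDl [in LHS]mxE.
  rewrite mulrDr !mulmx_suml !summxE !mulr_sumr.
  have Z (f : 'rV[A]_n) : e j 0 a * (f^T *m f *m g *m Rm a b *m (e j)^T) b 0 =
     e j 0 a * f 0 b * (f *m g *m Rm a b *m (e j)^T) 0 0.
    rewrite -mulrA; congr (_ * _); rewrite -!mulmxA [LHS]mxE big_ord1.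
    by rewrite [f^T _ _]mxE.
  by congr (_ + _); apply: eq_bigr => l _; rewrite Z.
transitivity (\sum_j \sum_l \sum_a \sum_b e j 0 a * X j l a b).
  transitivity (\sum_a \sum_b \sum_j \sum_l e j 0 a * X j l a b).
    rewrite tev_suml; apply: eq_bigr => a _; rewrite tev_suml.
    apply: eq_bigr => b _; rewrite tev_eps_iota //; apply: eq_bigr => j _.
    by rewrite thginv tev_act mulr_sumr.
  under eq_bigr do rewrite exchange_big /=.
  rewrite exchange_big; apply: eq_bigr => j _.
  by under eq_bigr do rewrite exchange_big /=; rewrite exchange_big.
rewrite -sumrN; apply: eq_bigr => j _; rewrite (bigD1 j) //= nuE.
rewrite [X in _ + X](_ : _ =
    - \sum_(l | l != j) riem4 (e j) (e l) (e j) (e l)); last first.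
  rewrite -sumrN; apply: eq_bigr => l lj.
  transitivity (riem4 (e j) (e j) (e l) (e l) - riem4 (e j) (e l) (e j) (e l)).
    rewrite /riem4 -sumrB.
    apply: eq_bigr => a _; rewrite -sumrB; apply: eq_bigr => b _.
    by rewrite Xjl 1?eq_sym // mulrBr !mulrA.
  by rewrite riem4_same add0r.
rewrite (bigD1 j) //= riem4_same add0r addrAC subrr add0r -sumrN.
by apply: eq_bigr => al _; rewrite riem4_anti.
Qed.

End Decomposable.

(** * Smooth functions on an open set *)

Section Lines.
Variables (R : realType) (n : nat).
Implicit Types (f : 'rV[R]_n -> R) (x v : 'rV[R]_n).

Lemma is_derive_line f x v (t : R) : derivable f (x + t *: v) v ->
  is_derive t 1 (fun s : R => f (x + s *: v)) ('D_v f (x + t *: v)).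
Proof.
have E : (fun h : R => h^-1 *: (((fun s : R => f (x + s *: v)) \o shift t)
    (h *: (1 : R)) - f (x + t *: v))) =
  (fun h => h^-1 *: ((f \o shift (x + t *: v)) (h *: v) - f (x + t *: v))).
  apply/funext => h /=; congr (_ *: (f _ - _)).
  by rewrite [h *: 1]mulr1 scalerDl addrCA.
by move=> fd; split; rewrite /derivable /derive E.
Qed.

Lemma derive_chain f (g : R -> R) x v dg : derivable f x v ->
  is_derive (f x) 1 g dg -> is_derive x v (g \o f) (dg * 'D_v f x).
Proof.
move=> fd gd; rewrite -{1}[x]addr0 -(scale0r v) in fd.
have := is_derive_line fd => fl.
have gd' : is_derive (f (x + 0 *: v)) 1 g dg by rewrite scale0r addr0.
have := @is_derive1_comp _ g (fun s : R => f (x + s *: v)) 0 _ _ gd' fl.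
case=> cd ce; rewrite scale0r addr0 in ce.
have E : (fun h : R => h^-1 *: (((fun s : R => (g \o f) (x + s *: v)) \o shift 0)
    (h *: (1 : R)) - (g \o f) (x + 0 *: v))) =
  (fun h => h^-1 *: (((g \o f) \o shift x) (h *: v) - (g \o f) x)).
  apply/funext => h /=; congr (_ *: (g (f _) - g (f _))).
    by rewrite [h *: 1]mulr1 addr0 addrC.
  by rewrite scale0r addr0.
by split; rewrite /derivable /derive -E.
Qed.

(** The absolute values allow increments of either sign. *)
Lemma MVT_line f x v (h : R) :
  (forall s : R, `|s| <= `|h| -> derivable f (x + s *: v) v) ->
  exists2 c : R, `|c| <= `|h| & f (x + h *: v) - f x = h * 'D_v f (x + c *: v).
Proof.
move=> fd; pose g (s : R) := f (x + s *: v).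
have gd (s : R) : `|s| <= `|h| -> is_derive s (1 : R) g ('D_v f (x + s *: v)).
  by move=> sh; exact/is_derive_line/fd.
have gc (a b : R) : (forall s : R, a <= s <= b -> `|s| <= `|h|) ->
    {within `[a, b], continuous g}.
  move=> ab; apply: derivable_within_continuous => s; rewrite in_itv /= => /ab sh.
  by have [] := gd _ sh.
have g0 : g 0 = f x by rewrite /g scale0r addr0.
have [h0|h0] := leP 0 h.
  have H s : 0 <= s <= h -> `|s| <= `|h|.
    by move=> /andP[s0 sh]; rewrite !ger0_norm.
  have [] := @MVT_segment _ g (fun s => 'D_v f (x + s *: v)) 0 h h0.
  - by move=> s; rewrite in_itv /= => /andP[a b]; apply/gd/H; rewrite !ltW.
  - exact: gc.
  move=> c; rewrite in_itv /= => /H ch; rewrite g0 subr0 => E.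
  by exists c => //; rewrite E mulrC.
have H s : h <= s <= 0 -> `|s| <= `|h|.
  by move=> /andP[hs s0]; rewrite !ler0_norm ?lerN2 // ltW.
have [] := @MVT_segment _ g (fun s => 'D_v f (x + s *: v)) h 0 (ltW h0).
- by move=> s; rewrite in_itv /= => /andP[a b]; apply/gd/H; rewrite !ltW.
- exact: gc.
move=> c; rewrite in_itv /= => /H ch; rewrite g0 sub0r => E.
by exists c => //; rewrite -opprB E mulrN opprK mulrC.
Qed.

Lemma MVT_line_pos f x v (h : R) : 0 < h ->
  (forall s : R, 0 <= s <= h -> derivable f (x + s *: v) v) ->
  exists2 c : R, 0 < c < h & f (x + h *: v) - f x = h * 'D_v f (x + c *: v).
Proof.
move=> h0 fd; pose g (s : R) := f (x + s *: v).
have gd (s : R) : 0 <= s <= h -> is_derive s (1 : R) g ('D_v f (x + s *: v)).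
  by move=> sh; exact/is_derive_line/fd.
have [] := @MVT _ g (fun s => 'D_v f (x + s *: v)) 0 h h0.
- by move=> s; rewrite in_itv /= => /andP[a b]; apply/gd; rewrite !ltW.
- apply: derivable_within_continuous => s; rewrite in_itv /= => sh.
  by have [] := gd _ sh.
have g0 : g 0 = f x by rewrite /g scale0r addr0.
move=> c; rewrite in_itv /= => ch; rewrite g0 subr0 => E.
by exists c => //; rewrite mulrC -E.
Qed.

(** By the mean value theorem the increment in the direction [c u] is governed by
    the derivative along [u] at a nearby point, which is close to that at [x]. *)
Lemma derive_addl f x u v (c : R) :
  (\forall y \near x, derivable f y u) -> {for x, continuous ('D_u f)} ->
  derivable f x v ->
  is_derive x (v + c *: u) f ('D_v f x + c * 'D_u f x).
Proof.
move=> fu cu fv.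
suff L : (fun h => h^-1 *: ((f \o shift x) (h *: (v + c *: u)) - f x)) @ 0^' -->
    ('D_v f x + c * 'D_u f x : R).
  split; last exact: cvg_lim.
  by apply/cvg_ex; exists ('D_v f x + c * 'D_u f x).
pose q h : R := h^-1 *: ((f \o shift x) (h *: v) - f x).
pose r h : R := h^-1 * (f (x + h *: v + (h * c) *: u) - f (x + h *: v)).
have -> : (fun h => h^-1 *: ((f \o shift x) (h *: (v + c *: u)) - f x)) = q \+ r.
  apply/funext => h; rewrite /q /r /= [h *: v + x]addrC.
  have -> : h *: (v + c *: u) + x = x + h *: v + (h * c) *: u.
    by rewrite scalerDr scalerA addrC addrA.
  have sE (a b : R) : a *: b = a * b by [].
  rewrite !sE; ring.
apply: cvgD; first exact: fv.
apply/cvgrPdist_le => /= e e0.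
pose e' := e / (`|c| + 1).
have c1 : 0 < `|c| + 1 by rewrite ltr_wpDl.
have e'0 : 0 < e' by rewrite divr_gt0.
have /nbhs_ballP[d d0 dP] : \forall y \near x,
    derivable f y u /\ `|'D_u f x - 'D_u f y| <= e'.
  have /cvgrPdist_le/(_ _ e'0) := cu.
  by apply: filterS2 fu => y.
pose K := `|v| + `|c| * `|u| + 1.
have K0 : 0 < K by rewrite ltr_wpDl // addr_ge0 // mulr_ge0.
near=> h.
have h0 : h != 0 by near: h; exact: nbhs_dnbhs_neq.
have hd : `|h| * K < d.
  rewrite -ltr_pdivlMr //; near: h; apply: dnbhs0_lt.
  by rewrite divr_gt0.
have B s : `|s| <= `|h * c| -> ball x d (x + h *: v + s *: u).
  move=> sh; rewrite -ball_normE /ball_ /= opprD opprD !addrA subrr sub0r -opprD normrN.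
  apply: le_lt_trans (ler_normD _ _) _; apply: le_lt_trans hd.
  rewrite /K !normrZ !mulrDr mulr1; apply: ler_wpDr => //; apply: lerD => //.
  by rewrite mulrA -normrM ler_wpM2r.
have [s sh E] := @MVT_line f (x + h *: v) u (h * c) (fun s sh => (dP _ (B s sh)).1).
rewrite /r E mulrA mulrA mulVf // mul1r -mulrBr normrM.
have := (dP _ (B s sh)).2 => H.
apply: le_trans (ler_wpM2l (normr_ge0 c) H) _; rewrite /e' mulrA ler_pdivrMr //.
by rewrite mulrDr mulr1 mulrC lerDl ltW.
Unshelve. all: by end_near. Qed.

End Lines.

Section SmoothOn.
Variables (R : realType) (n : nat) (U : set 'rV[R]_n).
Hypothesis oU : open U.
Implicit Types f g : 'rV[R]_n -> R.

Lemma partial_eq i f g x : U x -> (forall y, U y -> f y = g y) ->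
  partial i f x = partial i g x.
Proof.
by move=> Ux fg; apply: near_eq_derive; near do apply: fg; exact: open_nbhs_nbhs.
Unshelve. all: by end_near. Qed.

Lemma derivable_eq v f g x : U x -> (forall y, U y -> f y = g y) ->
  derivable f x v -> derivable g x v.
Proof.
move=> Ux fg; apply: near_eq_derivable; near do apply: fg.
exact: open_nbhs_nbhs.
Unshelve. all: by end_near. Qed.

Lemma continuous_eq f g x : U x -> (forall y, U y -> f y = g y) ->
  {for x, continuous f} -> {for x, continuous g}.
Proof.
move=> Ux fg cf; suff: g y @[y --> x] --> f x by rewrite fg.
have N : nbhs x U by exact: open_nbhs_nbhs.
apply: cvg_trans cf; apply: (@near_eq_cvg _ _ (nbhs x) _ f g).
by near=> y; apply: fg; near: y; exact: N.
Unshelve. all: by end_near. Qed.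

Lemma Cn_eq k f g : (forall y, U y -> f y = g y) -> Cn_on k U f -> Cn_on k U g.
Proof.
elim: k f g => [|k IH] f g fg [cf df]; split; try by [].
- by move=> x Ux; apply: (continuous_eq Ux fg); exact: cf.
- by move=> x Ux; apply: (continuous_eq Ux fg); exact: cf.
move=> i; have [fi Ci] := df i; split.
  by move=> x Ux; apply: (derivable_eq Ux fg); exact: fi.
by apply: IH Ci => y Uy; exact: partial_eq.
Qed.

Lemma CnS k f : Cn_on k.+1 U f -> Cn_on k U f.
Proof.
elim: k f => [|k IH] f [cf df]; split => // i; have [fi Ci] := df i; split => //.
exact: IH.
Qed.

Lemma Cn_cst k (c : R) : Cn_on k U (cst c).
Proof.
elim: k c => [|k IH] c; (split; first by move=> x _; exact: cst_continuous) => // i.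
split; first by move=> x _; exact: derivable_cst.
by apply: Cn_eq (IH 0) => y _; rewrite /partial derive_cst.
Qed.

Lemma CnD k f g : Cn_on k U f -> Cn_on k U g -> Cn_on k U (f \+ g).
Proof.
elim: k f g => [|k IH] f g [cf df] [cg dg]; (split;
  first by move=> x Ux; apply: continuousD; [exact: cf|exact: cg]) => // i.
have [fi Ci] := df i; have [gi Di] := dg i; split.
  by move=> x Ux; apply: derivableD; [exact: fi|exact: gi].
apply: Cn_eq (IH _ _ Ci Di) => y Uy.
by rewrite /partial deriveD; [|exact: fi|exact: gi].
Qed.

Lemma CnN k f : Cn_on k U f -> Cn_on k U (\- f).
Proof.
elim: k f => [|k IH] f [cf df]; (split;
  first by move=> x Ux; apply: continuousN; exact: cf) => // i.
have [fi Ci] := df i; split.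
  by move=> x Ux; apply: derivableN; exact: fi.
apply: Cn_eq (IH _ Ci) => y Uy.
by rewrite /partial deriveN; [|exact: fi].
Qed.

Lemma CnM k f g : Cn_on k U f -> Cn_on k U g -> Cn_on k U (f \* g).
Proof.
elim: k f g => [|k IH] f g Cf Cg; have [cf df] := Cf; have [cg dg] := Cg;
  (split; first by move=> x Ux; apply: continuousM; [exact: cf|exact: cg]) => // i.
have [fi Ci] := df i; have [gi Di] := dg i; split.
  by move=> x Ux; apply: derivableM; [exact: fi|exact: gi].
apply: Cn_eq (CnD (IH _ _ (CnS Cf) Di) (IH _ _ (CnS Cg) Ci)) => y Uy.
by rewrite /partial deriveM; [|exact: fi|exact: gi].
Qed.

Lemma CnV k f : (forall x, U x -> f x != 0) -> Cn_on k U f ->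
  Cn_on k U (fun x => (f x)^-1).
Proof.
move=> f0; elim: k => [|k IH] Cf; have [cf df] := Cf; (split;
  first by move=> x Ux; apply: continuousV; [exact: f0|exact: cf]) => // i.
have [fi Ci] := df i; split.
  by move=> x Ux; apply: derivableV; [exact: f0|exact: fi].
have IHf := IH (CnS Cf).
apply: Cn_eq (CnN (CnM (CnM IHf IHf) Ci)) => y Uy.
rewrite /partial deriveV; [|exact: f0|exact: fi].
by rewrite /= -[RHS]/(_ * _) mulNr expr2 invfM.
Qed.

Lemma Cn_sqrt k f : (forall x, U x -> 0 < f x) -> Cn_on k U f ->
  Cn_on k U (fun x => Num.sqrt (f x)).
Proof.
move=> f0; elim: k => [|k IH] Cf; have [cf df] := Cf; (split;
  first by move=> x Ux; apply: (@continuous_comp _ _ _ f Num.sqrt);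
    [exact: cf|exact: sqrt_continuous]) => // i.
have [fi Ci] := df i; have dx x : U x -> is_derive x 'e_i (Num.sqrt \o f)
    ((2 * Num.sqrt (f x))^-1 * 'D_('e_i) f x).
  move=> Ux; apply: derive_chain; first exact: fi.
  by apply: is_derive1_sqrt; exact: f0.
split; first by move=> x /dx[].
have IHf := IH (CnS Cf).
have s0 x : U x -> Num.sqrt (f x) != 0.
  by move=> Ux; rewrite gt_eqF // sqrtr_gt0 f0.
apply: Cn_eq (CnM (CnM (Cn_cst _ 2^-1) (CnV s0 IHf)) Ci) => y /dx[_ E].
by rewrite /partial E /= invfM.
Qed.

Lemma second_difference_eq (a b c d h p q : R) : h != 0 ->
  a - b - c + d = h * (h * p) -> a - c - b + d = h * (h * q) -> p = q.
Proof.
by move=> h0; rewrite (addrAC a) => -> /(mulfI h0)/(mulfI h0).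
Qed.

Lemma ler_dist_common (a b p e : R) :
  `|a - p| <= e / 2 -> `|b - p| <= e / 2 -> `|a - b| <= e.
Proof.
move=> ap bp; have -> : a - b = (a - p) - (b - p) by ring.
by rewrite (splitr e); apply: le_trans (ler_normB _ _) _; exact: lerD.
Qed.

(** Schwarz' theorem: the second difference quotient is a mixed derivative at
    nearby points, in either order. *)
Lemma partialC i j f x : Cn_on 2 U f -> U x ->
  partial i (partial j f) x = partial j (partial i f) x.
Proof.
move=> [_ Cf] Ux; have [fi [ci Ci]] := Cf i; have [fj [cj Cj]] := Cf j.
have [fij [cij _]] := Ci j; have [fji [cji _]] := Cj i.
apply/eqP; rewrite -subr_eq0 -normr_le0; apply/ler_addgt0Pl => e e0; rewrite addr0.
have e2 : 0 < e / 2 by rewrite divr_gt0.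
have H1 : nbhs x U by exact: open_nbhs_nbhs.
have /cvgrPdist_le/(_ _ e2) H2 := cji _ Ux.
have /cvgrPdist_le/(_ _ e2) H3 := cij _ Ux.
have /nbhs_ballP[d d0 {}H1] : \forall y \near x, U y /\
    (`|partial i (partial j f) x - partial i (partial j f) y| <= e / 2 /\
     `|partial j (partial i f) x - partial j (partial i f) y| <= e / 2).
  exact: filterI H1 (filterI H2 H3).
have dP y : ball x d y -> [/\ U y,
    `|partial i (partial j f) x - partial i (partial j f) y| <= e / 2 &
    `|partial j (partial i f) x - partial j (partial i f) y| <= e / 2].
  by move=> /H1[Uy [A B]]; exact: And3 Uy A B.
pose h := d / (`|'e_i : 'rV[R]_n| + `|'e_j : 'rV[R]_n| + 1).
have N0 : 0 < `|'e_i : 'rV[R]_n| + `|'e_j : 'rV[R]_n| + 1.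
  by rewrite ltr_wpDl // addr_ge0.
have h0 : 0 < h by rewrite divr_gt0.
have B s t : `|s| <= `|h| -> `|t| <= `|h| ->
    ball x d (x + s *: 'e_i + t *: 'e_j).
  move=> sh th; rewrite -ball_normE /ball_ /= opprD opprD !addrA subrr sub0r -opprD normrN.
  apply: le_lt_trans (ler_normD _ _) _; rewrite !normrZ.
  apply: (@le_lt_trans _ _ (h * (`|'e_i : 'rV[R]_n| + `|'e_j : 'rV[R]_n|))).
    by move: sh th; rewrite (gtr0_norm h0) => sh th; rewrite mulrDr lerD // ler_wpM2r.
  have -> : d = h * (`|'e_i : 'rV[R]_n| + `|'e_j : 'rV[R]_n| + 1).
    by rewrite /h divfK // gt_eqF.
  by rewrite ltr_pM2l // ltrDl.
(* the second difference, computed in both orders *)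
have key (p q : 'I_n) : (forall y, U y -> derivable f y 'e_p) ->
    (forall y, U y -> derivable (partial p f) y 'e_q) ->
    (forall s t, `|s| <= `|h| -> `|t| <= `|h| ->
       ball x d (x + s *: 'e_p + t *: 'e_q)) ->
    exists s t, [/\ `|s| <= `|h|, `|t| <= `|h| &
      f (x + h *: 'e_p + h *: 'e_q) - f (x + h *: 'e_p) - f (x + h *: 'e_q) + f x
      = h * (h * partial q (partial p f) (x + s *: 'e_p + t *: 'e_q))].
  move=> fp fpq Bpq; pose F y := f (y + h *: 'e_q) - f y.
  have FE y : derivable f (y + h *: 'e_q) 'e_p -> derivable f y 'e_p ->
     is_derive y 'e_p F (partial p f (y + h *: 'e_q) - partial p f y).
    move=> d1 d2; have E : is_derive y 'e_p (fun z => f (z + h *: 'e_q))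
        (partial p f (y + h *: 'e_q)).
      have Eq : (fun l : R => l^-1 *: (((fun z => f (z + h *: 'e_q)) \o shift y)
          (l *: ('e_p : 'rV[R]_n)) - f (y + h *: 'e_q))) =
        (fun l : R => l^-1 *: ((f \o shift (y + h *: 'e_q)) (l *: 'e_p) - f (y + h *: 'e_q))).
        by apply/funext => l /=; rewrite addrA.
      by split; rewrite /derivable /partial /derive Eq.
    apply: is_deriveB; exact: derivableP.
  have Fd s : `|s| <= `|h| -> is_derive (x + s *: 'e_p) 'e_p F
      (partial p f (x + s *: 'e_p + h *: 'e_q) - partial p f (x + s *: 'e_p)).
    move=> sh; apply: FE; apply: fp.
      by case: (dP _ (Bpq s h sh (lexx _))).
    by rewrite -[_ + _]addr0 -(scale0r 'e_q); case: (dP _ (Bpq s 0 sh _)); rewrite // normr0.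
  have [s sh Es] := @MVT_line _ _ F x 'e_p h (fun s sh => @ex_derive _ _ _ _ _ _ _ (Fd s sh)).
  have [t th Et] := @MVT_line _ _ (partial p f) (x + s *: 'e_p) 'e_q h
    (fun t th => fpq _ (let: And3 a _ _ := dP _ (Bpq s t sh th) in a)).
  exists s, t; split=> //; rewrite -Et.
  have := @derive_val _ _ _ _ _ _ _ (Fd s sh) => <-; rewrite -Es /F.
  by rewrite opprB addrA addrAC; ring.
have [s [t [sh th E]]] := key i j fi fij B.
have [|s' [t' [sh' th' E']]] := key j i fj fji.
  by move=> a b ah bh; rewrite addrAC; exact: B.
rewrite [x + h *: 'e_j + _]addrAC in E'.
have EE := second_difference_eq (lt0r_neq0 h0) E E'.
have [_ _ J1] := dP _ (B s t sh th); rewrite EE in J1.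
have := dP _ (B t' s' th' sh'); rewrite addrAC => -[_ J2 _].
exact: ler_dist_common J2 J1.
Qed.

(** The coordinate directions are added one at a time. *)
Lemma derive_partial f x v : Cn_on 1 U f -> U x ->
  is_derive x v f (\sum_i v 0 i * partial i f x).
Proof.
move=> [_ Cf] Ux.
have H (r : seq 'I_n) : is_derive x (\sum_(i <- r) v 0 i *: 'e_i) f
    (\sum_(i <- r) v 0 i * partial i f x).
  elim: r => [|i r IH]; first by rewrite !big_nil; exact: is_derive0.
  have [fi [ci _]] := Cf i.
  rewrite !big_cons addrC [X in is_derive _ _ _ X]addrC.
  rewrite -(@derive_val _ _ _ _ _ _ _ IH).
  apply: derive_addl; last by case: IH.
    by near do apply: fi; exact: open_nbhs_nbhs.
  exact: ci.
by rewrite {1}[v]row_sum_delta; exact: H.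
Unshelve. all: by end_near. Qed.

Lemma partial_max f x i : Cn_on 1 U f -> U x ->
  (forall y, U y -> f y <= f x) -> partial i f x = 0.
Proof.
move=> [_ Cf] Ux fx; have [fi _] := Cf i.
have /nbhs_ballP[d d0 dP] : nbhs x U by exact: open_nbhs_nbhs.
pose h := d / (`|'e_i : 'rV[R]_n| + 1).
have N0 : 0 < `|'e_i : 'rV[R]_n| + 1 by rewrite ltr_wpDl.
have h0 : 0 < h by rewrite divr_gt0.
have B s : s \in `]-h, h[%R -> U (x + s *: 'e_i).
  rewrite in_itv /= -ltr_norml => sh; apply: dP.
  rewrite -ball_normE /ball_ /= opprD addrA subrr sub0r normrN normrZ.
  apply: (@le_lt_trans _ _ (h * `|'e_i : 'rV[R]_n|)).
    by rewrite ler_wpM2r // ltW.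
  have -> : d = h * (`|'e_i : 'rV[R]_n| + 1) by rewrite /h divfK // gt_eqF.
  by rewrite ltr_pM2l // ltrDl.
have dl s : U (x + s *: 'e_i) -> is_derive s 1 (fun s : R => f (x + s *: 'e_i))
    (partial i f (x + s *: 'e_i)).
  by move=> Us; apply: is_derive_line; exact: fi.
have [] := @derive1_at_max _ (fun s : R => f (x + s *: 'e_i)) (- h) h 0.
- by rewrite ge0_cp // ltW.
- by move=> t /B /dl [].
- by rewrite in_itv /= oppr_lt0 h0.
- by move=> t /B Ut; rewrite scale0r addr0; exact: fx.
have [|_ E _] := dl 0; first by rewrite scale0r addr0.
by rewrite E scale0r addr0.
Qed.

(** Second derivative test: if the second derivative along [v] were positive, the
    first one would be positive right after [x], and the mean value theorem would
    give larger values of [f]. *)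
Lemma hessian_max f (x v : 'rV[R]_n) : Cn_on 2 U f -> U x -> (forall y, U y -> f y <= f x) ->
  \sum_(i < n) \sum_(j < n) v 0 i * v 0 j * partial j (partial i f) x <= 0.
Proof.
move=> Cf Ux fx; rewrite leNgt; apply/negP => q0.
have Cf1 := CnS Cf; have [_ Cfi] := Cf.
pose g y := \sum_(i < n) v 0 i * partial i f y.
have Dg y : U y -> is_derive y v f (g y) by move=> Uy; exact: derive_partial.
have gx : g x = 0 by rewrite /g big1 // => i _; rewrite partial_max ?mulr0.
have Cg : Cn_on 1 U g.
  have : Cn_on 1 U (\sum_i (cst (v 0 i) \* partial i f)).
    elim/big_ind: _ => [|a b|i _]; [exact: Cn_cst|exact: CnD|].
    by apply: CnM; [exact: Cn_cst|have [_] := Cfi i].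
  by apply: Cn_eq => y _; rewrite fct_sumE.
have [gd gE] := derive_partial v Cg Ux.
set q := \sum_i \sum_j _ in q0.
have {}gE : 'D_v g x = q.
  rewrite gE /q exchange_big /=; apply: eq_bigr => j _.
  have -> : partial j g x = \sum_i v 0 i * partial j (partial i f) x.
    have -> : g = \sum_i (cst (v 0 i) \* partial i f).
      by rewrite fct_sumE.
    rewrite /partial derive_sum => [|i].
      apply: eq_bigr => i _; rewrite deriveM; first by rewrite derive_cst scaler0 addr0.
        exact: derivable_cst.
      by have [_ [_ /(_ j)[H _]]] := Cfi i; exact: H.
    apply: derivableM; first exact: derivable_cst.
    by have [_ [_ /(_ j)[H _]]] := Cfi i; exact: H.
  by rewrite mulr_sumr; apply: eq_bigr => i _; ring.
have /cvgrPdist_lt/(_ _ q0) := gd; rewrite -[lim _]/('D_v g x) gE => H.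
have /nbhs_ballP[d d0 dP] : nbhs x U by exact: open_nbhs_nbhs.
have [e e0 eP] : exists2 e, 0 < e & forall h, 0 < h -> h < e -> 0 < g (x + h *: v).
  have /nbhs_ballP[e e0 eP] := H; exists e => // h h0 he.
  have : ball (0 : R) e h by rewrite -ball_normE /ball_ /= sub0r normrN gtr0_norm.
  move=> /eP /(_ (lt0r_neq0 h0)) /=; rewrite gx subr0 [h *: v + x]addrC.
  rewrite ltr_norml => /andP[_]; rewrite gtrBl.
  by rewrite [_ *: _]/(_ * _) pmulr_rgt0 ?invr_gt0.
pose N := `|v| + 1; have N0 : 0 < N by rewrite ltr_wpDl.
pose h := Num.min (e / 2) (d / N).
have h0 : 0 < h by rewrite lt_min !divr_gt0.
have he : h < e by rewrite (@le_lt_trans _ _ (e / 2)) ?ge_min ?lexx // ltr_pdivrMr // ltr_pMr // ltr1n.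
have B s : `|s| <= `|h| -> U (x + s *: v).
  rewrite (gtr0_norm h0) => sh; apply: dP.
  rewrite -ball_normE /ball_ /= opprD addrA subrr sub0r normrN normrZ.
  apply: (@le_lt_trans _ _ (h * `|v|)); first by rewrite ler_wpM2r.
  apply: (@lt_le_trans _ _ (h * N)); first by rewrite ltr_pM2l // ltrDl.
  by rewrite -ler_pdivlMr // ge_min lexx orbT.
have [|c /andP[c0 ch] E] := @MVT_line_pos _ _ f x v h h0.
  move=> s /andP[s0 sh]; have [|+ _] := Dg (x + s *: v); last by [].
  by apply: B; rewrite !ger0_norm // ltW.
have Uc : U (x + c *: v) by apply: B; rewrite !gtr0_norm // ltW.
have := fx _ (B h (lexx _)); rewrite leNgt => /negP; apply.
rewrite -subr_gt0 E; have [_ ->] := Dg _ Uc.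
by rewrite mulr_gt0 // eP // (lt_trans ch).
Unshelve. all: by end_near. Qed.

End SmoothOn.

(** * The ring of smooth functions *)

Section SmoothRing.
Variables (R : realType) (n : nat) (U : set 'rV[R]_n) (oU : open U).

(** The proof that [U] is open belongs to the predicate because closure under
    the ring operations depends on it, and canonical instances can only find it
    there. *)
Definition smooth_pred of open U : {pred ('rV[R]_n -> R)} :=
  fun f => `[< smooth_on U f >].

Lemma smoothP (f : 'rV[R]_n -> R) : reflect (smooth_on U f) (f \in smooth_pred oU).
Proof. exact: asboolP. Qed.

Lemma smooth_subring : GRing.subring_closed (smooth_pred oU).
Proof.
split=> [|f g /smoothP sf /smoothP sg|f g /smoothP sf /smoothP sg]; apply/smoothP => k.
- exact: (Cn_cst oU).
- by apply: (CnD oU); [exact: sf|apply: (CnN oU); exact: sg].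
- by apply: (CnM oU); [exact: sf|exact: sg].
Qed.

HB.instance Definition _ :=
  GRing.isSubringClosed.Build ('rV[R]_n -> R) (smooth_pred oU) smooth_subring.

Definition smoothfun := {f : 'rV[R]_n -> R | f \in smooth_pred oU}.
HB.instance Definition _ := SubChoice.on smoothfun.
HB.instance Definition _ := [SubChoice_isSubComNzRing of smoothfun by <:].

Lemma smooth_val (f : smoothfun) : smooth_on U (\val f).
Proof. exact/smoothP/(valP f). Qed.

Definition mk_smooth (f : 'rV[R]_n -> R) (sf : smooth_on U f) : smoothfun :=
  Sub f (introT (smoothP f) sf).

Lemma mk_smoothE f sf : \val (@mk_smooth f sf) = f.
Proof. by rewrite SubK. Qed.

(** Cutting off at the boundary of [U] makes partial differentiation a
    derivation for the equality of functions on the whole space. *)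
Definition cut (f : 'rV[R]_n -> R) x : R := if `[< U x >] then f x else 0.

Lemma cutE f x : U x -> cut f x = f x.
Proof. by rewrite /cut; case: asboolP. Qed.

Lemma cut_smooth f : smooth_on U f -> smooth_on U (cut f).
Proof. by move=> sf k; apply: Cn_eq (sf k) => // y Uy; rewrite cutE. Qed.

Lemma smooth_cn f : smooth_on U f -> forall i, smooth_on U (partial i f).
Proof. by move=> sf i k; have [_ /(_ i)[]] := sf k.+1. Qed.

Lemma smooth_derivable f : smooth_on U f ->
  forall i x, U x -> derivable f x 'e_i.
Proof. by move=> sf i; have [_ /(_ i)[H _]] := sf 1%N. Qed.

Definition sder i (f : smoothfun) : smoothfun :=
  mk_smooth (cut_smooth (smooth_cn (smooth_val f) i)).

Lemma sder_val i f x : U x -> \val (sder i f) x = partial i (\val f) x.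
Proof. by move=> Ux; rewrite mk_smoothE cutE. Qed.

Lemma sder_out i f x : ~ U x -> \val (sder i f) x = 0.
Proof. by move=> nUx; rewrite mk_smoothE /cut asboolF. Qed.

Lemma sder_morph i : {morph sder i : f g / f + g}.
Proof.
move=> f g; apply/val_inj/funext => x.
have -> : \val (sder i f + sder i g) x = \val (sder i f) x + \val (sder i g) x.
  by rewrite rmorphD.
have [Ux|nUx] := pselect (U x); last by rewrite !sder_out // addr0.
rewrite !sder_val // rmorphD /partial deriveD //.
- exact: smooth_derivable (smooth_val f) _ _ Ux.
- exact: smooth_derivable (smooth_val g) _ _ Ux.
Qed.

Lemma sderM i f g : sder i (f * g) = sder i f * g + f * sder i g.
Proof.
apply/val_inj/funext => x.
have -> : \val (sder i f * g + f * sder i g) x =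
   \val (sder i f) x * \val g x + \val f x * \val (sder i g) x.
  by rewrite rmorphD !rmorphM.
have [Ux|nUx] := pselect (U x); last by rewrite !sder_out // mulr0 mul0r addr0.
rewrite !sder_val // rmorphM /partial deriveM.
- by rewrite addrC; congr (_ + _); rewrite -[_ *: _]/(_ * _) mulrC.
- exact: smooth_derivable (smooth_val f) _ _ Ux.
- exact: smooth_derivable (smooth_val g) _ _ Ux.
Qed.

Lemma sderC i j f : sder i (sder j f) = sder j (sder i f).
Proof.
apply/val_inj/funext => x; have [Ux|nUx] := pselect (U x); last first.
  by rewrite !sder_out.
have E p q : \val (sder p (sder q f)) x = partial p (partial q (\val f)) x.
  rewrite sder_val //; apply: (partial_eq oU p Ux) => y Uy.
  exact: sder_val.
rewrite !E; exact: (partialC oU i j (smooth_val f 2) Ux).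
Qed.

Definition sev (x : 'rV[R]_n) (f : smoothfun) : R := \val f x.

Lemma sev_zmod x : {morph sev x : f g / f - g}.
Proof. by move=> f g; rewrite /sev rmorphB. Qed.

Lemma sev_monoid x : monoid_morphism (sev x).
Proof. by split; [rewrite /sev rmorph1|move=> f g; rewrite /sev rmorphM]. Qed.

HB.instance Definition _ x :=
  GRing.isZmodMorphism.Build smoothfun R (sev x) (@sev_zmod x).
HB.instance Definition _ x :=
  GRing.isMonoidMorphism.Build smoothfun R (sev x) (sev_monoid x).

Lemma sev_sder x i f : U x -> sev x (sder i f) = partial i (\val f) x.
Proof. exact: sder_val. Qed.

Lemma smooth_ext (f g : smoothfun) : (forall x, sev x f = sev x g) -> f = g.
Proof. by move=> fg; apply/val_inj/funext. Qed.

End SmoothRing.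

(** * Iterated integrals of compactly supported functions *)

Section OneDim.
Variable R : realType.
Local Notation mu := (@lebesgue_measure R).
Local Notation I1 F := (Rintegral mu [set: R] F).
Implicit Types F G : R -> R.

Definition ucont1 F := forall e : R, 0 < e ->
  exists2 d : R, 0 < d & forall s t : R, `|s - t| < d -> `|F s - F t| <= e.
Definition csupp1 (B : R) F := forall t, B < `|t| -> F t = 0.

Lemma ucont1_continuous F : ucont1 F -> continuous F.
Proof.
move=> uF x; apply/cvgrPdist_le => e e0; have [d d0 dP] := uF e e0.
by apply/nbhs_ballP; exists d => // y yx; apply: dP; exact: yx.
Qed.

Section Support.
Variables (B : R) (B0 : 0 < B).

Lemma csupp1_restrict F : csupp1 B F -> F = F \_ `[- B, B].
Proof.
move=> sF; apply/funext => t; rewrite patchE; case: ifPn => //.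
rewrite notin_setE /= in_itv /= -ler_norml => /negP; rewrite -ltNge.
exact: sF.
Qed.

Lemma segment_integrable F (a b : R) : {within `[a, b], continuous F} ->
  mu.-integrable `[a, b] (EFin \o F).
Proof. by move=> cF; apply: continuous_compact_integrable => //; exact: segment_compact. Qed.

Lemma restrict_integrable F (a b : R) : {within `[a, b], continuous F} ->
  mu.-integrable [set: R] (EFin \o (F \_ `[a, b])).
Proof.
move=> cF; rewrite -restrict_EFin.
have := @integrable_mkcond _ _ R mu _ (EFin \o F) (measurable_itv `[a, b]).
by move=> [H _]; apply: H; exact: segment_integrable.
Qed.

Lemma csupp1_integrable F : csupp1 B F -> continuous F ->
  mu.-integrable [set: R] (EFin \o F).
Proof.
move=> sF cF; rewrite (csupp1_restrict sF); apply: restrict_integrable.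
exact: continuous_subspaceT.
Qed.

Lemma I1_restrict (a b c : R) : a <= b ->
  I1 ((cst c : R -> R) \_ `[a, b]) = c * (b - a).
Proof.
move=> ab; rewrite -Rintegral_mkcond Rintegral_cst //= lebesgue_measure_itv /=.
rewrite lte_fin; case: ltgtP ab => //= -> _; first by rewrite subrr.
Qed.

Lemma I1_bound F (e : R) : csupp1 B F -> continuous F -> (forall t, `|F t| <= e) ->
  `|I1 F| <= e * (2 * B).
Proof.
move=> sF cF Fe; have iF := csupp1_integrable sF cF.
have ic c : mu.-integrable [set: R] (EFin \o ((cst c : R -> R) \_ `[- B, B])).
  by apply: restrict_integrable; apply: continuous_subspaceT => x; exact: cvg_cst.
have Bc c : I1 ((cst c : R -> R) \_ `[- B, B]) = c * (2 * B).
  by rewrite I1_restrict // ?ge0_cp ?ltW //; ring.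
have FE t : F t = (F \_ `[- B, B]) t by rewrite -csupp1_restrict.
rewrite ler_norml -mulNr -!Bc; apply/andP; split.
  apply: le_Rintegral; [by []|exact: ic|exact: iF|] => t _.
  rewrite FE !patchE; case: ifP => //= _.
  by have := Fe t; rewrite ler_norml => /andP[].
apply: le_Rintegral; [by []|exact: iF|exact: ic|] => t _.
rewrite FE !patchE; case: ifP => //= _.
by have := Fe t; rewrite ler_norml => /andP[].
Qed.

Lemma I1_gt0 F t0 : csupp1 B F -> continuous F -> (forall t, 0 <= F t) ->
  0 < F t0 -> 0 < I1 F.
Proof.
move=> sF cF F0 Ft0; have iF := csupp1_integrable sF cF.
have c0 : 0 < F t0 / 2 by rewrite divr_gt0.
have /cvgrPdist_le/(_ _ c0)/nbhs_ballP[d /= d0 dP] := cF t0.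
have d2 : 0 < d / 2 by rewrite divr_gt0.
pose a := t0 - d / 2; pose b := t0 + d / 2.
have ab : a <= b by rewrite lerD2l ge0_cp // ltW.
apply: (@lt_le_trans _ _ (I1 ((cst (F t0 / 2) : R -> R) \_ `[a, b]))).
  rewrite I1_restrict // mulr_gt0 //.
  by have -> : b - a = d by rewrite /a /b; field.
apply: le_Rintegral; [by []| |exact: iF|move=> t _].
  by apply: restrict_integrable; apply: continuous_subspaceT => x; exact: cvg_cst.
case: ifPn => // /set_mem /=.
rewrite in_itv /= => tab.
have : ball t0 d t.
  rewrite -ball_normE /ball_ /= distrC (@le_lt_trans _ _ (d / 2)) //.
    by rewrite ler_distl.
  by rewrite ltr_pdivrMr // ltr_pMr // ltr1n.
move=> /dP; rewrite ler_norml => /andP[_]; lra.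
Qed.

(** The fundamental theorem of calculus on an interval containing the support in
    its interior. *)
Lemma I1_derive F G : csupp1 B F -> csupp1 B G -> continuous G ->
  (forall t : R, is_derive t (1 : R) F (G t)) -> I1 G = 0.
Proof.
move=> sF sG cG dF; pose C := B + 1.
have C0 : 0 < C by rewrite addr_gt0.
have sGC : csupp1 C G by move=> t Ct; apply: sG; apply: lt_trans Ct; rewrite ltrDl.
have dFx x : derivable F x 1 by have [] := dF x.
have cF : continuous F.
  by move=> x; apply/differentiable_continuous/derivable1_diffP.
have FC t : `|t| = C -> F t = 0 by move=> tC; apply: sF; rewrite tC ltrDl.
have -> : G = G \_ `[- C, C].
  apply/funext => t; rewrite patchE; case: ifPn => //.
  rewrite notin_setE /= in_itv /= -ler_norml => /negP; rewrite -ltNge.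
  exact: sGC.
rewrite -Rintegral_mkcond /Rintegral (@continuous_FTC2 _ G F).
- by rewrite !FC ?normrN ?gtr0_norm // subee.
- by rewrite gt0_cp.
- exact: continuous_subspaceT.
- split; first by move=> x _; exact: dFx.
    by apply: cvg_at_right_filter; exact: cF.
  by apply: cvg_at_left_filter; exact: cF.
- by move=> x _; rewrite derive1E; have [] := dF x.
Qed.

End Support.
End OneDim.

Section Iterated.
Variables (R : realType) (B : R).
Hypothesis B0 : 0 < B.
Local Notation mu := (@lebesgue_measure R).

(** Uniform continuity, unlike continuity, passes directly to slices and to the
    integrals of slices, which is what the induction on the dimension requires. *)
Definition ucont n (f : 'rV[R]_n -> R) := forall e : R, 0 < e ->
  exists2 d : R, 0 < d & forall x y : 'rV[R]_n, (forall i, `|x 0 i - y 0 i| < d) ->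
    `|f x - f y| <= e.
Definition csupp n (f : 'rV[R]_n -> R) := forall (x : 'rV[R]_n) i, B < `|x 0 i| -> f x = 0.
Definition ucc n (f : 'rV[R]_n -> R) := ucont f /\ csupp f.

Definition slice n (f : 'rV[R]_n.+1 -> R) (t : R) : 'rV[R]_n -> R :=
  fun y => f (row_mx (const_mx t : 'rV_1) y).

Lemma integral_rVS n (f : 'rV[R]_n.+1 -> R) : integral_rV f =
  Rintegral mu [set: R] (fun t => integral_rV (slice f t)).
Proof. by []. Qed.

Lemma row_mx0 n (t : R) (y : 'rV[R]_n) :
  (row_mx (const_mx t : 'rV_1) y : 'rV_n.+1) 0 ord0 = t.
Proof.
rewrite mxE; case: splitP => [j _|j]; first by rewrite mxE.
by [].
Qed.

Lemma row_mxS n (t : R) (y : 'rV[R]_n) (i : 'I_n) :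
  (row_mx (const_mx t : 'rV_1) y : 'rV_n.+1) 0 (lift ord0 i) = y 0 i.
Proof.
rewrite mxE; case: splitP => j /=; rewrite /bump add1n.
  by case: j => [[]].
by move=> [ij]; congr (y 0 _); apply: val_inj.
Qed.

Lemma slice_split n (x : 'rV[R]_n.+1) : exists t (y : 'rV[R]_n),
  x = row_mx (const_mx t : 'rV_1) y.
Proof.
exists (x 0 ord0), (\row_i x 0 (lift ord0 i)); apply/rowP => i.
case: (unliftP ord0 i) => [j ->|->]; last by rewrite row_mx0.
by rewrite row_mxS mxE.
Qed.

Lemma uccD n (f g : 'rV[R]_n -> R) : ucc f -> ucc g -> ucc (fun x => f x + g x).
Proof.
move=> [uf sf] [ug sg]; split=> [e e0|x i xi]; last by rewrite (sf x i) ?(sg x i) ?addr0.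
have e2 : 0 < e / 2 by rewrite divr_gt0.
have [d d0 dP] := uf _ e2; have [d' d'0 d'P] := ug _ e2.
exists (Num.min d d') => [|x y xy]; first by rewrite lt_min d0.
have -> : f x + g x - (f y + g y) = (f x - f y) + (g x - g y) by ring.
rewrite (splitr e); apply: le_trans (ler_normD _ _) _; apply: lerD.
  by apply: dP => i; have := xy i; rewrite lt_min => /andP[].
by apply: d'P => i; have := xy i; rewrite lt_min => /andP[].
Qed.

Lemma uccZ n c (f : 'rV[R]_n -> R) : ucc f -> ucc (fun x => c * f x).
Proof.
move=> [uf sf]; split=> [e e0|x i xi]; last by rewrite (sf x i) ?mulr0.
have c1 : 0 < `|c| + 1 by rewrite ltr_wpDl.
have [d d0 dP] := uf _ (divr_gt0 e0 c1); exists d => // x y /dP xy.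
rewrite -mulrBr normrM; apply: le_trans (ler_wpM2l (normr_ge0 c) xy) _.
rewrite mulrCA ger_pMr // ler_pdivrMr // mul1r lerDl //.
Qed.

Lemma ucc_slice n (f : 'rV[R]_n.+1 -> R) t : ucc f -> ucc (slice f t).
Proof.
move=> [uf sf]; split=> [e e0|x i xi].
  have [d d0 dP] := uf e e0; exists d => // x y xy; apply: dP => i.
  case: (unliftP ord0 i) => [j ->|->]; first by rewrite !row_mxS.
  by rewrite !row_mx0 subrr normr0.
by apply: (sf _ (lift ord0 i)); rewrite row_mxS.
Qed.

Lemma slice_csupp n (f : 'rV[R]_n.+1 -> R) t : csupp f -> B < `|t| ->
  slice f t = (fun=> 0).
Proof. by move=> sf Bt; apply/funext => y; apply: (sf _ ord0); rewrite row_mx0. Qed.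

Lemma integral_rV0 n : integral_rV (fun _ : 'rV[R]_n => 0) = 0.
Proof.
elim: n => [//|n IH]; rewrite integral_rVS /Rintegral.
by under eq_integral do rewrite IH; rewrite integral0.
Qed.

(** The basic properties of the iterated integral are proved together: those
    in dimension [n] give the continuity of the integral of a slice, which is
    needed in dimension [n + 1]. *)
Lemma integral_rV_props n :
  [/\ forall f g : 'rV[R]_n -> R, ucc f -> ucc g ->
        integral_rV (fun x => f x + g x) = integral_rV f + integral_rV g,
      forall c (f : 'rV[R]_n -> R), ucc f ->
        integral_rV (fun x => c * f x) = c * integral_rV f &
      forall (f : 'rV[R]_n -> R) (e : R), ucc f -> (forall x, `|f x| <= e) ->
        `|integral_rV f| <= e * (2 * B) ^+ n].
Proof.
elim: n => [|n [ID IZ IB]]; first by split => // f e _ fe; rewrite expr0 mulr1; exact: fe.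
have sliceB f g : ucc f -> ucc g -> integral_rV f - integral_rV g =
    integral_rV (fun x : 'rV[R]_n => f x - g x).
  move=> uf ug; rewrite -mulN1r -IZ // -ID //; last exact: uccZ.
  by congr integral_rV; apply/funext => x; rewrite mulN1r.
have ucF f : ucc f -> ucont1 (fun t => integral_rV (@slice n f t)).
  move=> ucf; have [uf sf] := ucf; move=> e e0.
  have N0 : 0 < (2 * B) ^+ n by rewrite exprn_gt0 // mulr_gt0.
  have [d d0 dP] := uf _ (divr_gt0 e0 N0); exists d => // s t st.
  rewrite sliceB; try exact: ucc_slice.
  have -> : e = e / (2 * B) ^+ n * (2 * B) ^+ n by rewrite divfK // gt_eqF.
  apply: IB => [|y].
    have := uccD (ucc_slice s ucf) (uccZ (-1) (ucc_slice t ucf)).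
    by congr ucc; apply/funext => x; rewrite mulN1r.
  apply: dP => i; case: (unliftP ord0 i) => [j ->|->]; last by rewrite !row_mx0.
  by rewrite !row_mxS subrr normr0.
have cF f : ucc f -> continuous (fun t => integral_rV (@slice n f t)).
  by move=> uf; apply/ucont1_continuous/ucF.
have sF f : ucc f -> csupp1 B (fun t => integral_rV (@slice n f t)).
  by move=> [_ sf] t Bt; rewrite slice_csupp // integral_rV0.
have iF f : ucc f -> mu.-integrable [set: R]
    (EFin \o (fun t => integral_rV (@slice n f t))).
  by move=> uf; exact: csupp1_integrable (sF _ uf) (cF _ uf).
split.
- move=> f g uf ug; rewrite !integral_rVS -RintegralD //; try exact: iF.
  apply: eq_Rintegral => t _; rewrite -ID //; exact: ucc_slice.
- move=> c f uf; rewrite !integral_rVS -RintegralZl //; last exact: iF.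
  apply: eq_Rintegral => t _; rewrite -IZ //; exact: ucc_slice.
- move=> f e uf fe; rewrite integral_rVS exprSr mulrA.
  apply: I1_bound => //; [exact: sF|exact: cF|] => t.
  by apply: IB => [|y]; [exact: ucc_slice|exact: fe].
Qed.

Lemma integral_rVD n (f g : 'rV[R]_n -> R) : ucc f -> ucc g ->
  integral_rV (fun x => f x + g x) = integral_rV f + integral_rV g.
Proof. by have [H _ _] := integral_rV_props n; exact: H. Qed.

Lemma integral_rVZ n c (f : 'rV[R]_n -> R) : ucc f ->
  integral_rV (fun x => c * f x) = c * integral_rV f.
Proof. by have [_ H _] := integral_rV_props n; exact: H. Qed.

Lemma integral_rV_bound n (f : 'rV[R]_n -> R) (e : R) : ucc f ->
  (forall x, `|f x| <= e) -> `|integral_rV f| <= e * (2 * B) ^+ n.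
Proof. by have [_ _ H] := integral_rV_props n; exact: H. Qed.

Lemma uccB n (f g : 'rV[R]_n -> R) : ucc f -> ucc g -> ucc (fun x => f x - g x).
Proof.
move=> uf ug; have := uccD uf (uccZ (-1) ug).
by congr ucc; apply/funext => x; rewrite mulN1r.
Qed.

Lemma integral_rVB n (f g : 'rV[R]_n -> R) : ucc f -> ucc g ->
  integral_rV (fun x => f x - g x) = integral_rV f - integral_rV g.
Proof.
move=> uf ug; rewrite -[in RHS]mulN1r -integral_rVZ // -integral_rVD //.
  by congr integral_rV; apply/funext => x; rewrite mulN1r.
exact: uccZ.
Qed.

Lemma slice_integral_csupp n (f : 'rV[R]_n.+1 -> R) : ucc f ->
  csupp1 B (fun t => integral_rV (slice f t)).
Proof. by move=> [_ sf] t Bt; rewrite slice_csupp // integral_rV0. Qed.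

Lemma slice_integral_continuous n (f : 'rV[R]_n.+1 -> R) : ucc f ->
  continuous (fun t => integral_rV (slice f t)).
Proof.
move=> ucf; apply: ucont1_continuous; have [uf sf] := ucf; move=> e e0.
have N0 : 0 < (2 * B) ^+ n by rewrite exprn_gt0 // mulr_gt0.
have [d d0 dP] := uf _ (divr_gt0 e0 N0); exists d => // s t st.
rewrite -integral_rVB; try exact: ucc_slice.
have -> : e = e / (2 * B) ^+ n * (2 * B) ^+ n by rewrite divfK // gt_eqF.
apply: integral_rV_bound => [|y]; first by apply: uccB; exact: ucc_slice.
apply: dP => i; case: (unliftP ord0 i) => [j ->|->]; last by rewrite !row_mx0.
by rewrite !row_mxS subrr normr0.
Qed.

Lemma integral_rV_ge0 n (f : 'rV[R]_n -> R) :
  (forall x, 0 <= f x) -> 0 <= integral_rV f.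
Proof.
elim: n f => [|n IH] f f0; first exact: f0.
by apply: Rintegral_ge0 => t _; apply: IH.
Qed.

Lemma integral_rV_gt0 n (f : 'rV[R]_n -> R) x : ucc f ->
  (forall x, 0 <= f x) -> 0 < f x -> 0 < integral_rV f.
Proof.
elim: n f x => [|n IH] f x uf f0 fx; first by rewrite /= (_ : 0 = x) // thinmx0.
have [t [y E]] := slice_split x; rewrite integral_rVS.
apply: (I1_gt0 (B := B) (t0 := t)).
- exact: slice_integral_csupp.
- exact: slice_integral_continuous.
- by move=> s; apply: integral_rV_ge0 => z; exact: f0.
- apply: (IH _ y); [exact: ucc_slice|by move=> z; exact: f0|].
  by rewrite /slice -E.
Qed.

(** Integration by parts without boundary terms. In the first coordinate this
    is differentiation under the integral sign and the fundamental theorem of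
    calculus; in the others the inner integral already vanishes. *)
Lemma integral_partial n (f : 'rV[R]_n -> R) i : ucc f ->
  (forall x, derivable f x 'e_i) -> ucc (partial i f) ->
  integral_rV (partial i f) = 0.
Proof.
elim: n f i => [|n IH] f i uf df upf; first by case: i df upf.
rewrite integral_rVS.
have rowD t y (h : R) : row_mx (const_mx (t + h) : 'rV_1) y =
    row_mx (const_mx t : 'rV_1) y + h *: 'e_ord0 :> 'rV[R]_n.+1.
  apply/rowP => j; rewrite [RHS]mxE [X in _ = _ + X]mxE [X in _ = _ + _ * X]mxE.
  case: (unliftP ord0 j) => [j' ->|->].
    by rewrite !row_mxS eq_sym (negbTE (neq_lift _ _)) andbF mulr0 addr0.
  by rewrite !row_mx0 !eqxx mulr1.
case: (unliftP ord0 i) => [j|] Ei; subst i.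
  have sl t (y : 'rV[R]_n) (h : R) : row_mx (const_mx t : 'rV_1) (h *: 'e_j + y) =
      h *: 'e_(lift ord0 j) + row_mx (const_mx t : 'rV_1) y :> 'rV[R]_n.+1.
    apply/rowP => l; rewrite [RHS]mxE [X in _ = X + _]mxE [X in _ = _ * X + _]mxE.
    case: (unliftP ord0 l) => [l' ->|->].
      by rewrite !row_mxS !mxE (inj_eq lift_inj).
    by rewrite !row_mx0 (negbTE (neq_lift _ _)) andbF mulr0 add0r.
  have E t y : (fun h : R => h^-1 *: ((slice f t \o shift y) (h *: 'e_j) -
      slice f t y)) = (fun h : R => h^-1 *: ((f \o shift (row_mx (const_mx t : 'rV_1) y
      : 'rV[R]_n.+1)) (h *: 'e_(lift ord0 j)) - f (row_mx (const_mx t : 'rV_1) y))).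
    by apply/funext => h; rewrite /slice /= sl.
  have pE t : slice (partial (lift ord0 j) f) t = partial j (slice f t).
    by apply/funext => y; rewrite /partial /derive E.
  rewrite /Rintegral; under eq_integral => t _.
    rewrite pE IH; last 3 first.
    - exact: ucc_slice.
    - by move=> y; rewrite /derivable E; exact: df.
    - by rewrite -pE; exact: ucc_slice.
    over.
  by rewrite integral0.
apply: (I1_derive B0 (F := fun t => integral_rV (slice f t))).
- exact: slice_integral_csupp.
- exact: slice_integral_csupp.
- exact: slice_integral_continuous.
move=> t; set G := integral_rV _.
suff L : h^-1 *: (((fun s => integral_rV (slice f s)) \o shift t) (h *: (1 : R)) -
    integral_rV (slice f t)) @[h --> 0^'] --> G.
  by split; [apply/cvg_ex; exists G|apply: cvg_lim].
apply/cvgrPdist_le => e e0.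
have N0 : 0 < (2 * B) ^+ n by rewrite exprn_gt0 // mulr_gt0.
have [d d0 dP] := upf.1 _ (divr_gt0 e0 N0).
near=> h.
have h0 : h != 0 by near: h; exact: nbhs_dnbhs_neq.
have hd : `|h| < d by near: h; exact: dnbhs0_lt.
pose q y := h^-1 * (slice f (t + h) y - slice f t y).
have uq : ucc q by apply: uccZ; apply: uccB; exact: ucc_slice.
have -> : h^-1 *: (((fun s => integral_rV (slice f s)) \o shift t) (h *: (1 : R)) -
    integral_rV (slice f t)) = integral_rV q.
  rewrite integral_rVZ; last by apply: uccB; exact: ucc_slice.
  rewrite integral_rVB; try exact: ucc_slice.
  by rewrite /= [h *: 1]mulr1 [h + t]addrC.
rewrite -integral_rVB //; last exact: ucc_slice.
have -> : e = e / (2 * B) ^+ n * (2 * B) ^+ n by rewrite divfK // gt_eqF.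
apply: integral_rV_bound => [|y]; first by apply: uccB => //; exact: ucc_slice.
have [c ch E] := @MVT_line _ _ f (row_mx (const_mx t : 'rV_1) y : 'rV[R]_n.+1) 'e_ord0 h (fun s _ => df _).
rewrite /q /slice rowD E mulrA mulVf // mul1r; apply: dP => j.
set z := row_mx _ _; rewrite [(z + _) 0 j]mxE opprD addrA subrr sub0r normrN.
rewrite 2!mxE eqxx normrM.
apply: le_lt_trans hd; apply: le_trans ch; rewrite ler_piMr //.
by case: (_ == _); rewrite ?normr1 ?normr0.
Unshelve. all: by end_near. Qed.

End Iterated.

(** * Compactly supported and bump functions *)

Section CompactSupport.
Variables (R : realType) (n : nat).
Implicit Types (f : 'rV[R]_n -> R) (x y : 'rV[R]_n).

Lemma nbhs_cube x (P : set 'rV[R]_n) : nbhs x P ->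
  exists2 r : R, 0 < r & forall y, (forall i, `|y 0 i - x 0 i| <= r) -> P y.
Proof.
move=> /nbhs_ballP[d /= d0 dP]; exists (d / 2); first by rewrite divr_gt0.
move=> y yx; apply: dP; split => // i j; rewrite ord1.
rewrite -ball_normE /ball_ /= distrC; apply: le_lt_trans (yx j) _.
by rewrite ltr_pdivrMr // ltr_pMr // ltr1n.
Qed.

Lemma cube_nbhs x (r : R) : 0 < r ->
  nbhs x [set y | forall i, `|y 0 i - x 0 i| < r].
Proof.
move=> r0; apply/nbhs_ballP; exists r => //= y [_ yx] i.
by have := yx 0 i; rewrite -ball_normE /ball_ /= distrC.
Qed.

Lemma cube_compact x (r : R) :
  compact [set y : 'rV[R]_n | forall i, `|y 0 i - x 0 i| <= r].
Proof.
have := @rV_compact R n (fun i => `[x 0 i - r, x 0 i + r]%classic)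
  (fun i => @segment_compact _ _ _).
congr compact; apply/seteqP; split => y /= H i; have := H i;
  by rewrite in_itv /= ler_distl.
Qed.

Lemma compact_coord_bounded (K : set 'rV[R]_n) : compact K ->
  exists2 B : R, 0 < B & forall x i, K x -> `|x 0 i| <= B.
Proof.
move=> /compact_bounded[M [_ MP]]; exists (`|M| + 1); first by rewrite ltr_wpDl.
move=> x i Kx; apply: le_trans (MP _ _ _ Kx); last first.
  by rewrite (le_lt_trans (ler_norm M)) // ltrDl.
rewrite [leRHS]/Num.Def.normr /= mx_normrE.
exact: (le_bigmax _ (fun ij => `|x ij.1 ij.2|) (0, i)).
Qed.

(** Heine's theorem, for functions vanishing outside a compact set. *)
Lemma compact_support_ucont f (K : set 'rV[R]_n) : compact K ->
  (forall x, ~ K x -> f x = 0) -> continuous f -> ucont f.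
Proof.
move=> cK fK cf e e0; have e2 : 0 < e / 2 by rewrite divr_gt0.
pose P (d : R) x := forall y, (forall i, `|x 0 i - y 0 i| < d) -> `|f x - f y| <= e.
have : \forall d \near 0^'+, K `<=` P d.
  apply: ((compact_near_coveringP _).1 cK) => x _.
  have /cvgrPdist_le/(_ _ e2)/nbhs_cube[r r0 rP] := cf x.
  have r2 : 0 < r / 2 by rewrite divr_gt0.
  near=> z d => y zy.
  have zx i : `|z 0 i - x 0 i| < r / 2.
    by move: i; near: z; exact: cube_nbhs.
  have dr : d < r / 2 by near: d; exact: nbhs_right_lt.
  have -> : f z - f y = (f x - f y) - (f x - f z) by ring.
  rewrite (splitr e); apply: le_trans (ler_normB _ _) _; apply: lerD; apply: rP => i.
    have -> : y 0 i - x 0 i = (z 0 i - x 0 i) - (z 0 i - y 0 i) by ring.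
    rewrite (splitr r); apply: le_trans (ler_normB _ _) _; apply: lerD.
      by apply: ltW; exact: zx.
    by apply: ltW; apply: lt_trans (zy i) dr.
  by apply/ltW/(lt_trans (zx i)); rewrite ltr_pdivrMr // ltr_pMr // ltr1n.
move=> H; have [d [d0 dP]] : exists d : R, 0 < d /\ K `<=` P d.
  near ((0:R)^'+) => d; exists d; split; first by near: d; exact: nbhs_right_gt.
  by near: d.
exists d => // x y xy; have [Kx|nKx] := pselect (K x); first exact: (dP _ Kx).
have [Ky|nKy] := pselect (K y).
  by rewrite distrC; apply: (dP _ Ky) => i; rewrite distrC.
by rewrite !fK // subrr normr0 ltW.
Unshelve. all: by end_near. Qed.

Lemma compact_support_ucc f (K : set 'rV[R]_n) (B : R) : compact K ->
  (forall x i, K x -> `|x 0 i| <= B) ->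
  (forall x, ~ K x -> f x = 0) -> continuous f -> ucc B f.
Proof.
move=> cK KB fK cf; split; first exact: compact_support_ucont cK fK cf.
by move=> x i xi; apply: fK => Kx; have := KB x i Kx; rewrite leNgt xi.
Qed.

(** Points outside [U] have a neighbourhood, the complement of [K], on which [f]
    vanishes. *)
Lemma continuous_compact_support f (K U : set 'rV[R]_n) : open U -> compact K ->
  K `<=` U -> (forall x, ~ K x -> f x = 0) ->
  (forall x, U x -> {for x, continuous f}) -> continuous f.
Proof.
move=> oU cK KU fK cf x; have [Ux|nUx] := pselect (U x); first exact: cf.
have oK := closed_openC (compact_closed (@norm_hausdorff R 'rV[R]_n) cK).
have nK : (~` K) x by move=> /KU.
apply: (continuous_eq oK nK (f := cst 0)); last exact: cst_continuous.
by move=> y /fK ->.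
Qed.

End CompactSupport.

Section Bump.
Variable R : realType.

(** The functions obtained from [exp (- 1 / t)] by differentiating: a family
    of flat functions closed under differentiation. *)
Definition flatfun (k : nat) (t : R) : R :=
  if 0 < t then t ^- k * expR (- t^-1) else 0.

Lemma flatfun_pos k (t : R) : 0 < t -> flatfun k t = t ^- k * expR (- t^-1).
Proof. by rewrite /flatfun => ->. Qed.

Lemma flatfun_neg k (t : R) : t <= 0 -> flatfun k t = 0.
Proof. by rewrite /flatfun ltNge => ->. Qed.

Lemma flatfun_ge0 k (t : R) : 0 <= flatfun k t.
Proof.
rewrite /flatfun; case: ifP => [t0|//].
by rewrite mulr_ge0 ?expR_ge0 // invr_ge0 exprn_ge0 // ltW.
Qed.

(** The exponential dominates every power. *)
Lemma flatfun_bound k (t : R) : flatfun k t <= k.+2`!%:R * t ^+ 2.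
Proof.
have [t0|t0] := ltP 0 t; last first.
  by rewrite flatfun_neg // mulr_ge0 ?ler0n ?sqr_ge0.
rewrite flatfun_pos // expRN ler_pdivrMr ?expR_gt0 //.
have s0 : 0 < t^-1 by rewrite invr_gt0.
have f0 : 0 < k.+2`!%:R :> R by rewrite ltr0n fact_gt0.
have : t^-1 ^+ k.+2 / k.+2`!%:R <= expR t^-1.
  by apply: le_trans (expR_ge1Dxn k.+1 (ltW s0)); rewrite lerDr.
rewrite ler_pdivrMr // => H.
have -> : t ^- k = t ^+ 2 * t^-1 ^+ k.+2.
  rewrite -[k.+2]addn2 exprD mulrCA -exprMn mulfV ?gt_eqF // expr1n mulr1.
  by rewrite exprVn.
have -> : k.+2`!%:R * t ^+ 2 * expR t^-1 = t ^+ 2 * (expR t^-1 * k.+2`!%:R) by ring.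
by apply: ler_wpM2l; rewrite ?sqr_ge0.
Qed.

Lemma flatfun_derive k (t : R) : is_derive t (1 : R) (flatfun k)
  (- k%:R * flatfun k.+1 t + flatfun k.+2 t).
Proof.
have [t0|t0|t0] := ltgtP 0 t.
- have It : is_derive t (1 : R) (fun y : R => y^-1) (- t ^- 2).
    have tn0 : id t != 0 by rewrite gt_eqF.
    split; first by apply: (@derivableV _ _ id) => //; exact: derivable_id.
    have := @deriveV _ _ id t (1 : R) tn0 (@derivable_id _ _ _ _).
    by rewrite derive_id => ->; rewrite [LHS]mulr1.
  pose K : R -> R := (fun s : R => s ^+ k) * (expR \o -%R).
  have Ks : is_derive t^-1 (1 : R) K
      (t^-1 ^+ k * (expR (- t^-1) * -1) + expR (- t^-1) * (k%:R * t^-1 ^+ k.-1)).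
    have Xk : is_derive t^-1 (1 : R) (fun s : R => s ^+ k) (k%:R * t^-1 ^+ k.-1).
      split; first exact: exprn_derivable.
      by rewrite exp_derive [LHS]mulr1.
    have Ek : is_derive t^-1 (1 : R) (expR \o -%R : R -> R) (expR (- t^-1) * -1).
      exact: is_derive1_comp.
    by have := is_deriveM Xk Ek.
  have H := @is_derive1_comp _ K (fun y => y^-1) t _ _ Ks It.
  have E : (t^-1 ^+ k * (expR (- t^-1) * -1) + expR (- t^-1) * (k%:R * t^-1 ^+ k.-1))
      * - t ^- 2 = - k%:R * flatfun k.+1 t + flatfun k.+2 t.
    rewrite !flatfun_pos // -!exprVn; set s := t^-1; set e := expR _.
    by case: k {K Ks H} => [|k] /=; rewrite ?exprS; ring.
  rewrite E in H; apply: near_eq_is_derive H.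
  near=> y; have y0 : 0 < y by near: y; exact: lt_nbhsr.
  by rewrite flatfun_pos //= -exprVn.
- apply: (@near_eq_is_derive _ _ _ (cst 0)).
    near=> y; rewrite flatfun_neg //; apply: ltW; near: y; exact: lt_nbhsl.
  by rewrite !flatfun_neg ?ltW // mulr0 addr0; exact: is_derive_cst.
subst t; rewrite !flatfun_neg // mulr0 addr0.
have L : h^-1 *: ((flatfun k \o shift 0) (h *: (1 : R)) - flatfun k 0)
    @[h --> 0^'] --> (0 : R).
  apply/cvgrPdist_le => e e0.
  have f0 : 0 < k.+2`!%:R :> R by rewrite ltr0n fact_gt0.
  near=> h.
  have h0 : h != 0 by near: h; exact: nbhs_dnbhs_neq.
  have he : `|h| < e / k.+2`!%:R by near: h; apply: dnbhs0_lt; rewrite divr_gt0.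
  rewrite /= addr0 [h *: 1]mulr1 (flatfun_neg _ (lexx 0)) subr0 sub0r normrN.
  rewrite normrM normfV (ger0_norm (flatfun_ge0 _ _)).
  rewrite mulrC ler_pdivrMr ?normr_gt0 //.
  apply: le_trans (flatfun_bound k h) _; rewrite -real_normK ?num_real // expr2 mulrA.
  by rewrite ler_wpM2r // mulrC -ler_pdivlMr // ltW.
split; first by apply/cvg_ex; exists 0.
exact: cvg_lim L.
Unshelve. all: by end_near. Qed.

Variable n : nat.

Lemma flatfun_Cn m k (c a : R) (i : 'I_n) :
  Cn_on m [set: 'rV[R]_n] (fun x => flatfun k (c + a * x 0 i)).
Proof.
have aff (x : 'rV[R]_n) j : is_derive x 'e_j (fun y : 'rV[R]_n => c + a * y 0 i) (a * (j == i)%:R).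
  have E : (fun h : R => h^-1 *: (((fun y : 'rV[R]_n => c + a * y 0 i) \o shift x)
     (h *: 'e_j) - (c + a * x 0 i))) = (fun h : R => h^-1 * h * (a * (j == i)%:R)).
    apply/funext => h /=; rewrite !mxE eqxx /= [i == j]eq_sym.
    by rewrite -[_ *: _]/(_ * _); ring.
  have L : (fun h : R => h^-1 * h * (a * (j == i)%:R)) @ 0^' --> a * (j == i)%:R.
    apply: cvg_near_cst; near=> h.
    by rewrite mulVf ?mul1r //; near: h; exact: nbhs_dnbhs_neq.
  by split; rewrite /derivable /derive E; [apply/cvg_ex; exists (a * (j == i)%:R)|exact: cvg_lim].
have der k' (x : 'rV[R]_n) j : is_derive x 'e_j (fun x : 'rV[R]_n => flatfun k' (c + a * x 0 i))
    ((- k'%:R * flatfun k'.+1 (c + a * x 0 i) + flatfun k'.+2 (c + a * x 0 i))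
     * (a * (j == i)%:R)).
  have [d1 d2] := aff x j; rewrite -d2.
  by apply: derive_chain => //; exact: flatfun_derive.
have oT : open [set: 'rV[R]_n] := openT.
elim: m k => [|m IH] k; split => //; try move=> x _; try move=> j.
- apply: (@continuous_comp _ _ _ (fun y : 'rV[R]_n => c + a * y 0 i) (flatfun k)).
    apply: continuousD; first exact: cst_continuous.
    by apply: continuousM; [exact: cst_continuous|exact: coord_continuous].
  by apply/differentiable_continuous/derivable1_diffP; have [] := flatfun_derive k (c + a * x 0 i).
- apply: (@continuous_comp _ _ _ (fun y : 'rV[R]_n => c + a * y 0 i) (flatfun k)).
    apply: continuousD; first exact: cst_continuous.
    by apply: continuousM; [exact: cst_continuous|exact: coord_continuous].
  by apply/differentiable_continuous/derivable1_diffP; have [] := flatfun_derive k (c + a * x 0 i).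
split; first by move=> x _; have [] := der k x j.
apply: Cn_eq (CnM oT (CnD oT (CnM oT (Cn_cst oT m (- k%:R)) (IH k.+1)) (IH k.+2))
  (Cn_cst oT m (a * (j == i)%:R))) => // x _.
by have [_] := der k x j.
Unshelve. all: by end_near. Qed.

(** A product over the coordinates of flat functions of the distances to the two
    faces of the cube. *)
Lemma exists_bump (x0 : 'rV[R]_n) (r : R) : 0 < r ->
  exists chi : 'rV[R]_n -> R, [/\ smooth_on [set: 'rV[R]_n] chi,
    forall x, 0 <= chi x, 0 < chi x0 &
    forall x : 'rV[R]_n, ~ (forall i, `|x 0 i - x0 0 i| <= r) -> chi x = 0].
Proof.
move=> r0; have oT : open [set: 'rV[R]_n] := openT.
pose b i (x : 'rV[R]_n) := flatfun 0 (r - x0 0 i + 1 * x 0 i) *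
   flatfun 0 (r + x0 0 i + (-1) * x 0 i).
exists (fun x => \prod_i b i x); split.
- move=> k; have : Cn_on k [set: 'rV[R]_n] (\prod_i b i).
    elim/big_ind: _ => [|f g|i _]; [exact: Cn_cst|exact: CnM|].
    exact: CnM (flatfun_Cn _ _ _ _ _) (flatfun_Cn _ _ _ _ _).
  by apply: Cn_eq => // x _; rewrite fct_prodE.
- by move=> x; apply: prodr_ge0 => i _; rewrite mulr_ge0 ?flatfun_ge0.
- apply: prodr_gt0 => i _; rewrite /b mul1r mulN1r subrK addrK.
  by rewrite !flatfun_pos // !mulr_gt0 ?expR_gt0 // invr_gt0 exprn_gt0.
move=> x /existsNP[i] /negP; rewrite -ltNge => xi.
rewrite (bigD1 i) //= /b; have [x1|x1] := leP (r - x0 0 i + 1 * x 0 i) 0.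
  by rewrite flatfun_neg // !mul0r.
rewrite [X in _ * X * _]flatfun_neg ?mulr0 ?mul0r //.
move: xi x1; case: (lerP 0 (x 0 i - x0 0 i)) => h.
  by rewrite ger0_norm //; lra.
by rewrite ltr0_norm //; lra.
Qed.

End Bump.

(** * Positive definite forms and orthonormal bases *)

Section InnerProduct.
Variables (R : realType) (n : nat) (g : 'M[R]_n).
Hypothesis gsym : g^T = g.
Hypothesis gpos : forall v : 'rV[R]_n, v != 0 -> 0 < (v *m g *m v^T) 0 0.
Implicit Types (u v w : 'rV[R]_n) (P : {vspace 'rV[R]_n}).

Lemma ginnerC u v : ginner g u v = ginner g v u.
Proof.
rewrite /ginner -[in RHS]gsym -(trmxK v) -trmx_mul -trmx_mul trmxK mulmxA.
by rewrite [in RHS]mxE.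
Qed.

Lemma ginner_sumr (I : finType) u (v : I -> 'rV[R]_n) :
  ginner g u (\sum_i v i) = \sum_i ginner g u (v i).
Proof. by rewrite /ginner raddf_sum /= mulmx_sumr summxE. Qed.

Lemma ginnerZr u v c : ginner g u (c *: v) = c * ginner g u v.
Proof. by rewrite /ginner linearZ /= -scalemxAr mxE. Qed.

Lemma ginnerBr u v w : ginner g u (v - w) = ginner g u v - ginner g u w.
Proof. by rewrite /ginner raddfB /= mulmxBr mxE [X in _ + X]mxE. Qed.

Lemma ginner_linear v : linear (fun u => ginner g u v : R^o).
Proof.
by move=> c x y; rewrite /ginner !mulmxDl mxE -!scalemxAl mxE.
Qed.

Definition ginner_hom v : 'Hom('rV[R]_n, R^o) :=
  linfun (HB.pack_for {linear 'rV[R]_n -> R^o} (fun u => ginner g u v : R^o)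
    (GRing.isLinear.Build _ _ _ _ (fun u => ginner g u v : R^o) (ginner_linear v))).

Lemma ginner_homE v u : ginner_hom v u = ginner g u v.
Proof. by rewrite lfunE. Qed.

Lemma ginner_normalize v : v != 0 ->
  ginner g ((Num.sqrt (ginner g v v))^-1 *: v) ((Num.sqrt (ginner g v v))^-1 *: v) = 1.
Proof.
move=> v0; have q0 : 0 < ginner g v v by exact: gpos.
rewrite ginnerZr ginnerC ginnerZr mulrA -invfM -expr2 sqr_sqrtr ?ltW //.
by rewrite mulVf // gt_eqF.
Qed.

(** Gram-Schmidt: the rest of the basis is found in the kernel of the inner
    product with a unit vector. *)
Lemma exists_orthonormal (m : nat) P : \dim P = m ->
  exists e : 'I_m -> 'rV[R]_n, orthonormal_basis g [set v | v \in P] e.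
Proof.
elim: m P => [|m IH] P dP.
  exists (fun=> 0); split; try by case.
  move=> v /= vP; exists (fun=> 0); rewrite big_ord0.
  by apply/eqP; rewrite -memv0 -(eqP (_ : P == 0%VS)) // -dimv_eq0 dP.
have P0 : P != 0%VS by rewrite -dimv_eq0 dP.
have v0 : vpick P != 0 by rewrite vpick0.
pose e0 := (Num.sqrt (ginner g (vpick P) (vpick P)))^-1 *: vpick P.
have e00 : ginner g e0 e0 = 1 by exact: ginner_normalize.
have e0P : e0 \in P by rewrite memvZ // memv_pick.
have fe0 : ginner_hom e0 e0 = 1 by rewrite ginner_homE.
have dQ : \dim (P :&: lker (ginner_hom e0)) = m.
  have := limg_ker_dim (ginner_hom e0) P; rewrite dP.
  suff -> : \dim (ginner_hom e0 @: P) = 1%N by rewrite addn1 => -[].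
  apply/eqP; rewrite eqn_leq; apply/andP; split.
    by apply: leq_trans (dimvS (subvf _)) _; rewrite dimvf /dim /=.
  rewrite lt0n dimv_eq0; apply/eqP => E.
  have := memv_img (ginner_hom e0) e0P; rewrite E memv0 fe0.
  by rewrite oner_eq0.
have [e [eQ eO eS]] := IH _ dQ.
have eP i : e i \in P by have := eQ i; rewrite /= memv_cap => /andP[].
have ee0 i : ginner g (e i) e0 = 0.
  have := eQ i; rewrite /= memv_cap memv_ker => /andP[_ /eqP].
  by rewrite ginner_homE.
exists (fun i => if unlift ord0 i is Some j then e j else e0); split.
- by move=> i; case: (unlift _ _) => //= j; exact: eP.
- move=> i j; case: (unliftP ord0 i) => [i' ->|->]; case: (unliftP ord0 j) => [j' ->|->].
  + by rewrite eO (inj_eq lift_inj).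
  + by rewrite ee0 eq_sym (negbTE (neq_lift _ _)).
  + by rewrite ginnerC ee0 (negbTE (neq_lift _ _)).
  + by rewrite eqxx e00.
move=> v /= vP; pose w := v - ginner g v e0 *: e0.
have [|c wc] := eS w.
  rewrite /= memv_cap memv_ker; apply/andP; split.
    by rewrite rpredB // memvZ.
  rewrite ginner_homE ginnerC ginnerBr ginnerZr e00 ginnerC.
  by rewrite mulr1 subrr.
exists (fun i => if unlift ord0 i is Some j then c j else ginner g v e0).
rewrite big_ord_recl unlift_none; under eq_bigr do rewrite liftK.
by rewrite -wc /w addrC subrK.
Qed.

Lemma orthonormal_coef m (e : 'I_m -> 'rV[R]_n) c i :
  (forall i j, ginner g (e i) (e j) = (i == j)%:R) ->
  ginner g (e i) (\sum_j c j *: e j) = c i.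
Proof.
move=> eO; rewrite ginner_sumr (bigD1 i) //= ginnerZr eO eqxx mulr1.
by rewrite big1 ?addr0 // => j ji; rewrite ginnerZr eO eq_sym (negbTE ji) mulr0.
Qed.

(** The inner products with an orthonormal basis of [P] form a surjective linear
    map, whose kernel is the orthogonal complement. *)
Lemma gperp_vspace P (d : nat) : \dim P = d -> (d <= n)%N ->
  exists2 Q : {vspace 'rV[R]_n}, \dim Q = (n - d)%N &
    [set v | v \in Q] = gperp g P.
Proof.
move=> dP dn; have [e [eP eO eS]] := exists_orthonormal dP.
pose F : 'rV[R]_n -> 'rV[R]_d := fun v => \row_i ginner g v (e i).
have Flin : linear F.
  move=> c x y; apply/rowP => i; rewrite !mxE.
  exact: ginner_linear.
pose f : 'Hom('rV[R]_n, 'rV[R]_d) := linfun (HB.pack_for {linear 'rV[R]_n -> 'rV[R]_d}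
  F (GRing.isLinear.Build _ _ _ _ F Flin)).
have fE v : f v = F v by rewrite lfunE.
have fker v : (v \in lker f) = [forall i, ginner g v (e i) == 0].
  rewrite memv_ker fE; apply/eqP/forallP => [/rowP H i|H].
    by have := H i; rewrite !mxE => ->.
  by apply/rowP => i; rewrite !mxE; exact/eqP.
have fS (c : 'rV[R]_d) : f (\sum_i c 0 i *: e i) = c.
  rewrite fE; apply/rowP => i; rewrite mxE ginnerC orthonormal_coef //.
exists (lker f).
  have := limg_ker_dim f fullv; rewrite capfv dimvf /dim /= mul1n.
  suff -> : limg f = fullv.
    by rewrite dimvf /dim /= mul1n => E; rewrite -[in RHS]E addnK.
  apply/vspaceP => c; rewrite memvf -(fS c); exact/memv_img/memvf.
apply/seteqP; split => v /=.
  rewrite fker => /forallP H w wP; have [c ->] := eS w wP.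
  by rewrite ginner_sumr big1 // => i _; rewrite ginnerZr (eqP (H i)) mulr0.
move=> H; rewrite fker; apply/forallP => i; apply/eqP/H; exact: eP.
Qed.

(** Parseval: both sides are inverse to [g], since expanding a vector in the
    orthonormal basis formed by [e] and [nu] gives it back. *)
Lemma orthonormal_complete P m m' (e : 'I_m -> 'rV[R]_n) (nu : 'I_m' -> 'rV[R]_n) :
  orthonormal_basis g [set v | v \in P] e -> orthonormal_basis g (gperp g P) nu ->
  \sum_i (e i)^T *m e i + \sum_j (nu j)^T *m nu j = invmx g.
Proof.
move=> [eP eO eS] [nP nO nS].
set C := _ + _.
have vC v : v *m g *m C = \sum_i ginner g v (e i) *: e i + \sum_j ginner g v (nu j) *: nu j.
  rewrite mulmxDr !mulmx_sumr; congr (_ + _); apply: eq_bigr => i _.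
    by rewrite mulmxA [_ *m (e i)^T]mx11_scalar mul_scalar_mx.
  by rewrite mulmxA [_ *m (nu i)^T]mx11_scalar mul_scalar_mx.
have H v : v *m g *m C = v.
  pose p := \sum_i ginner g v (e i) *: e i.
  have pe i : ginner g (e i) p = ginner g v (e i) by rewrite /p orthonormal_coef.
  have [|c cE] := nS (v - p).
    move=> w /eS[c ->]; rewrite ginner_sumr big1 // => i _.
    by rewrite ginnerZr ginnerC ginnerBr pe ginnerC subrr mulr0.
  have vE : v = p + \sum_j c j *: nu j by rewrite -cE addrC subrK.
  rewrite vC -/p [in RHS]vE; congr (_ + _); apply: eq_bigr => j _; congr (_ *: _).
  have np : ginner g (nu j) p = 0.
    rewrite /p ginner_sumr big1 // => i _; rewrite ginnerZr (nP j) ?mulr0 //; exact: eP.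
  rewrite ginnerC vE -[p]opprK addrC ginnerBr orthonormal_coef //.
  by rewrite -[- p]scaleN1r ginnerZr np mulr0 subr0.
have gC : g *m C = 1%:M.
  by apply/row_matrixP => i; rewrite rowE mulmxA H row1.
have [gU _] := mulmx1_unit gC.
by rewrite -[C]mul1mx -(mulVmx gU) -mulmxA gC mulmx1.
Qed.

(** The rows of [B] are an orthonormal basis. *)
Lemma posdef_square_root : exists B : 'M[R]_n, B *m g *m B^T = 1%:M.
Proof.
have dn : \dim (fullv : {vspace 'rV[R]_n}) = n by rewrite dimvf /dim /= mul1n.
have [e [_ eO _]] := exists_orthonormal dn.
exists (\matrix_(i, j) e i 0 j); apply/matrixP => i j.
rewrite [RHS]mxE -eO /ginner [LHS]mxE [RHS]mxE; apply: eq_bigr => q _.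
by rewrite !mxE; congr (_ * _); apply: eq_bigr => r _; rewrite mxE.
Qed.

Lemma posdef_invmx : exists2 B : 'M[R]_n, B \in unitmx & invmx g = B^T *m B.
Proof.
have [B BgB] := posdef_square_root.
have [BU _] : B \in unitmx /\ g *m B^T \in unitmx.
  by apply: mulmx1_unit; rewrite mulmxA.
have gBB : g *m (B^T *m B) = 1%:M by rewrite mulmxA; apply: mulmx1C; rewrite mulmxA.
have [gU _] := mulmx1_unit gBB; exists B => //.
by rewrite -[RHS]mul1mx -(mulVmx gU) -mulmxA gBB mulmx1.
Qed.

Lemma posdef_det : 0 < \det g.
Proof.
have [B BgB] := posdef_square_root.
have := congr1 determinant BgB; rewrite !det_mulmx det_tr det1 mulrAC -expr2 => E.
have B2 : 0 < (\det B) ^+ 2.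
  rewrite lt0r sqr_ge0 andbT; apply/eqP => B0; move/eqP: E.
  by rewrite B0 mul0r eq_sym oner_eq0.
by rewrite -(pmulr_rgt0 _ B2) E.
Qed.

Lemma posdef_unit : g \in unitmx.
Proof. by rewrite unitmxE unitfE gt_eqF // posdef_det. Qed.

Lemma posdef_factor : exists2 C : 'M[R]_n, C \in unitmx & g = C^T *m C.
Proof.
have [B BU E] := posdef_invmx; exists ((invmx B)^T).
  by rewrite unitmx_tr unitmx_inv.
have gU := posdef_unit; rewrite trmxK.
have H : g *m (B^T *m B) = 1%:M by rewrite -E mulmxV.
have BtU : B^T \in unitmx by rewrite unitmx_tr.
rewrite -[LHS]mulmx1 -[X in _ *m X](_ : (B^T *m B) *m (invmx B *m invmx B^T) = 1%:M).
  by rewrite mulmxA H mul1mx trmx_inv.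
by rewrite mulmxA -(mulmxA B^T) mulmxV // mulmx1 mulmxV.
Qed.

End InnerProduct.

Section TensorNorm.
Variables (R : realType) (n k : nat) (C : 'M[R]_n).
Hypothesis CU : C \in unitmx.
Implicit Type T : {ffun 'I_k -> 'I_n} -> R.

Lemma tdot_ge0 T : 0 <= tdot T T.
Proof. by apply: sumr_ge0 => I _; rewrite -expr2 sqr_ge0. Qed.

Lemma tdot_factor T : tdot T (tmap (C^T *m C) T) = tdot (tmap C T) (tmap C T).
Proof. by rewrite -tmap_comp tdot_tmap trmxK. Qed.

Lemma tnorm_ge0 T : 0 <= tdot T (tmap (C^T *m C) T).
Proof. by rewrite tdot_factor tdot_ge0. Qed.

Lemma tnorm_eq0 T : tdot T (tmap (C^T *m C) T) = 0 -> T = fun=> 0.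
Proof.
rewrite tdot_factor => /eqP; rewrite psumr_eq0 => [/allP H|I _]; last first.
  by rewrite -expr2 sqr_ge0.
have CT : tmap C T = fun=> 0.
  apply/funext => I; have /H : I \in index_enum _ by rewrite mem_index_enum.
  by rewrite /= mulf_eq0 orbb => /eqP.
rewrite -[T]tmap1 -(mulVmx CU) -tmap_comp CT; apply/funext => I.
by rewrite /tmap big1 // => J _; rewrite mulr0.
Qed.

End TensorNorm.

(** With [B^T *m B] the inverse of the metric [C^T *m C], this is the squared norm
    of a covariant derivative: a sum of squared norms in an orthonormal basis. *)
Lemma gradient_norm_ge0 (R : realType) n k (B C : 'M[R]_n)
    (X : 'I_n -> {ffun 'I_k -> 'I_n} -> R) :
  0 <= \sum_a \sum_b (B^T *m B) a b * tdot (X a) (tmap (C^T *m C) (X b)).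
Proof.
set g := C^T *m C.
have -> : \sum_a \sum_b (B^T *m B) a b * tdot (X a) (tmap g (X b)) =
    \sum_q tdot (\sum_a tscale (B q a) (X a)) (tmap g (\sum_b tscale (B q b) (X b))).
  under [RHS]eq_bigr do rewrite tdot_suml.
  rewrite [RHS]exchange_big; apply: eq_bigr => a _ /=.
  under [RHS]eq_bigr do rewrite tmap_sum tdotC tdot_suml.
  rewrite [RHS]exchange_big; apply: eq_bigr => b _ /=.
  rewrite mxE mulr_suml; apply: eq_bigr => q _.
  rewrite mxE [in RHS]tdotC tdotZl tmapZ [in RHS]tdotC tdotZl mulrA.
  by rewrite [tdot (X a) _]tdotC.
by apply: sumr_ge0 => q _; exact: tnorm_ge0.
Qed.

Section Wedge.
Variables (R : realType) (n d : nat).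
Implicit Types (v e : 'I_d -> 'rV[R]_n).

Definition vspan v : {vspace 'rV[R]_n} := <<[tuple v i | i < d]>>%VS.

(** Linearly dependent vectors have vanishing minors. *)
Lemma wedge_free v I : wedge v I != 0 -> \dim (vspan v) = d.
Proof.
move=> vI; have : free [tuple v i | i < d].
  apply/freeP => c c0; set M := \matrix_(i, j) v i 0 (I j).
  have cM : (\row_i c i) *m M = 0.
    apply/rowP => j; transitivity ((\sum_(k < d) c k *: [tuple v i | i < d]`_k) 0 (I j)).
      rewrite summxE mxE; apply: eq_bigr => i _.
      by rewrite !mxE -tnth_nth tnth_mktuple.
    by rewrite c0 !mxE.
  move=> i; have : \row_i c i = 0.
    have MU : M \in unitmx by rewrite unitmxE unitfE.
    by rewrite -[LHS]mulmx1 -(mulmxV MU) mulmxA cM mul0mx.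
  by move=> /rowP/(_ i); rewrite !mxE.
by rewrite /free size_tuple => /eqP.
Qed.

(** The factor is the determinant of the coordinates of [v] with respect to [e]. *)
Lemma wedge_span v e : (forall w, w \in vspan v -> exists c : 'I_d -> R, w = \sum_i c i *: e i) ->
  exists c : R, wedge v = tscale c (wedge e).
Proof.
move=> H; have cP i : exists c : 'I_d -> R, v i = \sum_j c j *: e j.
  by apply: H; apply: memv_span; apply/mapP; exists i; rewrite // mem_enum.
have [C CP] := choice cP.
exists (\det (\matrix_(i, j) C i j)); apply/funext => I.
rewrite /wedge /tscale -det_mulmx; congr (\det _).
apply/matrixP => i j; rewrite !mxE CP summxE; apply: eq_bigr => l _.
by rewrite !mxE.
Qed.

End Wedge.

(** * The codifferential in a chart *)

Section TensorMorphism.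
Variables (A B : comNzRingType) (f : {rmorphism A -> B}) (n : nat).
Local Notation idx k := {ffun 'I_k -> 'I_n}.
Local Notation tens k := (idx k -> A).

Definition tmor k (T : tens k) : idx k -> B := fun I => f (T I).

Lemma tmorD k (T S : tens k) : tmor (T + S) = tmor T + tmor S.
Proof. by apply/funext => I; rewrite /tmor tDE rmorphD. Qed.

Lemma tmorN k (T : tens k) : tmor (- T) = - tmor T.
Proof. by apply/funext => I; rewrite /tmor tNE rmorphN. Qed.

Lemma tmor_sum k (J : finType) (F : J -> tens k) :
  tmor (\sum_j F j) = \sum_j tmor (F j).
Proof. by apply/funext => I; rewrite /tmor !tsumE rmorph_sum. Qed.

Lemma tmor_tmap k M (T : tens k) : tmor (tmap M T) = tmap (map_mx f M) (tmor T).
Proof.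
apply/funext => I; rewrite /tmor /tmap rmorph_sum; apply: eq_bigr => J _.
rewrite rmorphM rmorph_prod; congr (_ * _).
by apply: eq_bigr => l _; rewrite mxE.
Qed.

Lemma tmor_eps k v (T : tens k) : tmor (eps v T) = eps (fun i => f (v i)) (tmor T).
Proof.
apply/funext => I; rewrite /tmor /eps rmorph_sum; apply: eq_bigr => j _.
by rewrite !rmorphM rmorph_sign.
Qed.

Lemma tmor_act k M (T : tens k) : tmor (act M T) = act (map_mx f M) (tmor T).
Proof.
apply/funext => I; rewrite /tmor /act rmorph_sum; apply: eq_bigr => l _.
by rewrite rmorph_sum; apply: eq_bigr => m _; rewrite rmorphM mxE.
Qed.

Lemma tmor_dot k (T S : tens k) : f (tdot T S) = tdot (tmor T) (tmor S).
Proof. by rewrite rmorph_sum; apply: eq_bigr => I _; rewrite rmorphM. Qed.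

Lemma tmor_alt k (T : tens k) : alternating T -> alternating (tmor T).
Proof. by move=> aT s I; rewrite /tmor aT rmorphM rmorph_sign. Qed.

End TensorMorphism.

Section CompactlySupported.
Variables (R : realType) (n : nat).
Implicit Types (f : 'rV[R]_n -> R) (U K : set 'rV[R]_n).

Lemma Cn_sub k f U U' : U' `<=` U -> Cn_on k U f -> Cn_on k U' f.
Proof.
move=> UU; elim: k f => [|k IH] f [cf df]; split; try by [].
- by move=> x /UU; exact: cf.
- by move=> x /UU; exact: cf.
move=> i; have [fi Ci] := df i; split; last exact: IH.
by move=> x /UU; exact: fi.
Qed.

Lemma zero_partial f K i x : compact K -> (forall x, ~ K x -> f x = 0) -> ~ K x ->
  derivable f x 'e_i /\ partial i f x = 0.
Proof.
move=> cK fK nK.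
have oK := closed_openC (compact_closed (@norm_hausdorff R 'rV[R]_n) cK).
split.
  by apply: (derivable_eq oK (f := cst 0) nK) => [y /fK ->|] //; exact: derivable_cst.
by rewrite (partial_eq oK i (g := cst 0) nK) // /partial derive_cst.
Qed.

(** Extension by zero. *)
Lemma Cn_compact_support k f U K : open U -> compact K -> K `<=` U ->
  (forall x, ~ K x -> f x = 0) -> Cn_on k U f -> Cn_on k setT f.
Proof.
move=> oU cK KU; elim: k f => [|k IH] f fK [cf df];
  have cfT : continuous f by exact: (continuous_compact_support oU cK KU fK cf).
  by split=> // x _; exact: cfT.
split=> [x _|i]; first exact: cfT.
have [fi Ci] := df i; split=> [x _|].
  have [Kx|nKx] := pselect (K x); first exact/fi/KU.
  by have [] := zero_partial i cK fK nKx.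
by apply: IH => // x nKx; have [] := zero_partial i cK fK nKx.
Qed.

Lemma ucc_compact_support f U K (B : R) : open U -> compact K -> K `<=` U ->
  (forall x i, K x -> `|x 0 i| <= B) ->
  (forall x, ~ K x -> f x = 0) -> Cn_on 0 U f -> ucc B f.
Proof.
move=> oU cK KU KB fK [cf _]; apply: (compact_support_ucc cK KB fK).
exact: (continuous_compact_support oU cK KU fK cf).
Qed.

Lemma integral_partial_compact f U K (B : R) i : 0 < B -> open U -> compact K ->
  K `<=` U -> (forall x i, K x -> `|x 0 i| <= B) ->
  (forall x, ~ K x -> f x = 0) -> Cn_on 1 U f ->
  ucc B (partial i f) /\ integral_rV (partial i f) = 0.
Proof.
move=> B0 oU cK KU KB fK Cf; have [_ dfU] := Cf; have [_ Cfi] := dfU i.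
have up : ucc B (partial i f).
  apply: (ucc_compact_support oU cK KU KB _ Cfi) => x nKx.
  by have [] := zero_partial i cK fK nKx.
split=> //; apply: (integral_partial B0) => //.
  exact: (ucc_compact_support oU cK KU KB fK (CnS Cf)).
have [_ df] := Cn_compact_support oU cK KU fK Cf; have [fi _] := df i.
by move=> x; exact: fi.
Qed.

Lemma ucc_sum (B : R) (J : Type) (r : seq J) (F : J -> 'rV[R]_n -> R) : 0 < B ->
  (forall j, ucc B (F j)) -> ucc B (fun x => \sum_(j <- r) F j x) /\
  integral_rV (fun x => \sum_(j <- r) F j x) = \sum_(j <- r) integral_rV (F j).
Proof.
move=> B0 uF; elim: r => [|j r [IH1 IH2]].
  rewrite big_nil; under eq_fun do rewrite big_nil.
  rewrite integral_rV0; split=> //; split=> // e e0.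
  by exists 1 => // x y _; rewrite subrr normr0 ltW.
rewrite big_cons -IH2 -(integral_rVD B0 (uF j) IH1).
by under eq_fun do rewrite big_cons; split=> //; exact: uccD.
Qed.

End CompactlySupported.

Section Chart.
Variables (R : realType) (n : nat) (U : set 'rV[R]_n) (oU : open U).
Variable G : 'rV[R]_n -> 'M[R]_n.
Hypothesis Gsym : forall x, U x -> (G x)^T = G x.
Hypothesis Gpos : forall x (v : 'rV[R]_n), U x -> v != 0 -> 0 < (v *m G x *m v^T) 0 0.
Hypothesis Gsmooth : forall i j, smooth_on U (fun x => G x i j).
Local Notation A := (smoothfun oU).
Local Notation idx k := {ffun 'I_k -> 'I_n}.
Local Notation tens k := (idx k -> A).
Local Notation tsev x T := (tmor (sev x) T).

(** Replacing the metric by the identity matrix outside the chart makes its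
    determinant a unit of the ring of smooth functions. *)
Definition Gcut (x : 'rV[R]_n) : 'M[R]_n := if `[< U x >] then G x else 1%:M.

Lemma GcutE x : U x -> Gcut x = G x.
Proof. by rewrite /Gcut; case: asboolP. Qed.

Lemma Gcut_smooth i j : smooth_on U (fun x => Gcut x i j).
Proof. by move=> k; apply: Cn_eq (Gsmooth i j k) => // y Uy; rewrite GcutE. Qed.

Definition gS : 'M[A]_n := \matrix_(i, j) mk_smooth oU (Gcut_smooth i j).

Lemma sev_gcut x : map_mx (sev x) gS = Gcut x.
Proof. by apply/matrixP => i j; rewrite !mxE /sev mk_smoothE. Qed.

Lemma sev_gS x : U x -> map_mx (sev x) gS = G x.
Proof. by move=> Ux; rewrite sev_gcut GcutE. Qed.

Lemma det_gS_gt0 x : 0 < sev x (\det gS).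
Proof.
rewrite -det_map_mx sev_gcut /Gcut; case: asboolP => [Ux|_].
  by apply: posdef_det => [|v v0]; [exact: Gsym|exact: Gpos].
by rewrite det1 ltr01.
Qed.

Lemma sev_neq0 (f : A) : (forall x, 0 < sev x f) -> forall x, U x -> \val f x != 0.
Proof. by move=> f0 x _; rewrite gt_eqF //; exact: f0. Qed.

Definition sinv (f : A) (f0 : forall x, 0 < sev x f) : A :=
  mk_smooth oU (fun k => CnV oU (sev_neq0 f0) (smooth_val f k)).

Lemma mul_sinv f (f0 : forall x, 0 < sev x f) : f * sinv f0 = 1.
Proof.
apply: smooth_ext => x; rewrite rmorphM rmorph1 /= [sev x (sinv _)]/sev mk_smoothE.
by rewrite mulfV // gt_eqF.
Qed.

Definition ginvS : 'M[A]_n := sinv det_gS_gt0 *: \adj gS.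

Lemma ginvS_gS : ginvS *m gS = 1%:M.
Proof. by rewrite -scalemxAl mul_adj_mx scale_scalar_mx mulrC mul_sinv. Qed.

Lemma gS_sym : gS^T = gS.
Proof.
apply/matrixP => i j; apply: smooth_ext => x.
transitivity ((map_mx (sev x) gS) j i); first by rewrite !mxE.
transitivity ((map_mx (sev x) gS) i j); last by rewrite mxE.
rewrite sev_gcut /Gcut; case: asboolP => [Ux|_]; last by rewrite !mxE eq_sym.
by rewrite -[in LHS](Gsym Ux) mxE.
Qed.

Lemma sev_ginvS x : U x -> map_mx (sev x) ginvS = invmx (G x).
Proof.
move=> Ux; have := congr1 (map_mx (sev x)) ginvS_gS; rewrite map_mxM sev_gS //.
rewrite map_mx1 => H; have [_ gU] := mulmx1_unit H.
by rewrite -[LHS]mulmx1 -(mulmxV gU) mulmxA H mul1mx.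
Qed.

Definition sqS : A := mk_smooth oU (fun k => Cn_sqrt oU (fun x _ => det_gS_gt0 x)
  (smooth_val (\det gS) k)).

Lemma sev_sq x : sev x sqS = Num.sqrt (sev x (\det gS)).
Proof. by rewrite /sev mk_smoothE. Qed.

Lemma sq_gt0 x : 0 < sev x sqS.
Proof. by rewrite sev_sq sqrtr_gt0 det_gS_gt0. Qed.

Lemma sqSE x : U x -> sev x sqS = Num.sqrt (\det (G x)).
Proof. by move=> Ux; rewrite sev_sq -det_map_mx sev_gS. Qed.

Lemma sqS2 : sqS * sqS = \det gS.
Proof.
apply: smooth_ext => x; rewrite rmorphM /= sev_sq -expr2 sqr_sqrtr // ltW //.
exact: det_gS_gt0.
Qed.

Definition cS (c : R) : A := mk_smooth oU (fun k => Cn_cst oU k c).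

Lemma sev_cS x c : sev x (cS c) = c.
Proof. by rewrite /sev mk_smoothE. Qed.

Lemma sder_cS i c : sder i (cS c) = 0.
Proof.
apply: smooth_ext => x; rewrite rmorph0; have [Ux|nUx] := pselect (U x).
  by rewrite /= sev_sder // mk_smoothE /partial derive_cst.
exact: sder_out.
Qed.

Lemma cS_half : cS 2^-1 + cS 2^-1 = 1.
Proof.
by apply: smooth_ext => x; rewrite rmorphD rmorph1 /= sev_cS; lra.
Qed.

Local Notation D := (@sder R n U oU).
Local Notation DD := (@sder_morph R n U oU).
Local Notation DM := (@sderM R n U oU).
Local Notation DC := (@sderC R n U oU).
Local Notation half := (cS 2^-1).
Local Notation div_ := (dvg D gS ginvS half).

Definition mk_field k (t : tfield R n k) (st : smooth_tfield U t) : tens k :=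
  fun I => mk_smooth oU (st I).

Lemma mk_fieldE k (t : tfield R n k) (st : smooth_tfield U t) x :
  tsev x (mk_field st) = t x.
Proof. by apply/funext => I; rewrite /tmor /= /sev mk_smoothE. Qed.

Lemma sev_smooth k (T : tens k) I : smooth_on U (fun x => tsev x T I).
Proof. exact: smooth_val. Qed.

(** The integrand of the L^2 product, as an element of the ring: this provides its
    smoothness and lets the identities of the tensor calculus apply to it. *)
Definition L2S k (T S : tens k) : A :=
  cS (k`!%:R)^-1 * (tdot T (tmap ginvS S) * sqS).

Lemma form_innerE (g : 'M[R]_n) k (T S : tensor R n k) :
  form_inner g T S = (k`!%:R)^-1 * tdot T (tmap (invmx g) S).
Proof.
congr (_ * _); rewrite /tdot; apply: eq_bigr => I _; rewrite mulr_sumr.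
by apply: eq_bigr => J _; rewrite mulrAC mulrC mulrA mulrAC.
Qed.

Lemma sev_L2S k (T S : tens k) x : U x ->
  form_inner (G x) (tsev x T) (tsev x S) * Num.sqrt (\det (G x)) = sev x (L2S T S).
Proof.
move=> Ux; rewrite form_innerE !rmorphM /= sev_cS sqSE // (tmor_dot (sev x)) tmor_tmap.
by rewrite sev_ginvS // mulrA.
Qed.

Definition L2_integrand k (w t : tfield R n k) (x : 'rV[R]_n) : R :=
  form_inner (G x) (w x) (t x) * Num.sqrt (\det (G x)).

Section Compact.
Variables (K : set 'rV[R]_n) (B : R).
Hypothesis cK : compact K.
Hypothesis KU : K `<=` U.
Hypothesis B0 : 0 < B.
Hypothesis KB : forall x i, K x -> `|x 0 i| <= B.

Lemma L2_integrand_ucc k (w t : tfield R n k) : smooth_tfield U w ->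
  smooth_tfield U t -> (forall x, ~ K x -> forall I, w x I = 0) ->
  ucc B (L2_integrand w t).
Proof.
move=> sw st wK; apply: (ucc_compact_support oU cK KU KB).
  move=> x /wK w0; rewrite /L2_integrand form_innerE /tdot big1 ?mulr0 ?mul0r //.
  by move=> I _; rewrite w0 mul0r.
apply: (Cn_eq oU _ (smooth_val (L2S (mk_field sw) (mk_field st)) 0)) => x Ux.
by rewrite -/(sev x _) -sev_L2S // !mk_fieldE.
Qed.

End Compact.

Definition is_codiff k (w : tfield R n k.+1) (t : tfield R n k) :=
  [/\ forall x, U x -> alternating_tensor (t x), smooth_tfield U t &
      forall eta : tfield R n k, test_form U eta ->
        L2_inner G (ext_deriv eta) w = L2_inner G eta t].

Lemma smooth_sub (f : 'rV[R]_n -> R) : smooth_on setT f -> smooth_on U f.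
Proof. by move=> sf k; apply: Cn_sub (sf k). Qed.

(** Testing against the difference of the candidates, multiplied by a bump
    function, makes the difference of the two pairings the integral of a
    nonnegative continuous function. *)
Lemma codiff_unique k (w : tfield R n k.+1) t1 t2 : is_codiff w t1 -> is_codiff w t2 ->
  forall x, U x -> t1 x = t2 x.
Proof.
move=> [a1 s1 c1] [a2 s2 c2] x0 Ux0; apply: contrapT => ne.
have [r r0 rP] := nbhs_cube (open_nbhs_nbhs (conj oU Ux0)).
have [chi [schi chi0 chix0 chiK]] := exists_bump x0 r0.
pose K := [set y : 'rV[R]_n | forall i, `|y 0 i - x0 0 i| <= r].
have cK : compact K by exact: cube_compact.
have KU : K `<=` U by move=> y Ky; exact: rP.
have [B B0 KB] := compact_coord_bounded cK.
pose tau : tfield R n k := fun x I => t1 x I - t2 x I.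
pose eta : tfield R n k := fun x I => chi x * tau x I.
have etaK x : ~ K x -> forall I, eta x I = 0.
  by move=> nK I; rewrite /eta chiK ?mul0r.
have stau : smooth_tfield U tau.
  by move=> I j; apply: CnD => //; [exact: s1|apply: CnN => //; exact: s2].
have seta : smooth_tfield setT eta.
  move=> I j; apply: (Cn_compact_support oU cK KU) => [x nK|].
    exact: etaK.
  by apply: CnM => //; [exact: smooth_sub|exact: stau].
have setaU : smooth_tfield U eta by move=> I; exact: smooth_sub.
have teta : test_form U eta.
  split=> // [x s I|]; last by exists K.
  have [Kx|nKx] := pselect (K x); last by rewrite !etaK // mulr0.
  have Ux := KU _ Kx.
  by rewrite /eta /tau (a1 _ Ux) (a2 _ Ux) -mulrBr mulrCA.
have := c1 _ teta; rewrite (c2 _ teta) /L2_inner -!/(L2_integrand _ _ _) => /eqP.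
rewrite eq_sym -subr_eq0 -(integral_rVB B0); last 2 first.
- exact: (L2_integrand_ucc cK KU KB setaU s1 etaK).
- exact: (L2_integrand_ucc cK KU KB setaU s2 etaK).
set f := fun x => _ - _.
have fE x : f x = chi x * ((k`!%:R)^-1 * tdot (tau x) (tmap (invmx (G x)) (tau x))) *
    Num.sqrt (\det (G x)).
  rewrite /f /L2_integrand !form_innerE -mulrBl -mulrBr.
  have -> : tmap (invmx (G x)) (tau x) =
      tmap (invmx (G x)) (t1 x) + - tmap (invmx (G x)) (t2 x) by rewrite -tmapN -tmapD.
  rewrite [eta x](_ : _ = tscale (chi x) (tau x)) // !tdotZl tdotDr -mulrBr.
  by rewrite mulrCA; congr (_ * (_ * (_ + _)) * _); rewrite tdotC -tdotNl tdotC.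
have fpos x : U x -> 0 <= f x /\ (f x = 0 -> chi x = 0 \/ tau x = fun=> 0).
  move=> Ux; have gs := Gsym Ux; have gp v := @Gpos x v Ux.
  have sq0 : 0 < Num.sqrt (\det (G x)) by rewrite sqrtr_gt0; exact: posdef_det.
  have k0 : 0 < (k`!%:R : R)^-1 by rewrite invr_gt0 ltr0n fact_gt0.
  rewrite fE; have [C CU ->] := posdef_invmx gs gp; split.
    by rewrite !mulr_ge0 ?(ltW sq0) ?(ltW k0) ?tnorm_ge0.
  move=> /eqP; rewrite !mulf_eq0 (gt_eqF sq0) (gt_eqF k0) orbF /=.
  by case/orP => /eqP; [left|right; exact: tnorm_eq0 CU _ _].
apply/negP; rewrite gt_eqF //; apply: (integral_rV_gt0 B0 (x := x0)).
- apply: uccB.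
  + exact: (L2_integrand_ucc cK KU KB setaU s1 etaK).
  + exact: (L2_integrand_ucc cK KU KB setaU s2 etaK).
- move=> x; have [Kx|nKx] := pselect (K x); first by have [] := fpos x (KU _ Kx).
  by rewrite fE chiK // !mul0r.
have [f0 fN] := fpos _ Ux0; rewrite lt0r f0 andbT; apply/eqP => /fN[c0|t0].
  by rewrite c0 ltxx in chix0.
apply: ne; apply/funext => I; apply/eqP; rewrite -subr_eq0; apply/eqP.
by have := congr1 (fun T => T I) t0.
Qed.

(** By [adjoint_divergence] the two integrands differ by a sum of partial
    derivatives of compactly supported functions. *)
Lemma is_codiff_dvg k (W : tens k.+1) (w : tfield R n k.+1) : alternating W ->
  (forall x, U x -> w x = tsev x (tmap gS W)) ->
  is_codiff w (fun x => tsev x (tmap gS (- div_ W))).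
Proof.
move=> aW wE.
have adiv : alternating (div_ W).
  by apply: alt_sum => b; apply: alt_iota; exact: (alt_nab DD DM _ _ _ _ aW).
split=> [x Ux||eta [aeta seta [K [cK KU etaK]]]].
- by apply: tmor_alt; apply: alt_tmap; exact: altN.
- by move=> I; exact: sev_smooth.
have [B B0 KB] := compact_coord_bounded cK.
have setaU : smooth_tfield U eta by move=> I; exact: smooth_sub.
pose e := mk_field setaU.
have eE x : tsev x e = eta x by rewrite mk_fieldE.
pose F a : A := cS (k`!%:R)^-1 * (sqS * tdot e (iota a W)).
have FK a x : ~ K x -> sev x (F a) = 0.
  move=> nK; rewrite !rmorphM /= (tmor_dot (sev x)) eE /tdot big1 ?mulr0 //.
  by move=> I _; rewrite etaK ?mul0r.
have dF a := integral_partial_compact a B0 oU cK KU KB (FK a) (smooth_val (F a) 1).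
pose t : tfield R n k := fun x => tsev x (tmap gS (- div_ W)).
have ut : ucc B (L2_integrand eta t).
  by apply: (L2_integrand_ucc cK KU KB setaU _ etaK) => I; exact: sev_smooth.
have [us Is] := ucc_sum (index_enum _) B0 (fun a => (dF a).1).
transitivity (integral_rV (fun x => L2_integrand eta t x +
   \sum_a partial a (\val (F a)) x)); last first.
  rewrite (integral_rVD B0 ut us) Is big1 ?addr0 // => a _; exact: (dF a).2.
congr integral_rV; apply/funext => x.
have [Kx|nKx] := pselect (K x); last first.
  rewrite -/(L2_integrand _ _ _) /L2_integrand !form_innerE /tdot big1 ?mulr0 ?mul0r => [|I _].
    rewrite big1 ?mulr0 ?mul0r ?add0r => [|I _]; last by rewrite etaK ?mul0r.
    rewrite big1 // => a _.
    by have [] := zero_partial a cK (FK a) nKx.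
  rewrite /ext_deriv big1 ?mul0r // => j _.
  have [|_ ->] := zero_partial (f := fun y => eta y [ffun l => I (lift j l)]) (I j) cK _ nKx.
    by move=> y nKy; rewrite etaK.
  by rewrite mulr0.
have Ux := KU _ Kx.
have -> : ext_deriv eta x = tsev x (ext D e).
  apply/funext => I; rewrite /tmor rmorph_sum; apply: eq_bigr => j _.
  rewrite rmorphM rmorph_sign /= (sev_sder _ _ Ux) mk_smoothE //.
rewrite wE // sev_L2S // /L2_integrand -eE sev_L2S //.
have -> : \sum_a partial a (\val (F a)) x = sev x (\sum_a D a (F a)).
  by rewrite rmorph_sum; apply: eq_bigr => a _; rewrite /= sev_sder.
rewrite -(rmorphD (sev x)) /=; congr (sev x _); rewrite /L2S !tmap_comp ginvS_gS !tmap1.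
have -> : \sum_a D a (F a) = cS (k`!%:R)^-1 * (sqS *
    (\sum_a tdot (Dt D a e) (iota a W) + tdot e (div_ W))).
  rewrite -(adjoint_divergence DD DM gS_sym ginvS_gS cS_half _ sqS2 (mul_sinv sq_gt0) aW).
  by rewrite mulr_sumr; apply: eq_bigr => a _; rewrite /F DM sder_cS mul0r add0r.
have -> : tdot (ext D e) W = k.+1%:R * \sum_a tdot (Dt D a e) (iota a W).
  rewrite extE tdot_suml mulr_sumr; apply: eq_bigr => a _; rewrite tdot_eps //.
  rewrite (bigD1 a) //= /kron eqxx mul1r big1 ?addr0 // => b ba.
  by rewrite (negbTE ba) mul0r.
have -> : cS (k`!%:R)^-1 = cS (k.+1`!%:R)^-1 * k.+1%:R.
  apply: smooth_ext => y; rewrite rmorphM rmorph_nat /= !sev_cS factS natrM.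
  by rewrite invfM mulrC mulrA mulfV ?mul1r // pnatr_eq0.
rewrite [tdot e (- _)]tdotC tdotNl [tdot (div_ W) e]tdotC.
by ring.
Qed.

(** The codifferential is determined by [codiff_unique], and minus the metric
    divergence has its defining property. *)
Lemma codiffE k (W : tens k.+1) (w : tfield R n k.+1) x : alternating W ->
  (forall x, U x -> w x = tsev x (tmap gS W)) -> U x ->
  codiff G U w x = tsev x (tmap gS (- div_ W)).
Proof.
move=> aW wE Ux; have H := is_codiff_dvg aW wE.
apply: (codiff_unique _ H Ux); apply: (xgetPex (P := is_codiff w) (fun _ _ => 0)).
by exists (fun x => tsev x (tmap gS (- div_ W))).
Qed.



(** * Harmonic fields at a maximum, in a chart *)

Local Notation gam_ := (gam D gS ginvS half).
Local Notation Riem_ := (Riem D gS ginvS half).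

Lemma val_gS i j y : U y -> \val (gS i j) y = G y i j.
Proof. by move=> Uy; rewrite -(sev_gS Uy) !mxE. Qed.

Lemma sev_gam i j k x : U x -> sev x (gam_ i k j) = christoffel G k i j x.
Proof.
move=> Ux; rewrite mxE rmorphM /= sev_cS rmorph_sum; congr (_ * _).
apply: eq_bigr => l _; rewrite rmorphM rmorphB rmorphD /= !(sev_sder _ _ Ux).
congr (_ * _); first by rewrite -(sev_ginvS Ux) [RHS]mxE.
have P m p q : partial m (\val (gS p q)) x = partial m (fun y => G y p q) x.
  by apply: (partial_eq oU m Ux) => y Uy; exact: val_gS.
by rewrite !P.
Qed.

Definition curv x a b : 'M[R]_n := map_mx (sev x) (Riem_ a b).

Lemma curvE x a b k j : curv x a b k j =
  sev x (D a (gam_ b k j)) + \sum_l sev x (gam_ a k l) * sev x (gam_ b l j) -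
  (sev x (D b (gam_ a k j)) + \sum_l sev x (gam_ b k l) * sev x (gam_ a l j)).
Proof.
have S (f h : 'I_n -> A) : sev x (\sum_l f l * h l) = \sum_l sev x (f l) * sev x (h l).
  by rewrite rmorph_sum; apply: eq_bigr => l _; rewrite rmorphM.
rewrite /curv /Riem; move: gam_ => Gm; rewrite !mxE rmorphD !rmorphB /= !S.
by rewrite opprD addrACA.
Qed.

(** Fields with constant components commute, and their covariant derivatives are
    given by Christoffel symbols alone. *)
Lemma riemann_cst x (u v z : 'rV[R]_n) : U x ->
  riemann G (cst u) (cst v) (cst z) x =
  \row_k \sum_a \sum_b u 0 a * v 0 b * (curv x a b *m z^T) k 0.
Proof.
move=> Ux.
pose Y (v : 'rV[R]_n) k : A := \sum_i \sum_j gam_ i k j * cS (v 0 i) * cS (z 0 j).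
have nY (w : 'rV[R]_n) k y : U y -> nabla G (cst w) (cst z) y 0 k = sev y (Y w k).
  move=> Uy; rewrite mxE big1 ?add0r => [|i _].
    rewrite rmorph_sum; apply: eq_bigr => i _; rewrite rmorph_sum.
    apply: eq_bigr => j _; rewrite !rmorphM /= !sev_cS sev_gam //.
  by rewrite [X in _ * X](_ : _ = 0) ?mulr0 // /partial derive_cst.
have nnY (w t : 'rV[R]_n) k : nabla G (cst w) (nabla G (cst t) (cst z)) x 0 k =
    \sum_a \sum_b w 0 a * t 0 b *
      \sum_j (sev x (D a (gam_ b k j)) +
              \sum_l sev x (gam_ a k l) * sev x (gam_ b l j)) * z 0 j.
  rewrite mxE -big_split; apply: eq_bigr => a _ /=.
  rewrite [X in _ * X + _](_ : _ = sev x (D a (Y t k))); last first.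
    by rewrite sev_sder //; apply: (partial_eq oU a Ux) => y Uy; exact: nY.
  have -> : D a (Y t k) = \sum_b \sum_j D a (gam_ b k j) * cS (t 0 b) * cS (z 0 j).
    rewrite (Dsum DD); apply: eq_bigr => b _; rewrite (Dsum DD).
    by apply: eq_bigr => j _; rewrite !DM !sder_cS !mulr0 !addr0.
  have -> : \sum_j christoffel G k a j x * cst w x 0 a * nabla G (cst t) (cst z) x 0 j =
      \sum_b \sum_j w 0 a * t 0 b * ((\sum_l sev x (gam_ a k l) * sev x (gam_ b l j)) * z 0 j).
    under eq_bigr => l _ do rewrite nY // rmorph_sum mulr_sumr.
    rewrite exchange_big; apply: eq_bigr => b _ /=.
    under eq_bigr => l _ do rewrite rmorph_sum mulr_sumr.
    rewrite exchange_big; apply: eq_bigr => j _ /=.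
    rewrite mulr_suml mulr_sumr; apply: eq_bigr => l _.
    rewrite !rmorphM /= !sev_cS -sev_gam //; ring.
  rewrite rmorph_sum mulr_sumr -big_split; apply: eq_bigr => b _ /=.
  rewrite rmorph_sum !mulr_sumr -big_split; apply: eq_bigr => j _ /=.
  by rewrite !rmorphM /= !sev_cS mulrDl mulrDr; congr (_ + _); ring.
rewrite /riemann; apply/rowP => k; rewrite mxE [X in _ + X]mxE [X in _ - X]mxE.
rewrite [X in _ - (X + _)]big1 => [|i _]; last first.
  rewrite [lie_bracket _ _ _ _ _]mxE big1 ?mul0r // => j _.
  by rewrite /partial !derive_cst !mulr0 subr0.
rewrite [X in _ - (_ + X)]big1 => [|i _]; last first.
  rewrite big1 // => l _; rewrite [lie_bracket _ _ _ _ _]mxE big1 ?mulr0 ?mul0r // => j _.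
  by rewrite /partial !derive_cst !mulr0 subr0.
rewrite addr0 subr0 mxE [X in _ + X]mxE !nnY [RHS]mxE.
rewrite [X in _ - X]exchange_big -sumrB; apply: eq_bigr => a _ /=.
rewrite -sumrB; apply: eq_bigr => b _ /=.
rewrite [v 0 b * u 0 a]mulrC [in RHS]mxE.
rewrite -mulrBr -sumrB; congr (_ * _); apply: eq_bigr => j _.
by rewrite [z^T j 0]mxE -mulrBl curvE.
Qed.

Lemma sectionalE x (u v : 'rV[R]_n) : U x ->
  sectional G x u v = riem4 (G x) (curv x) u v v u.
Proof.
move=> Ux; rewrite /sectional ginnerC; last exact: Gsym.
rewrite /ginner riemann_cst // /riem4 mxE.
under eq_bigr => k _ do rewrite [X in _ * X]mxE [X in _ * X]mxE mulr_sumr.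
rewrite exchange_big; apply: eq_bigr => a _ /=.
under eq_bigr => k _ do rewrite mulr_sumr.
rewrite exchange_big; apply: eq_bigr => b _ /=.
rewrite -mulmxA [in RHS]mxE mulr_sumr; apply: eq_bigr => k _.
by rewrite mulrCA.
Qed.

Lemma curvC x a b : curv x b a = - curv x a b.
Proof. by rewrite /curv RiemC map_mxN. Qed.

Lemma curv_anti x a b : U x -> (curv x a b)^T *m G x + G x *m curv x a b = 0.
Proof.
move=> Ux; have := congr1 (map_mx (sev x)) (Riem_anti DD DM DC gS_sym ginvS_gS cS_half a b).
by rewrite map_mxD !map_mxM map_trmx sev_gS // map_mx0.
Qed.

(** The curvature term of the Weitzenboeck formula, evaluated at a point. *)
Definition curvature_term k x (T : idx k.+1 -> R) : idx k.+1 -> R :=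
  \sum_a \sum_b eps (mcol (invmx (G x)) a) (iota b (act (curv x a b) T)).

Lemma curvature_termZ k x c (T : idx k.+1 -> R) :
  curvature_term x (tscale c T) = tscale c (curvature_term x T).
Proof.
apply/funext => I; rewrite /curvature_term tsumE /tscale tsumE mulr_sumr.
apply: eq_bigr => a _; rewrite !tsumE mulr_sumr; apply: eq_bigr => b _.
by rewrite (actZ (curv x a b) c T) iotaZ epsZr.
Qed.

Section Field.
Variables (k : nat) (V : tfield R n k.+2).
Hypothesis Valt : forall x, U x -> alternating_tensor (V x).
Hypothesis Vsmooth : smooth_tfield U V.

(** The field is cut off outside [U] in order to be alternating as a tensor over
    the ring. *)
Definition VS : tens k.+2 := fun I => mk_smooth oU (cut_smooth oU (Vsmooth I)).

Lemma sev_VS x : U x -> tsev x VS = V x.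
Proof. by move=> Ux; apply/funext => I; rewrite /tmor /= /sev mk_smoothE cutE. Qed.

Lemma norm_smooth : smooth_on U (fun y => tdot (V y) (tmap (G y) (V y))).
Proof.
move=> j; apply: (Cn_eq oU _ (smooth_val (tdot VS (tmap gS VS)) j)) => y Uy.
by rewrite -/(sev y _) (tmor_dot (sev y)) tmor_tmap sev_gS // sev_VS.
Qed.

Lemma VS_alt : alternating VS.
Proof.
move=> s I; apply: smooth_ext => x; rewrite rmorphM rmorph_sign /= /sev !mk_smoothE.
rewrite /cut; case: asboolP => [Ux|_]; last by rewrite mulr0.
exact: Valt.
Qed.

Lemma ext_deriv_sev m (w : tfield R n m) (W : tens m) x :
  (forall y, U y -> w y = tsev y W) -> U x -> ext_deriv w x = tsev x (ext D W).
Proof.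
move=> wW Ux; apply/funext => I; rewrite /tmor rmorph_sum; apply: eq_bigr => j _.
rewrite rmorphM rmorph_sign /= (sev_sder _ _ Ux); congr (_ * _).
by apply: (partial_eq oU _ Ux) => y Uy; rewrite wW.
Qed.

(** Both codifferentials are divergences by [codiffE], and by [ext_flat] the
    exterior derivative of a flat is the flat of [extd]; what remains is minus the
    left-hand side of the Weitzenboeck formula. *)
Lemma hodge_laplacianE x : U x -> hodge_laplacian G U V x =
  tsev x (- (rough_laplacian D gS ginvS half VS +
    \sum_a \sum_b eps (mcol ginvS a) (iota b (act (Riem_ a b) VS)))).
Proof.
move=> Ux; rewrite -(weitzenboeck DD DM DC gS_sym ginvS_gS cS_half).
set E := extd D gS ginvS half; set dv := dvg D gS ginvS half.
have flatE y : U y -> flat G V y = tsev y (tmap gS VS).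
  by move=> Uy; rewrite tmor_tmap sev_gS // sev_VS.
have cE y : U y -> codiff G U (flat G V) y = tsev y (tmap gS (- dv _ VS)).
  by move=> Uy; rewrite (codiffE VS_alt).
have adv : alternating (dv _ VS).
  by apply: alt_sum => b; apply: alt_iota; exact: (alt_nab DD DM _ _ _ _ VS_alt).
have aE : alternating (E _ VS).
  by apply: alt_sum => b; apply: alt_eps; exact: (alt_nab DD DM _ _ _ _ VS_alt).
have L1 : ext_deriv (codiff G U (flat G V)) x = tsev x (tmap gS (- E _ (dv _ VS))).
  rewrite (ext_deriv_sev cE Ux) (ext_flat DD DM gS_sym ginvS_gS cS_half (altN adv)).
  by rewrite (extdN DD).
have L2 : codiff G U (ext_deriv (flat G V)) x = tsev x (tmap gS (- dv _ (E _ VS))).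
  rewrite (codiffE aE) // => y Uy.
  by rewrite (ext_deriv_sev flatE Uy) (ext_flat DD DM gS_sym ginvS_gS cS_half VS_alt).
rewrite /hodge_laplacian /sharp /= L1 L2.
transitivity (tmap (invmx (G x)) (tsev x (tmap gS (- E _ (dv _ VS))) +
  tsev x (tmap gS (- dv _ (E _ VS))))) => //.
rewrite -tmorD -tmapD -sev_ginvS // -tmor_tmap tmap_comp ginvS_gS tmap1.
by rewrite opprD.
Qed.

(** At a maximum the gradient of the squared norm vanishes and its Hessian is
    nonpositive, so in the Bochner identity the nonnegative norm of the covariant
    derivative forces the other term to be nonpositive. *)
Lemma rough_laplacian_max x0 : U x0 ->
  (forall y, U y -> tdot (V y) (tmap (G y) (V y)) <= tdot (V x0) (tmap (G x0) (V x0))) ->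
  tdot (tsev x0 (rough_laplacian D gS ginvS half VS)) (tmap (G x0) (V x0)) <= 0.
Proof.
move=> Ux0 Vmax; pose N := tdot VS (tmap gS VS).
have NE y : U y -> \val N y = tdot (V y) (tmap (G y) (V y)).
  by move=> Uy; rewrite -/(sev y N) (tmor_dot (sev y)) tmor_tmap sev_gS // sev_VS.
have Nmax y : U y -> \val N y <= \val N x0 by move=> Uy; rewrite !NE // Vmax.
have DN0 a : sev x0 (D a N) = 0.
  by rewrite sev_sder //; exact: (partial_max oU a (smooth_val N 1) Ux0 Nmax).
have DDN a b : sev x0 (D a (D b N)) = partial a (partial b (\val N)) x0.
  by rewrite sev_sder //; apply: (partial_eq oU a Ux0) => y Uy; exact: sder_val.
have [B BU EB] := posdef_invmx (Gsym Ux0) (fun v => @Gpos x0 v Ux0).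
have [C CU EC] := posdef_factor (Gsym Ux0) (fun v => @Gpos x0 v Ux0).
have H : \sum_a \sum_b (B^T *m B) a b * sev x0 (D a (D b N)) <= 0.
  have -> : \sum_a \sum_b (B^T *m B) a b * sev x0 (D a (D b N)) =
      \sum_q \sum_b \sum_a (row q B) 0 b * (row q B) 0 a *
        partial a (partial b (\val N)) x0.
    rewrite exchange_big [RHS]exchange_big; apply: eq_bigr => b _ /=.
    rewrite [RHS]exchange_big; apply: eq_bigr => a _ /=.
    rewrite DDN mxE mulr_suml; apply: eq_bigr => q _.
    by rewrite !mxE [B q b * _]mulrC.
  apply: sumr_le0 => q _.
  exact: (hessian_max oU (row q B) (smooth_val N 2) Ux0 Nmax).
have := congr1 (sev x0) (bochner DD DM gS_sym ginvS_gS cS_half VS).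
rewrite /= -/N; set E := (tdot (rough_laplacian _ _ _ _ _) _ + _).
have -> : sev x0 (\sum_a \sum_b ginvS a b * D a (D b N)) =
    \sum_a \sum_b (B^T *m B) a b * sev x0 (D a (D b N)).
  rewrite rmorph_sum; apply: eq_bigr => a _; rewrite rmorph_sum.
  apply: eq_bigr => b _; rewrite rmorphM -EB -(sev_ginvS Ux0); congr (_ * _).
  by rewrite [RHS]mxE.
set Z := \sum_a \sum_b \sum_m _.
have -> : sev x0 (E + E + Z) = sev x0 E + sev x0 E.
  rewrite !rmorphD /= [sev x0 Z](_ : _ = 0) ?addr0 //.
  rewrite rmorph_sum big1 // => a _; rewrite rmorph_sum big1 // => b _.
  by rewrite rmorph_sum big1 // => m _; rewrite rmorphM /= DN0 mulr0.
move=> HE; rewrite HE in H.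
have E0 : sev x0 E <= 0 by move: (sev x0 E) H => r; lra.
move: E0; rewrite /E rmorphD /= (tmor_dot (sev x0)) tmor_tmap sev_gS // sev_VS //.
set r := tdot _ _; set q := sev x0 _; suff : 0 <= q by lra.
have -> : q = \sum_a \sum_b (B^T *m B) a b *
   tdot (tsev x0 (nab D gS ginvS half a VS))
     (tmap (C^T *m C) (tsev x0 (nab D gS ginvS half b VS))).
  rewrite /q rmorph_sum; apply: eq_bigr => a _; rewrite rmorph_sum.
  apply: eq_bigr => b _; rewrite rmorphM -EB -EC -(sev_ginvS Ux0); congr (_ * _).
    by rewrite [RHS]mxE.
  by rewrite /= (tmor_dot (sev x0)) tmor_tmap sev_gS.
exact: gradient_norm_ge0.
Qed.

(** For a harmonic field the rough Laplacian is minus the curvature term, whose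
    pairing with [V] is minus [c ^+ 2] times a positive multiple of the normal
    Ricci sum. *)
Lemma harmonic_max x0 m (e : 'I_k.+2 -> 'rV[R]_n) (nu : 'I_m -> 'rV[R]_n) (c : R) :
  U x0 ->
  (forall y, U y -> tdot (V y) (tmap (G y) (V y)) <= tdot (V x0) (tmap (G x0) (V x0))) ->
  (forall I, hodge_laplacian G U V x0 I = 0) ->
  V x0 = tscale c (wdg e) ->
  (forall i j, ginner (G x0) (e i) (e j) = (i == j)%:R) ->
  \sum_j (e j)^T *m e j + \sum_al (nu al)^T *m nu al = invmx (G x0) ->
  0 < \sum_i \sum_j sectional G x0 (e i) (nu j) -> c = 0.
Proof.
move=> Ux0 Vmax harm VE eO complete sect.
have r0 := rough_laplacian_max Ux0 Vmax.
have [gU _] : invmx (G x0) \in unitmx /\ G x0 \in unitmx.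
  have := posdef_unit (Gsym Ux0) (fun v => @Gpos x0 v Ux0).
  by rewrite unitmx_inv.
have gi : invmx (G x0) *m G x0 = 1%:M by rewrite mulVmx // -unitmx_inv.
have h2 : (2^-1 + 2^-1 : R) = 1 by lra.
have cw := curvature_wdg (Gsym Ux0) gi h2 (curvC x0) (fun a b => curv_anti a b Ux0) eO complete.
have rE : tsev x0 (rough_laplacian D gS ginvS half VS) = - curvature_term x0 (V x0).
  apply/funext => I; have := harm I; rewrite hodge_laplacianE // tmorN tmorD tNE tDE.
  have -> : tsev x0 (\sum_a \sum_b eps (mcol ginvS a) (iota b (act (Riem_ a b) VS))) =
      curvature_term x0 (V x0).
    rewrite tmor_sum; apply: eq_bigr => a _; rewrite tmor_sum; apply: eq_bigr => b _.
    rewrite tmor_eps -(sev_VS Ux0) -tmor_act; congr eps.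
    apply/funext => i; rewrite -(sev_ginvS Ux0) /mcol [RHS]mxE //.
  by rewrite tNE; move: (tmor _ _ _) (curvature_term _ _ _) => p q; lra.
move: r0; rewrite rE VE curvature_termZ tmapZ.
rewrite tdotNl tdotZl tdotC tdotZl tdotC cw.
under eq_bigr do under eq_bigr do rewrite -sectionalE //.
set S := \sum_i _ in sect *; have F0 : 0 < k.+2`!%:R * S.
  by rewrite mulr_gt0 // ltr0n fact_gt0.
move: (_ * S) F0 => F F0; rewrite mulrA -expr2 mulrN opprK pmulr_lle0 //.
by move=> c0; apply/eqP; rewrite -sqrf_eq0 eq_le c0 sqr_ge0.
Qed.

End Field.

End Chart.

(** * The maximum principle on the manifold *)

Section Global.
Variables (R : realType) (n : nat) (M : topologicalType) (A : smoothAtlas R n M).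
Variables (g : riemMetric A) (d : nat) (V : multivectorField d A).

Definition sqnorm (a : chart A) (x : 'rV[R]_n) : R :=
  tdot (V a x) (tmap (g a x) (V a x)).

(** The Jacobian matrices in the transformation laws of the metric and of the
    field cancel. *)
Lemma sqnorm_change a b p : dom a p -> dom b p ->
  sqnorm b (phi b p) = sqnorm a (phi a p).
Proof.
move=> ap bp; rewrite /sqnorm (gmx_change g ap bp).
have -> : V b (phi b p) = tmap (jac a b p)^T (V a (phi a p)).
  apply/funext => I; rewrite (mv_change V ap bp); apply: eq_bigr => J _.
  by congr (_ * _); apply: eq_bigr => l _; rewrite [RHS]mxE.
rewrite -!tmap_comp [RHS]tdot_tmap; move: (tmap _^T _) => W.
by [].
Qed.

Lemma sqnorm_ge0 a p : dom a p -> 0 <= sqnorm a (phi a p).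
Proof.
move=> /phi_img Ux; have [C _ EC] := posdef_factor (gmx_sym g Ux) (fun v => @gmx_posdef _ _ _ _ g _ _ v Ux).
by rewrite /sqnorm EC tnorm_ge0.
Qed.

Lemma sqnorm_eq0 a p : dom a p -> sqnorm a (phi a p) <= 0 -> V a (phi a p) = fun=> 0.
Proof.
move=> ap s0; have Ux := phi_img ap.
have [C CU EC] := posdef_factor (gmx_sym g Ux) (fun v => @gmx_posdef _ _ _ _ g _ _ v Ux).
apply: (tnorm_eq0 CU); rewrite -EC; apply/eqP; rewrite eq_le s0.
exact: sqnorm_ge0.
Qed.

Lemma exists_normal_bases a p (P : {vspace 'rV[R]_n}) : dom a p -> \dim P = d ->
  (d <= n)%N -> exists (e : 'I_d -> 'rV[R]_n) (nu : 'I_(n - d) -> 'rV[R]_n),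
    orthonormal_basis (g a (phi a p)) [set v | v \in P] e /\
    orthonormal_basis (g a (phi a p)) (gperp (g a (phi a p)) P) nu.
Proof.
move=> /phi_img Ux dP dn; have gs := gmx_sym g Ux.
have gp := fun v => @gmx_posdef _ _ _ _ g _ _ v Ux.
have [e eP] := exists_orthonormal gs gp dP.
have [Q dQ EQ] := gperp_vspace gs gp dP dn.
have [nu nuP] := exists_orthonormal gs gp dQ.
by exists e, nu; rewrite -EQ.
Qed.

(** The bases are those behind the value which [mean_normal_ricci] selects; it
    does select such a value because adapted bases exist. *)
Lemma kappa_pos_bases a p (P : {vspace 'rV[R]_n}) : (0 < d < n)%N ->
  (0 < kappa d g)%E -> dom a p -> \dim P = d ->
  exists (e : 'I_d -> 'rV[R]_n) (nu : 'I_(n - d) -> 'rV[R]_n),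
    [/\ orthonormal_basis (g a (phi a p)) [set v | v \in P] e,
        orthonormal_basis (g a (phi a p)) (gperp (g a (phi a p)) P) nu &
        0 < \sum_i \sum_j sectional (g a) (phi a p) (e i) (nu j)].
Proof.
move=> /andP[d0 dn] kpos ap dP.
have m0 : 0 < ((d * (n - d))%:R : R) by rewrite ltr0n muln_gt0 d0 subn_gt0.
have rpos : 0 < mean_normal_ricci d (g a) (phi a p) P.
  rewrite ltNge; apply/negP => r0; move: kpos; rewrite ltNge => /negP; apply.
  apply: mule_ge0_le0; first by rewrite lee_fin ltW.
  apply: (@le_trans _ _ (mean_normal_ricci d (g a) (phi a p) P)%:E); last by rewrite lee_fin.
  by apply: ereal_inf_lbound; exists p, a, P.
move: rpos; rewrite /mean_normal_ricci; set S := [set r | _].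
have : S (get S).
  apply: getPex; have [e [nu [eP nuP]]] := exists_normal_bases ap dP (ltnW dn).
  by eexists; exists e, nu; split; [exact: eP|exact: nuP|].
move=> [e [nu [eP nuP ->]]] rpos; exists e, nu; split=> //.
by rewrite pmulr_rgt0 ?invr_gt0 in rpos.
Qed.

End Global.

Section MaximumPrinciple.
Variables (R : realType) (n : nat) (M : topologicalType) (A : smoothAtlas R n M).
Variables (g : riemMetric A) (k : nat) (V : multivectorField k.+2 A).

(** The chart [c p] may vary wildly with [p], but by [sqnorm_change] a fixed chart
    can be used near each point. *)
Lemma sqnorm_continuous (c : M -> chart A) : (forall p, dom (c p) p) ->
  continuous (fun p => sqnorm g V (c p) (phi (c p) p)).
Proof.
move=> cP p; set a := c p.
have ap : dom a p := cP p.
have cf : {for phi a p, continuous (sqnorm g V a)}.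
  have := norm_smooth (@img_open _ _ _ A a) (gmx_smooth g a) (mv_smooth V a) 0%N.
  by move=> [H _]; apply: H; exact: phi_img.
have oa : nbhs p (dom a) by apply: open_nbhs_nbhs; split=> //; exact: dom_open.
have E : \forall q \near p, sqnorm g V a (phi a q) = sqnorm g V (c q) (phi (c q) q).
  by apply: filterS oa => q aq; exact: sqnorm_change.
rewrite /continuous_at; apply: cvg_trans; first exact: (near_eq_cvg E).
exact: (continuous_comp (phi_cont ap) cf).
Qed.

(** The squared norm attains its maximum, at a point where [V] is a multiple of the
    wedge of any orthonormal basis of the subspace spanned by its factors; the
    maximum principle [harmonic_max] makes that multiple zero. *)
Lemma simple_harmonic_vanish : compact [set: M] -> (k.+2 < n)%N ->
  (0 < kappa k.+2 g)%E -> simple_mv V -> harmonic_mv g V ->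
  forall p a, dom a p -> V a (phi a p) = fun=> 0.
Proof.
move=> cM kn kpos simpleV harmonicV p a ap.
have [c cP] := choice (@atlas_cover _ _ _ A).
have cT : {within [set: M], continuous (fun p => sqnorm g V (c p) (phi (c p) p))}.
  by apply: continuous_subspaceT; exact: sqnorm_continuous.
have [p0 _ pmax] := compact_EVT_max (ex_intro _ p I) cM cT.
set a0 := c p0 in pmax; set x0 := phi a0 p0 in pmax.
have ap0 : dom a0 p0 := cP p0.
have Ux0 : img a0 x0 by exact: phi_img.
suff V0 : V a0 x0 = fun=> 0.
  apply: (sqnorm_eq0 (g := g)) => //; rewrite (sqnorm_change g V (cP p) ap).
  apply: le_trans (pmax p (mem_set Logic.I)) _.
  by rewrite /sqnorm V0 /tdot big1 // => J _; rewrite mul0r.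
have Vmax y : img a0 y -> sqnorm g V a0 y <= sqnorm g V a0 x0.
  move=> Uy; have dy := psi_dom Uy.
  have := pmax (psi a0 y) (mem_set Logic.I).
  by rewrite (sqnorm_change g V dy (cP _)) psiK.
have [v Vv] := simpleV p0 a0 ap0.
apply: contrapT => V0.
have [I VI] : exists I, wedge v I != 0.
  apply: contrapT => H; apply: V0; rewrite Vv; apply/funext => I.
  by apply/eqP; apply: contrapT => /negP H'; apply: H; exists I.
have dP := wedge_free VI.
have kn' : (0 < k.+2 < n)%N by [].
have [e [nu [eP nuP spos]]] := kappa_pos_bases (p := p0) kn' kpos ap0 dP.
have [_ eO eS] := eP.
have [s Vs] := wedge_span eS.
have gs := gmx_sym g Ux0.
have s0 : s = 0.
  apply: (harmonic_max (@img_open _ _ _ A a0) (gmx_sym g (a:=a0)) (@gmx_posdef _ _ _ _ g a0)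
    (gmx_smooth g a0) (fun x => @mv_alt _ _ _ _ _ V a0 x) (mv_smooth V a0) Ux0 Vmax (harmonicV p0 a0 ap0)
    _ eO (orthonormal_complete gs eP nuP) spos).
  by rewrite Vv Vs.
by apply: V0; rewrite Vv Vs s0; apply/funext => J; rewrite /tscale mul0r.
Qed.

End MaximumPrinciple.

Theorem corollary2 (R : realType) (n d : nat) (M : topologicalType)
    (A : smoothAtlas R n M) (g : riemMetric A)
    (hausdorffM : hausdorff_space M) (compactM : compact [set: M]%classic)
    (hd2 : (2 <= d)%N) (hdn : (d <= n - 1)%N)
    (hkappa : (0 < kappa d g)%E)
    (V : multivectorField d A) (simpleV : simple_mv V)
    (harmonicV : harmonic_mv g V) :
  forall (p : M) (a : chart A), dom a p ->
    forall I : {ffun 'I_d -> 'I_n}, V a (phi a p) I = 0%R.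
Proof.
case: d hd2 hdn hkappa V simpleV harmonicV => [|[|k]] // _ kn kpos V sV hV p a ap I.
have kn' : (k.+2 < n)%N by case: n I kn {A g V sV hV kpos a ap} => [|m] // I; rewrite subn1.
by rewrite (simple_harmonic_vanish compactM kn' kpos sV hV ap).
Qed.
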